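(* Let $\Sigma\Subset\mathbb{S}$ be a nonempty open set. If $\mathbf f\in L^2(\mathbb S,\mathbb R^d)$ is tangent on $\Sigma$ and $\operatorname{div}_{\mathbb S}(\mathbf f)|_{\Sigma}=0$, then its Hardy component $\mathbf f_+$ is in $B_+(U_\Sigma^+)$ and its Hardy component $\mathbf f_-$ is in $B_-(U_\Sigma^-)$. Conversely, for every $\mathbf f_+\in B_+(U_\Sigma^+)$ there is a unique $\mathbf f_-\in B_-(U_\Sigma^-)$ such that $\mathbf f_++\mathbf f_-$ is tangent and divergence-free on $\Sigma$. Likewise, for every $\mathbf f_-\in B_-(U_\Sigma^-)$ there is a unique $\mathbf f_+\in B_+(U_\Sigma^+)$ such that $\mathbf f_++\mathbf f_-$ is tangent and divergence-free on $\Sigma$.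
   Context: Let $d\ge 3$, let $\mathbb S$ be the unit sphere in $\mathbb R^d$ with surface measure $\omega$, $\omega_d=\omega(\mathbb S)$, and outward unit normal field $\mathbf n$. $L^2(\mathbb S)$ is the space of square-integrable functions on $\mathbb S$ and $L^2(\mathbb S,\mathbb R^d)$ the space of square-integrable $\mathbb R^d$-valued vector fields on $\mathbb S$, with canonical inner products. For a subspace $H\subseteq L^2(\mathbb S)$, $H/\langle 1\rangle$ denotes the subspace $\{f\in H:\langle f,1\rangle=0\}$ of functions with zero mean. $\nabla_{\mathbb S}$ is the surface gradient, $I$ the identity. $\Sigma\Subset\mathbb S$ means that $\Sigma$ and its closure $\overline\Sigma$ are both proper subsets of $\mathbb S$. For open $\Sigma\subseteq\mathbb S$, $L^2(\Sigma)\subseteq L^2(\mathbb S)$ is the subspace of functions vanishing a.e. outside $\Sigma$, $P=P_\Sigma$ is the orthogonal projection of $L^2(\mathbb S)$ onto $L^2(\Sigma)$, and $C_c^\infty(\Sigma)$ is the set of smooth functions on $\mathbb S$ with compact support in $\Sigma$. A field $\mathbf f\in L^2(\mathbb S,\mathbb R^d)$ is tangent on $\Sigma$ if $\mathbf n\cdot\mathbf f=0$ a.e. on $\Sigma$; then $\operatorname{div}_{\mathbb S}(\mathbf f)|_\Sigma=0$ (divergence-free on $\Sigma$) means $\int_\Sigma \mathbf f\cdot\nabla_{\mathbb S}\varphi\,d\omega=0$ for all $\varphi\in C_c^\infty(\Sigma)$. Layer potentials, for $f\in L^2(\mathbb S)$ and $x\in\mathbb S$: $Sf(x)=\frac{-1}{\omega_d(d-2)}\int_{\mathbb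 S}\frac{f(y)}{|x-y|^{d-2}}d\omega(y)$ and $Kf(x)=\mathrm{p.v.}\,\frac{-1}{\omega_d}\int_{\mathbb S}\frac{\mathbf n(y)\cdot(x-y)}{|x-y|^{d}}f(y)\,d\omega(y)$. The operator $S$ maps $L^2(\mathbb S)$ bijectively and boundedly onto the Sobolev space $W^{1,2}(\mathbb S)$. Define bounded operators $B_+:L^2(\mathbb S)/\langle1\rangle\to L^2(\mathbb S,\mathbb R^d)$, $B_+f=\mathbf n\,(K-\tfrac12I)f+\nabla_{\mathbb S}Sf$, and $B_-:L^2(\mathbb S)\to L^2(\mathbb S,\mathbb R^d)$, $B_-f=\mathbf n\,(K+\tfrac12I)f+\nabla_{\mathbb S}Sf$. They are injective with closed ranges $H_+(\mathbb S)$ and $H_-(\mathbb S)$ (the Hardy spaces). With $D(\mathbb S)$ the space of fields that are tangent and divergence-free on all of $\mathbb S$, the Hardy-Hodge decomposition $L^2(\mathbb S,\mathbb R^d)=H_+(\mathbb S)\oplus H_-(\mathbb S)\oplus D(\mathbb S)$ is an orthogonal direct sum; the Hardy components $\mathbf f_\pm$ of $\mathbf f$ are its projections to $H_\pm(\mathbb S)$. Define $\mathcal D_\Sigma=\{f\in L^2(\mathbb S): \operatorname{div}_{\mathbb S}(\nabla_{\mathbb S}Sf)|_\Sigma=0\}$, $U_\Sigma^+=\{f\in L^2(\mathbb S): Pf=P(K+\tfrac12I)g\text{ for some }g\in\mathcal D_\Sigma\}/\langle1\rangle$, and $U_\Sigma^-=\{f\in L^2(\mathbb S): Pf=P(K-\tfrac12I)g\text{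 for some }g\in\mathcal D_\Sigma/\langle1\rangle\}$. *)

(* Defs.v *)
From HB Require Import structures.
From mathcomp Require Import all_boot all_order all_algebra.
From mathcomp Require Import all_classical all_reals all_analysis.
From mathcomp Require Import measurable_realfun.

Set Implicit Arguments.
Unset Strict Implicit.
Unset Printing Implicit Defensive.

Import Order.TTheory GRing.Theory Num.Theory.
Import numFieldNormedType.Exports.

Local Open Scope classical_set_scope.
Local Open Scope ring_scope.

(* The Borel sigma-algebra of [R^n], generated by the coordinates. *)
Section measurable_rV.
Context (R : realType) (n : nat).

Let coord (i : 'I_n) (v : 'rV[R]_n) : measurableTypeR R := v 0 i.

Let rV_set0 : g_sigma_preimage coord set0.
Proof. exact: sigma_algebra0. Qed.

Let rV_setC A : g_sigma_preimage coord A -> g_sigma_preimage coord (~` A).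
Proof. exact: sigma_algebraC. Qed.

Let rV_bigcup (F : (set 'rV[R]_n)^nat) :
  (forall i, g_sigma_preimage coord (F i)) ->
  g_sigma_preimage coord (\bigcup_i F i).
Proof. exact: sigma_algebra_bigcup. Qed.

HB.instance Definition _ := @isMeasurable.Build default_measure_display
  'rV[R]_n (g_sigma_preimage coord) rV_set0 rV_setC rV_bigcup.

Lemma measurable_rV_coord (i : 'I_n) :
  measurable_fun [set: 'rV[R]_n] (fun v : 'rV[R]_n => v 0 i).
Proof.
move=> _ Y mY; rewrite setTI; apply: sub_sigma_algebra => /=.
rewrite -bigcup_seq/=; exists i => /=; first by rewrite mem_index_enum.
by exists Y => //; rewrite setTI.
Qed.

Lemma measurable_fun_rV d (T : measurableType d) (f : T -> 'rV[R]_n) :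
  (forall i, measurable_fun [set: T] (fun t => f t 0 i)) ->
  measurable_fun [set: T] f.
Proof.
move=> mf _ A; move: A; apply: smallest_sub.
  split; first by rewrite /= preimage_set0 setI0; exact: measurable0.
  - move=> A /= mA; rewrite setTD -preimage_setC setTI.
    by apply: measurableC; rewrite -[X in measurable X]setTI.
  - move=> F /= mF; rewrite preimage_bigcup setTI.
    by apply: bigcupT_measurable => k; rewrite -[X in measurable X]setTI.
move=> B; rewrite -bigcup_seq => -[i _ [Y mY <-]] /=.
by rewrite !setTI -[X in measurable X]setTI; exact: mf.
Qed.

End measurable_rV.

(* [n]-dimensional Lebesgue measure, by iterated integration over the
   first coordinate. *)
Fixpoint lebesgue_rV (R : realType) (n : nat) : set 'rV[R]_n -> \bar R :=
  match n with
  | 0 => fun A => \d_(0%R : 'rV[R]_0) A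
  | m.+1 => fun A => (\int[lebesgue_measure]_t
      @lebesgue_rV R m [set v : 'rV[R]_m | A (row_mx t%:M v : 'rV[R]_(1 + m))])%E
  end.

Section lebesgue_rV_measure.
Context (R : realType).

Let consr (n : nat) (p : measurableTypeR R * 'rV[R]_n) : 'rV[R]_n.+1 :=
  row_mx (p.1)%:M p.2 : 'rV[R]_(1 + n).
Let unconsr (n : nat) (v : 'rV[R]_n.+1) : measurableTypeR R * 'rV[R]_n :=
  (v 0 0, rsubmx (v : 'rV[R]_(1 + n))).

Let consrEl n p (j : 'I_1) : @consr n p 0 (lshift n j) = p.1.
Proof. by apply: etrans (row_mxEl _ _ _ _) _; rewrite mxE !ord1 mulr1n. Qed.

Let consrEr n p (j : 'I_n) : @consr n p 0 (rshift 1 j) = p.2 0 j.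
Proof. exact: row_mxEr. Qed.

Let ord0E n : (0 : 'I_n.+1) = lshift n (0 : 'I_1).
Proof. exact/val_inj. Qed.

Let consrK n : cancel (@consr n) (@unconsr n).
Proof.
case=> t p; rewrite /unconsr; congr pair; first by rewrite (ord0E n) consrEl.
by apply/rowP => j; rewrite mxE consrEr.
Qed.

Let unconsrK n : cancel (@unconsr n) (@consr n).
Proof.
move=> v; apply/rowP => i.
have [j ->|j ->] := @split_ordP 1 n i; last by rewrite consrEr mxE.
by rewrite consrEl ord1 -(ord0E n).
Qed.

Let mconsr n : measurable_fun setT (@consr n).
Proof.
apply: measurable_fun_rV => i.
have [j ->|j ->] := @split_ordP 1 n i.
  by rewrite (_ : (fun _ => _) = fst)//; apply/funext => p; rewrite consrEl.
rewrite (_ : (fun _ => _) = (fun v : 'rV[R]_n => v 0 j) \o snd); last first.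
  by apply/funext => p; rewrite consrEr.
by apply: measurableT_comp => //; exact: measurable_rV_coord.
Qed.

Let munconsr n : measurable_fun setT (@unconsr n).
Proof.
apply/measurable_fun_pairP; split => /=; first exact: measurable_rV_coord.
apply: measurable_fun_rV => i.
rewrite (_ : (fun _ => _) = (fun v : 'rV[R]_n.+1 => v 0 (rshift 1 i))); last first.
  by apply/funext => v /=; rewrite mxE.
exact: measurable_rV_coord.
Qed.

Section step.
Local Open Scope ereal_scope.
Variables (n : nat) (mu : {sigma_finite_measure set 'rV[R]_n -> \bar R}).

Let m (A : set 'rV[R]_n.+1) : \bar R := \int[lebesgue_measure]_t
  mu [set v : 'rV[R]_n | A (row_mx t%:M v : 'rV[R]_(1 + n))].

Let mE A : m A = (lebesgue_measure \x mu) (@consr n @^-1` A).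
Proof.
rewrite /m /product_measure1; apply: eq_integral => t _ /=; congr (mu _).
by apply/seteqP; split => v; rewrite /xsection/= inE.
Qed.

Let m0 : m set0 = 0.
Proof. by rewrite mE preimage_set0 measure0. Qed.

Let m_ge0 A : 0 <= m A.
Proof. by rewrite mE; exact: measure_ge0. Qed.

Let mT (A : set 'rV[R]_n.+1) : measurable A -> measurable (@consr n @^-1` A).
Proof. by move=> mA; rewrite -[X in measurable X]setTI; exact: mconsr. Qed.

Let m_sigma_additive : semi_sigma_additive m.
Proof.
move=> F mF tF mUF; rewrite mE preimage_bigcup.
rewrite (_ : (fun _ => _) = (fun k => \sum_(0 <= i < k)
    (lebesgue_measure \x mu) (@consr n @^-1` F i))); last first.
  by apply/funext => k; apply: eq_bigr => i _; rewrite mE.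
apply: measure_semi_sigma_additive.
- by move=> k; exact: mT.
- apply/trivIsetP => /= i j _ _ ij; rewrite -preimage_setI.
  by move/trivIsetP : tF => /(_ _ _ _ _ ij) ->//; rewrite preimage_set0.
- by rewrite -preimage_bigcup; exact: mT.
Qed.

HB.instance Definition _ :=
  isMeasure.Build _ _ _ m m0 m_ge0 m_sigma_additive.

Let m_sigma_finite : sigma_finite setT m.
Proof.
have /sigma_finiteP[F [TF ndF Foo]] := sigma_finiteT (@lebesgue_measure R).
have /sigma_finiteP[G [TG ndG Goo]] := sigma_finiteT mu.
exists (fun k => @unconsr n @^-1` (F k `*` G k)).
  rewrite -preimage_bigcup -[LHS](preimage_setT (@unconsr n)); congr (_ @^-1` _).
  rewrite -setXTT TF TG predeqE => -[x y]; split.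
    move=> [/= [i _ Fix] [k _ Gky]]; exists (maxn i k) => //; split.
    - by move: x Fix; exact/subsetPset/ndF/leq_maxl.
    - by move: y Gky; exact/subsetPset/ndG/leq_maxr.
  by move=> [i _ []/= ? ?]; split; exists i.
move=> k; have [mF ltF] := Foo k; have [mG ltG] := Goo k; split.
  by rewrite -[X in measurable X]setTI; apply: munconsr => //; exact: measurableX.
rewrite mE -comp_preimage (_ : _ \o _ = id); last first.
  by apply/funext => p /=; rewrite consrK.
by rewrite preimage_id product_measure1E// lte_mul_pinfty// ge0_fin_numE.
Qed.

HB.instance Definition _ :=
  Measure_isSigmaFinite.Build _ _ _ m m_sigma_finite.

Lemma lebesgue_rV_step :
  exists mu' : {sigma_finite_measure set 'rV[R]_n.+1 -> \bar R},
    (fun A => \int[lebesgue_measure]_t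
      mu [set v : 'rV[R]_n | A (row_mx t%:M v : 'rV[R]_(1 + n))]) =
    mu' :> (set 'rV[R]_n.+1 -> \bar R).
Proof. by exists m. Qed.

End step.

Lemma lebesgue_rV_sigma_finite_measure n :
  exists mu : {sigma_finite_measure set 'rV[R]_n -> \bar R},
    @lebesgue_rV R n = mu :> (set 'rV[R]_n -> \bar R).
Proof.
elim: n => [|n [mu /= ->]]; first by exists (\d_(0%R : 'rV[R]_0)).
exact: lebesgue_rV_step.
Qed.

Variable n : nat.
Local Open Scope ereal_scope.

Let leb0 : @lebesgue_rV R n set0 = 0.
Proof. by have [mu ->] := lebesgue_rV_sigma_finite_measure n. Qed.

Let leb_ge0 A : 0 <= @lebesgue_rV R n A.
Proof. by have [mu ->] := lebesgue_rV_sigma_finite_measure n. Qed.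

Let leb_sigma_additive : semi_sigma_additive (@lebesgue_rV R n).
Proof.
have [mu ->] := lebesgue_rV_sigma_finite_measure n.
exact: measure_semi_sigma_additive.
Qed.

HB.instance Definition _ := isMeasure.Build _ _ _ (@lebesgue_rV R n)
  leb0 leb_ge0 leb_sigma_additive.

Let leb_sigma_finite : sigma_finite setT (@lebesgue_rV R n).
Proof.
have [mu ->] := lebesgue_rV_sigma_finite_measure n.
exact: sigma_finiteT.
Qed.

HB.instance Definition _ := Measure_isSigmaFinite.Build _ _ _
  (@lebesgue_rV R n) leb_sigma_finite.

End lebesgue_rV_measure.

Section sphere.
Context {R : realType} {d : nat}.
Implicit Types (u v x y : 'rV[R]_d).

Definition dot u v : R := \sum_i u 0 i * v 0 i.

(* Euclidean norm; the norm [`|x|] of the library is the sup norm. *)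
Definition enorm x : R := Num.sqrt (dot x x).

Definition sphere : set 'rV[R]_d := [set x | enorm x = 1].

(* Outward unit normal field, for [x] on the sphere. *)
Definition normal x : 'rV[R]_d := x.

Definition normalize x : 'rV[R]_d := (enorm x)^-1 *: x.

Lemma measurable_enorm : measurable_fun setT enorm.
Proof.
apply: (measurableT_comp (f := @Num.sqrt R)).
  by apply: continuous_measurable_fun; exact: sqrt_continuous.
by apply: measurable_sum => i; apply: measurable_funM;
  exact: measurable_rV_coord.
Qed.

Lemma measurable_normalize : measurable_fun setT normalize.
Proof.
apply: measurable_fun_rV => i.
rewrite (_ : (fun _ => _) = (fun x => enorm x `^ (-1) * x 0 i)); last first.
  by apply/funext => x; rewrite mxE powR_inv1// sqrtr_ge0.
apply: measurable_funM; last exact: measurable_rV_coord.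
exact: (measurableT_comp (f := fun t : R => t `^ (-1)) (measurable_powR _)
  measurable_enorm).
Qed.

Definition punctured_ball : set 'rV[R]_d := [set x | 0 < enorm x <= 1].

Lemma measurable_punctured_ball : measurable punctured_ball.
Proof.
rewrite (_ : punctured_ball = setT `&` enorm @^-1` `]0, 1]).
  exact: (measurable_enorm _ (measurable_itv _)).
by apply/seteqP; split => x /=; rewrite in_itv/=; [|case].
Qed.

(* Surface measure: [omega A] is [d] times the Lebesgue measure of the cone
   [{t a | a in A, 0 < t <= 1}] over [A]. It is carried by the sphere, so a
   function on the sphere is represented by a function on [R^d], up to
   [omega]-almost everywhere equality. *)
Definition omega (A : set 'rV[R]_d) : \bar R :=
  (d%:R%:E * lebesgue_rV [set x | punctured_ball x /\ A (normalize x)])%E.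

Section omega_measure.
Local Open Scope ereal_scope.

Let cone_measure : {measure set 'rV[R]_d -> \bar R} := mscale (d%:R%:nng)%R
  (mrestr (@lebesgue_rV R d) measurable_punctured_ball).

Let omegaE A : omega A = cone_measure (normalize @^-1` A).
Proof. by rewrite /cone_measure/= /mscale/= /mrestr [in RHS]setIC. Qed.

Let mN A : measurable A -> measurable (normalize @^-1` A).
Proof.
by move=> mA; rewrite -[X in measurable X]setTI; exact: measurable_normalize.
Qed.

Let omega0 : omega set0 = 0.
Proof. by rewrite omegaE preimage_set0 measure0. Qed.

Let omega_ge0 A : 0 <= omega A.
Proof. by apply: mule_ge0; rewrite ?lee_fin//; exact: measure_ge0. Qed.

Let omega_sigma_additive : semi_sigma_additive omega.
Proof.
move=> F mF tF mUF; rewrite omegaE preimage_bigcup.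
rewrite (_ : (fun _ => _) = (fun k => \sum_(0 <= i < k)
    cone_measure (normalize @^-1` F i))); last first.
  by apply/funext => k; apply: eq_bigr => i _; rewrite omegaE.
apply: measure_semi_sigma_additive.
- by move=> k; exact: mN.
- apply/trivIsetP => /= i j _ _ ij; rewrite -preimage_setI.
  by move/trivIsetP : tF => /(_ _ _ _ _ ij) ->//; rewrite preimage_set0.
- by rewrite -preimage_bigcup; exact: mN.
Qed.

HB.instance Definition _ :=
  isMeasure.Build _ _ _ omega omega0 omega_ge0 omega_sigma_additive.

End omega_measure.

Definition sphere_area : R := fine (omega sphere).

Definition relatively_open (Sigma : set 'rV[R]_d) :=
  exists2 O, open O & Sigma = sphere `&` O.

Definition proper_with_closure (Sigma : set 'rV[R]_d) :=
  Sigma `<` sphere /\ closure Sigma `<` sphere.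

Definition L2 (f : 'rV[R]_d -> R) : Prop := f \in Lfun omega 2%:E.

Lemma L2P f : L2 f <-> measurable_fun setT f /\ finite_norm omega 2%:E f.
Proof.
rewrite /L2 inE; split => [/andP[]|[mf ff]]; first by rewrite !inE.
by apply/andP; rewrite !inE.
Qed.

Definition L2v (F : 'rV[R]_d -> 'rV[R]_d) : Prop :=
  forall i, L2 (fun x => F x 0 i).

Definition L2_zero_mean (f : 'rV[R]_d -> R) : Prop :=
  L2 f /\ \int[omega]_(x in sphere) f x = 0.

(* Orthogonal projection of [L2] onto the functions vanishing outside
   [Sigma], see [proj_onP]. *)
Definition proj_on (Sigma : set 'rV[R]_d) (f : 'rV[R]_d -> R) : 'rV[R]_d -> R :=
  f \_ Sigma.

Lemma proj_onP (Sigma : set 'rV[R]_d) f : measurable Sigma -> L2 f ->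
  [/\ L2 (proj_on Sigma f),
      {ae omega, forall x, ~ Sigma x -> proj_on Sigma f x = 0} &
      forall h, L2 h -> {ae omega, forall x, ~ Sigma x -> h x = 0} ->
        \int[omega]_x ((f x - proj_on Sigma f x) * h x) = 0].
Proof.
move=> mS /L2P[mf foo].
have mp : measurable_fun setT (proj_on Sigma f).
  by apply/(measurable_restrictT f mS); exact: measurable_funS mf.
split.
- apply/L2P; split => //.
  apply: le_lt_trans foo; rewrite unlock gt0_ler_poweR//.
  + by rewrite in_itv/= leey integral_ge0// => x _; exact: poweR_ge0.
  + by rewrite in_itv/= leey integral_ge0// => x _; exact: poweR_ge0.
  + apply: ge0_le_integral => //.
    * by move=> x _; exact: poweR_ge0.
    * apply/measurable_EFinP.
      apply/(@measurableT_comp _ _ _ _ _ _ (fun x : R => x `^ 2)%R) => //.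
      exact/measurableT_comp.
    * apply/measurable_EFinP.
      apply/(@measurableT_comp _ _ _ _ _ _ (fun x : R => x `^ 2)%R) => //.
      exact/measurableT_comp.
    * move=> x _; rewrite /= lee_fin ge0_ler_powR ?nnegrE//.
      by rewrite /proj_on patchE; case: ifPn => // _; rewrite normr0.
- by apply: aeW => x /= Sx; rewrite /proj_on patchE memNset.
- move=> h /L2P[mh _] h0; rewrite /Rintegral.
  rewrite (_ : integral _ _ _ = 0%E)//.
  rewrite -[RHS](@integral0 _ _ R omega setT); apply: ae_eq_integral => //.
    apply/measurable_EFinP; apply: measurable_funM => //.
    exact: measurable_funB.
  apply: filterS h0 => x /= h0 _.
  have [Sx|Sx] := pselect (Sigma x).
    by rewrite /proj_on patchE mem_set// subrr mul0r.
  by rewrite h0// mulr0.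
Qed.

Fixpoint Ck (k : nat) (f : 'rV[R]_d -> R) : Prop :=
  match k with
  | 0 => continuous f
  | m.+1 => (forall x, differentiable f x) /\
            forall i : 'I_d, Ck m (fun x => 'D_(delta_mx 0 i) f x)
  end.

(* Smooth functions on the sphere are the restrictions of smooth functions
   on [R^d]. *)
Definition smooth (f : 'rV[R]_d -> R) : Prop := forall k, Ck k f.

Definition grad (f : 'rV[R]_d -> R) x : 'rV[R]_d :=
  \row_i 'D_(delta_mx 0 i) f x.

(* Tangential part of the gradient; on the sphere it only depends on the
   restriction of [f] to the sphere. *)
Definition sgrad (f : 'rV[R]_d -> R) x : 'rV[R]_d :=
  grad f x - dot (normal x) (grad f x) *: normal x.

(* Surface divergence, for a smooth field that is tangent to the sphere. *)
Definition sdiv (V : 'rV[R]_d -> 'rV[R]_d) x : R :=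
  \sum_i sgrad (fun y => V y 0 i) x 0 i.

Definition smooth_tangent (V : 'rV[R]_d -> 'rV[R]_d) : Prop :=
  (forall i, smooth (fun x => V x 0 i)) /\
  (forall x, sphere x -> dot (normal x) (V x) = 0).

Definition sphere_support (phi : 'rV[R]_d -> R) : set 'rV[R]_d :=
  closure [set x | sphere x /\ phi x <> 0].

Definition test_function (Sigma : set 'rV[R]_d) (phi : 'rV[R]_d -> R) : Prop :=
  [/\ smooth phi, compact (sphere_support phi) & sphere_support phi `<=` Sigma].

Definition tangent_on (Sigma : set 'rV[R]_d) (F : 'rV[R]_d -> 'rV[R]_d) : Prop :=
  {ae omega, forall x, Sigma x -> dot (normal x) (F x) = 0}.

Definition divfree_on (Sigma : set 'rV[R]_d) (F : 'rV[R]_d -> 'rV[R]_d) : Prop :=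
  forall phi, test_function Sigma phi ->
    \int[omega]_(x in Sigma) dot (F x) (sgrad phi x) = 0.

(* [u] belongs to the Sobolev space [W^{1,2}] of the sphere and [G] is its weak
   surface gradient. *)
Definition weak_sgrad (u : 'rV[R]_d -> R) (G : 'rV[R]_d -> 'rV[R]_d) : Prop :=
  [/\ L2 u, L2v G, tangent_on sphere G &
    forall V, smooth_tangent V ->
      \int[omega]_(x in sphere) dot (G x) (V x) =
      - \int[omega]_(x in sphere) (u x * sdiv V x)].

Definition layerS (f : 'rV[R]_d -> R) x : R :=
  - (sphere_area * (d%:R - 2))^-1 *
  \int[omega]_(y in sphere) (f y / enorm (x - y) ^+ (d - 2)).

Definition layerK (f : 'rV[R]_d -> R) x : R :=
  lim ((- sphere_area^-1 *
    \int[omega]_(y in [set y | sphere y /\ e < enorm (x - y)])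
      (dot (normal y) (x - y) / enorm (x - y) ^+ d * f y)) @[e --> 0^'+]).

(* The operators [B_+] and [B_-] are given by their graphs: [F] is a
   representative of the class of [B_+ f]. *)
Definition Bplus (f : 'rV[R]_d -> R) (F : 'rV[R]_d -> 'rV[R]_d) : Prop :=
  [/\ L2_zero_mean f, L2v F & exists2 G, weak_sgrad (layerS f) G &
    F = (fun x => (layerK f x - 2^-1 * f x) *: normal x + G x) %[ae omega]].

Definition Bminus (f : 'rV[R]_d -> R) (F : 'rV[R]_d -> 'rV[R]_d) : Prop :=
  [/\ L2 f, L2v F & exists2 G, weak_sgrad (layerS f) G &
    F = (fun x => (layerK f x + 2^-1 * f x) *: normal x + G x) %[ae omega]].

Definition Hplus (F : 'rV[R]_d -> 'rV[R]_d) : Prop := exists f, Bplus f F.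

Definition Hminus (F : 'rV[R]_d -> 'rV[R]_d) : Prop := exists f, Bminus f F.

Definition tangent_divfree (F : 'rV[R]_d -> 'rV[R]_d) : Prop :=
  [/\ L2v F, tangent_on sphere F & divfree_on sphere F].

Definition hardy_hodge (F Fp Fm D : 'rV[R]_d -> 'rV[R]_d) : Prop :=
  [/\ Hplus Fp, Hminus Fm, tangent_divfree D &
    F = (fun x => Fp x + Fm x + D x) %[ae omega]].

Definition hardy_component_plus (F Fp : 'rV[R]_d -> 'rV[R]_d) : Prop :=
  exists Fm D, hardy_hodge F Fp Fm D.

Definition hardy_component_minus (F Fm : 'rV[R]_d -> 'rV[R]_d) : Prop :=
  exists Fp D, hardy_hodge F Fp Fm D.

Definition Dspace (Sigma : set 'rV[R]_d) (g : 'rV[R]_d -> R) : Prop :=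
  L2 g /\ exists2 G, weak_sgrad (layerS g) G & divfree_on Sigma G.

Definition Uplus (Sigma : set 'rV[R]_d) (f : 'rV[R]_d -> R) : Prop :=
  L2_zero_mean f /\
  exists2 g, Dspace Sigma g &
    proj_on Sigma f = proj_on Sigma (fun x => layerK g x + 2^-1 * g x) %[ae omega].

Definition Uminus (Sigma : set 'rV[R]_d) (f : 'rV[R]_d -> R) : Prop :=
  L2 f /\
  exists g, [/\ Dspace Sigma g, L2_zero_mean g &
    proj_on Sigma f = proj_on Sigma (fun x => layerK g x - 2^-1 * g x) %[ae omega]].

Definition BplusU (Sigma : set 'rV[R]_d) (F : 'rV[R]_d -> 'rV[R]_d) : Prop :=
  exists2 f, Uplus Sigma f & Bplus f F.

Definition BminusU (Sigma : set 'rV[R]_d) (F : 'rV[R]_d -> 'rV[R]_d) : Prop :=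
  exists2 f, Uminus Sigma f & Bminus f F.

End sphere.

(* Main.v *)
(* On the unit sphere [y . (x - y) = - |x - y|^2 / 2]. With [c = (d - 2) / 2] and
   [T f(x) = omega_d^-1 \int f(y) |x - y|^(2 - d)], this gives [K f = T f / 2] and
   [S f = - T f / (2 c)] almost everywhere, and [T] acts on spherical harmonics of
   degree [l] as [c / (l + c)].

   For Hardy components [B_+ f] and [B_- g], tangency on [Sigma] reads
   [(K - 1/2) f + (K + 1/2) g = 0] there and divergence-freeness says that
   [f + g] lies in [D_Sigma]. Membership follows with [h = f + g] for [U^+] and
   [h = const - f - g] for [U^-], since [K 1 = 1/2]; solving for [f] or [g] gives
   existence.

   For uniqueness, the difference [k] of two candidates satisfies
   [b := T k + s k = 0] on [Sigma] with [s = 1] or [s = -1], and [T k] is harmonic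
   on [Sigma]. Let [A = c^2 - Delta] with [Delta] the Laplace-Beltrami operator;
   then [T^2 A = c^2], so [b] is orthogonal to [T A phi] for all test functions
   [phi] of [Sigma]. Since [Delta] maps [|x - y|^(-2a)] to a combination of
   [|x - y|^(-2a-2)] and [|x - y|^(-2a)], all integrals
   [\int\int phi(x) b(y) |x - y|^(-d-2j)] vanish. As [b] lives away from the support
   of [phi], bounded approximation turns these powers into polynomials in [x . y];
   so [\int b(y) (x . y)^m = 0] for [x] in an open set, all moments of [b] vanish
   and [b = 0]. Testing [T k = - s k] against spherical harmonics yields [k = 0]. *)

Require Import Defs.
From HB Require Import structures.
From mathcomp Require Import all_boot all_order all_algebra.
From mathcomp Require Import all_classical all_reals all_analysis.
From mathcomp Require Import measurable_realfun ring lra.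

Set Implicit Arguments.
Unset Strict Implicit.
Unset Printing Implicit Defensive.

Import Order.TTheory GRing.Theory Num.Theory.
Import numFieldNormedType.Exports.

Local Open Scope classical_set_scope.
Local Open Scope ring_scope.

(** * Lebesgue measure on R^n and the surface measure *)

(** Since [T] is [c A^(-1/2)], only its square is inverted by a local operator, and locality is what
    lets [b] be tested against functions living in [Sigma]. Symmetry of [T] turns the pairing of
    [b = T k + s k] with [T A phi] into [<k, T T A phi> + s <T k, A phi>]. The first term is
    [c^2 <k, phi>]; harmonicity of [T k] on [Sigma] makes the second one [s c^2 <T k, phi>]. As
    [s^2 = 1], the sum is [s c^2 <b, phi>], which is [0] because [b] vanishes where [phi] lives.
    Both signs are thus treated alike up to the final spectral argument.

    Calculus on the sphere rests on the rotation invariance of [omega]: a rotation is a product of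
    shears, which preserve Lebesgue measure by Fubini, and differentiating the invariance at angle
    [0] yields integration by parts. The eigenvalue [c / (l + c)] comes from letting [r] tend to [1]
    in an identity between [|y - r x|^(-2 c)] and the Poisson kernel. *)

Section cons_rV.
Context (R : realType).

(** Same block matrix as in the recursion of [lebesgue_rV], so that [lebesgue_rVS] holds by
    conversion. *)
Definition consr (n : nat) (p : measurableTypeR R * 'rV[R]_n) : 'rV[R]_n.+1 :=
  row_mx (p.1)%:M p.2 : 'rV[R]_(1 + n).

Lemma consrE0 n (p : measurableTypeR R * 'rV[R]_n) : consr p 0 0 = p.1.
Proof.
rewrite (_ : 0 = lshift n (0 : 'I_1)); last exact/val_inj.
by apply: etrans (row_mxEl _ _ _ _) _; rewrite mxE eqxx mulr1n.
Qed.

Lemma consrES n (p : measurableTypeR R * 'rV[R]_n) j :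
  consr p 0 (lift ord0 j) = p.2 0 j.
Proof.
rewrite (_ : lift ord0 j = rshift 1 j); last exact/val_inj.
exact: row_mxEr.
Qed.

Lemma consrD_lift n t (v : 'rV[R]_n) a k :
  consr (t, v + a *: delta_mx 0 k) =
  consr (t, v) + a *: delta_mx 0 (lift ord0 k).
Proof.
apply/rowP => i; rewrite [RHS]mxE [X in _ = _ + X]mxE [X in _ = _ + _ * X]mxE.
have [j ->|->] := unliftP ord0 i; rewrite ?consrES ?consrE0/=.
  by rewrite !mxE/= (inj_eq lift_inj).
by rewrite mulr0 addr0.
Qed.

Lemma consrD0 n t (v : 'rV[R]_n) a :
  consr (t + a, v) = consr (t, v) + a *: delta_mx 0 0.
Proof.
apply/rowP => i; rewrite [RHS]mxE [X in _ = _ + X]mxE [X in _ = _ + _ * X]mxE.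
have [j ->|->] := unliftP ord0 i; rewrite ?consrES ?consrE0/=.
  by rewrite mulr0 addr0.
by rewrite mulr1.
Qed.

Lemma measurable_consr n : measurable_fun setT (@consr n).
Proof.
apply: measurable_fun_rV => i.
have [j ->|->] := unliftP ord0 i.
  rewrite (_ : (fun _ => _) = (fun v : 'rV[R]_n => v 0 j) \o snd).
    by apply: measurableT_comp => //; exact: measurable_rV_coord.
  by apply/funext => p; rewrite consrES.
by rewrite (_ : (fun _ => _) = fst)//; apply/funext => p; rewrite consrE0.
Qed.

Lemma measurable_consr_preimage n A : measurable A -> measurable (@consr n @^-1` A).
Proof. by move=> mA; rewrite -[X in measurable X]setTI; exact: measurable_consr. Qed.

Lemma lebesgue_rVS n (A : set 'rV[R]_n.+1) :
  (lebesgue_rV A = \int[lebesgue_measure]_t lebesgue_rV [set v | A (consr (t, v))])%E.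
Proof. by []. Qed.

Lemma lebesgue_rV_prod n (A : set 'rV[R]_n.+1) :
  lebesgue_rV A = (lebesgue_measure \x @lebesgue_rV R n)%E (@consr n @^-1` A).
Proof.
rewrite lebesgue_rVS /product_measure1; apply: eq_integral => t _ /=.
congr (lebesgue_rV _).
by apply/seteqP; split => v; rewrite /xsection/= inE.
Qed.

Lemma lebesgue_measure_shift (a : R) (A : set (measurableTypeR R)) : measurable A ->
  lebesgue_measure ((fun t : R => t + a) @^-1` A) = lebesgue_measure A.
Proof.
move=> mA.
have ms : measurable_fun setT ((fun t : R => t + a) : measurableTypeR R -> measurableTypeR R).
  by apply: measurable_funD.
pose fm := isMeasurableFun.Build _ _ _ _ _ ms.
pose f : {mfun measurableTypeR R >-> measurableTypeR R} :=
  HB.pack ((fun t : R => t + a) : measurableTypeR R -> measurableTypeR R) fm.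
apply/esym; rewrite -[RHS]/(pushforward lebesgue_measure f A).
apply: lebesgue_measure_unique => //.
move=> _ [[u v]] _ <-; rewrite /= /pushforward.
rewrite (_ : _ @^-1` _ = `]u - a, v - a]%classic); last first.
  by apply/seteqP; split => x /=; rewrite !in_itv/= ltrBlDr lerBrDr.
rewrite !lebesgue_measure_itv/= !lte_fin ltrD2r.
by case: ifP => // _; rewrite -!EFinB; congr EFin; lra.
Qed.

(** Cavalieri. If [j] is not the first coordinate, every slice is a shear in one dimension less. If
    it is the first one, integrate over that coordinate first: [tau] does not depend on it, so each
    line is merely translated. *)
Lemma lebesgue_rV_shear n (j : 'I_n) (tau : 'rV[R]_n -> R) :
  measurable_fun setT tau ->
  (forall v w : 'rV[R]_n, (forall i, i != j -> v 0 i = w 0 i) -> tau v = tau w) ->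
  forall A, measurable A ->
  lebesgue_rV ((fun v : 'rV[R]_n => v + tau v *: delta_mx 0 j) @^-1` A) = lebesgue_rV A.
Proof.
elim: n => [|n IH] in j tau *; first by case: j.
move=> mtau tauP A mA; have [k jk|j0] := unliftP ord0 j.
  rewrite !lebesgue_rVS; apply: eq_integral => t _.
  have mt : measurable_fun setT (fun v : 'rV[R]_n => consr (t, v)).
    exact: (measurableT_comp (@measurable_consr n) (pair1_measurable t)).
  rewrite -[RHS](IH k (fun v => tau (consr (t, v))))//.
  - by congr (lebesgue_rV _); apply/funext => v /=; rewrite consrD_lift jk.
  - exact: (measurableT_comp mtau mt).
  - move=> v w vw; apply: tauP => i; rewrite jk.
    have [i' ->|->] := unliftP ord0 i; rewrite ?consrES ?consrE0//=.
    by rewrite (inj_eq lift_inj) => /vw.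
  - by rewrite -[X in measurable X]setTI; exact: mt.
rewrite !lebesgue_rV_prod.
have mS : measurable_fun setT (fun v : 'rV[R]_n.+1 => v + tau v *: delta_mx 0 j).
  apply: measurable_fun_rV => i.
  rewrite (_ : (fun _ => _) = (fun v : 'rV[R]_n.+1 => v 0 i + tau v * (i == j)%:R)).
    apply: measurable_funD; first exact: measurable_rV_coord.
    by apply: measurable_funM.
  by apply/funext => v; rewrite !mxE/=.
have mB : measurable ((fun v : 'rV[R]_n.+1 => v + tau v *: delta_mx 0 j) @^-1` A).
  by rewrite -[X in measurable X]setTI; exact: mS.
(* Exchanges the order of integration, so that the first coordinate becomes the inner one. *)
have prodE (B : set (measurableTypeR R * 'rV[R]_n)) : measurable B ->
    (lebesgue_measure \x @lebesgue_rV R n)%E B =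
    (lebesgue_measure \x^ @lebesgue_rV R n)%E B.
  apply: product_measure_unique => A1 A2 mA1 mA2.
  exact: product_measure2E.
rewrite !prodE; try exact: measurable_consr_preimage.
apply: eq_integral => v _ /=.
rewrite -[in RHS](lebesgue_measure_shift (tau (consr (0, v)))); last first.
  by apply: measurable_ysection; exact: measurable_consr_preimage.
have tE t : tau (consr (t, v)) = tau (consr (0, v)).
  apply: tauP => i.
  by have [i' ->|->] := unliftP ord0 i; rewrite ?consrES// j0 eqxx.
congr (lebesgue_measure _); apply/seteqP; split=> t;
  by rewrite /ysection/= !inE/= consrD0 j0 (tE t) => At; exact: At.
Qed.

Lemma lebesgue_rV_box n (a b : 'I_n -> R) : (forall i, a i <= b i) ->
  lebesgue_rV [set v : 'rV[R]_n | forall i, a i <= v 0 i <= b i] =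
  (\prod_i (b i - a i))%:E.
Proof.
elim: n => [|n IH] in a b *.
  move=> _; rewrite /= big_ord0 diracE mem_set//= => -[]//.
move=> ab; rewrite lebesgue_rVS big_ord_recl.
pose B := [set v : 'rV[R]_n | forall i, a (lift ord0 i) <= v 0 i <= b (lift ord0 i)].
transitivity (\int[lebesgue_measure]_t
    (lebesgue_rV B * (\1_(`[a 0, b 0]%classic) t)%:E))%E; last first.
  rewrite ge0_integralZl//; last by apply/measurable_EFinP; exact: measurable_indic.
  rewrite integral_indic// setIT IH// [X in (_ * X)%E](_ : _ = (b 0 - a 0)%:E).
    by rewrite muleC -EFinM.
  apply: etrans (lebesgue_measure_itv `[a 0, b 0]) _; rewrite /= lte_fin.
  have := ab 0; rewrite le_eqVlt => /orP[/eqP abE|ab0].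
    by rewrite abE ltxx subrr.
  by rewrite ab0 -EFinB.
apply: eq_integral => t _.
rewrite indicE; have [tab|tab] := pselect (`[a 0, b 0]%classic t).
  rewrite mem_set// mule1; congr (lebesgue_rV _).
  apply/seteqP; split => v /= vab i.
    by have := vab (lift ord0 i); rewrite consrES.
  have [i' ->|->] := unliftP ord0 i; by rewrite ?consrES ?consrE0//.
rewrite memNset// mule0 [X in lebesgue_rV X](_ : _ = set0) ?measure0//.
rewrite -subset0 => v /= /(_ ord0); rewrite consrE0 => ta; apply: tab.
by rewrite /= in_itv/=; exact: ta.
Qed.

End cons_rV.

Section measurable_open.
Context (R : realType) (n : nat).

Lemma ball_rVP (x y : 'rV[R]_n) e : 0 < e ->
  ball x e y <-> forall i, `|x 0 i - y 0 i| < e.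
Proof.
move=> e0; split; first by move=> [_ xy] i; exact: xy.
by move=> xy; split => // i j; rewrite ord1; exact: xy.
Qed.

Lemma measurable_ball_rV (x : 'rV[R]_n) e : measurable (ball x e).
Proof.
have [e0|e0] := ltP 0 e; last first.
  rewrite (_ : ball x e = set0)//; rewrite -subset0 => y [e1].
  by move: (lt_le_trans e1 e0); rewrite ltxx.
rewrite (_ : ball x e = \bigcap_(i in [set: 'I_n]) [set y : 'rV[R]_n | `|x 0 i - y 0 i| < e]).
  apply: fin_bigcap_measurable => // i _.
  rewrite (_ : mkset _ = setT `&` (fun y : 'rV[R]_n => y 0 i) @^-1` (ball (x 0 i) e)).
    by apply: measurable_rV_coord => //; exact: measurable_ball.
  by rewrite setTI.
apply/seteqP; split => y.
  by move=> /(ball_rVP _ _ e0) xy i _; exact: xy.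
by move=> xy; apply/ball_rVP => // i; exact: xy.
Qed.

(** Links two structures of different origin: the sigma-algebra is generated by the coordinates, the
    topology by the sup norm. An open set is a countable union of balls with rational centre and
    radius [1 / (N + 1)]. *)
Lemma open_measurable_rV (A : set 'rV[R]_n) : open A -> measurable A.
Proof.
move=> oA.
pose F (p : 'rV[rat]_n * nat) : set 'rV[R]_n := ball (map_mx (ratr : rat -> R) p.1 : 'rV[R]_n) p.2.+1%:R^-1.
rewrite (_ : A = \bigcup_(p in [set p | F p `<=` A]) F p).
  rewrite bigcup_mkcond; apply: countable_bigcupT_measurable => // p.
  by case: ifP => // _; exact: measurable_ball_rV.
apply/seteqP; split => [x Ax|x [p pA /pA]//].
have /nbhs_ballP[e /= e0 eA] : nbhs x A by exact: open_nbhs_nbhs.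
(* A ball of radius at most [e / 2] that contains [x] stays inside [ball x e]. *)
have [N Ne] : exists N : nat, N.+1%:R^-1 < e / 2 :> R.
  have /cvgrPdist_lt/(_ (e / 2)) := @cvg_harmonic R.
  rewrite divr_gt0// => /(_ isT) [N _ /(_ _ (leqnn N))].
  rewrite sub0r normrN ger0_norm// ?invr_ge0//; by exists N.
have N0 : 0 < N.+1%:R^-1 :> R by rewrite invr_gt0 ltr0Sn.
have q_ (i : 'I_n) : {q : rat | `|ratr q - x 0 i| < N.+1%:R^-1}.
  apply: cid.
  have [|q] := @rat_in_itvoo R (x 0 i - N.+1%:R^-1) (x 0 i + N.+1%:R^-1).
    by rewrite ltrD2l (@lt_trans _ _ 0) ?oppr_lt0 ?invr_gt0.
  rewrite in_itv/= => xq; exists q.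
  by rewrite ltr_norml ltrBrDr ltrBlDr [- _ + _]addrC [_^-1 + _]addrC.
exists (\row_i sval (q_ i), N) => /=.
  move=> y; rewrite /F/= => /(ball_rVP _ _ N0) Fy.
  apply: eA; apply/ball_rVP => // i.
  have := Fy i; rewrite !mxE; case: (q_ i) => q /= qx qy.
  rewrite -(subrK (ratr q) (x 0 i)) -addrA (le_lt_trans (ler_normD _ _))//.
  by rewrite [ltRHS]splitr ltrD// ?(lt_trans _ Ne)// distrC.
rewrite /F/=; apply/ball_rVP => // i.
by rewrite !mxE; case: (q_ i).
Qed.


Lemma measurable_fun_cont_on (O : set 'rV[R]_n) (f : 'rV[R]_n -> R) : open O ->
  (forall x, O x -> {for x, continuous f}) -> measurable_fun O f.
Proof.
move=> oO cf; apply: (measurability _ (RGenOpens.measurableE R)).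
move=> _ [_ [a [b ->]] <-].
apply: open_measurable_rV; rewrite openE => x [Ox fx].
apply: filterI; first exact: open_nbhs_nbhs.
by apply: cf => //; exact: open_nbhs_nbhs.
Qed.

Lemma measurable_fun_continuous (f : 'rV[R]_n -> R) : continuous f ->
  measurable_fun setT f.
Proof.
move=> cf; have oT := @openT 'rV[R]_n.
by apply: (measurable_fun_cont_on oT) => x _; exact: cf.
Qed.

End measurable_open.

Section dot_theory.
Context {R : realType} {d : nat}.
Implicit Types (u v x y z : 'rV[R]_d) (a : R).

Lemma dotC u v : dot u v = dot v u.
Proof. by apply: eq_bigr => i _; rewrite mulrC. Qed.

Lemma dotDl u v w : dot (u + v) w = dot u w + dot v w.
Proof. by rewrite -big_split; apply: eq_bigr => i _; rewrite mxE mulrDl. Qed.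

Lemma dotZl a u v : dot (a *: u) v = a * dot u v.
Proof. by rewrite /dot mulr_sumr; apply: eq_bigr => i _; rewrite mxE mulrA. Qed.

Lemma dotDr u v w : dot w (u + v) = dot w u + dot w v.
Proof. by rewrite ![dot w _]dotC dotDl. Qed.

Lemma dotZr a u v : dot v (a *: u) = a * dot v u.
Proof. by rewrite ![dot v _]dotC dotZl. Qed.

Lemma dotNl u v : dot (- u) v = - dot u v.
Proof. by rewrite -scaleN1r dotZl mulN1r. Qed.

Lemma dotNr u v : dot v (- u) = - dot v u.
Proof. by rewrite ![dot v _]dotC dotNl. Qed.

Lemma dotBl u v w : dot (u - v) w = dot u w - dot v w.
Proof. by rewrite dotDl dotNl. Qed.

Lemma dotBr u v w : dot w (u - v) = dot w u - dot w v.
Proof. by rewrite dotDr dotNr. Qed.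

Lemma dot0l u : dot 0 u = 0.
Proof. by rewrite -(scale0r u) dotZl mul0r. Qed.

Lemma dot_ge0 u : 0 <= dot u u.
Proof. by apply: sumr_ge0 => i _; rewrite -expr2 sqr_ge0. Qed.

Lemma dot_eq0 u : dot u u = 0 -> u = 0.
Proof.
move=> u0; apply/rowP => i; rewrite mxE.
have /psumr_eq0P/(_ i isT)/eqP : \sum_i u 0 i * u 0 i = 0 by exact: u0.
by rewrite mulf_eq0 orbb => /(_ _) /eqP -> // j _; rewrite -expr2 sqr_ge0.
Qed.

Lemma dot_delta u i : dot u (delta_mx 0 i) = u 0 i.
Proof.
rewrite /dot (bigD1 i)//= mxE !eqxx mulr1 big1 ?addr0// => j ji.
by rewrite mxE eqxx (negbTE ji) mulr0.
Qed.

Lemma sqr_enorm u : enorm u ^+ 2 = dot u u.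
Proof. by rewrite sqr_sqrtr// dot_ge0. Qed.

Lemma enorm_ge0 u : 0 <= enorm u. Proof. exact: sqrtr_ge0. Qed.

Lemma enorm_eq0 u : enorm u = 0 -> u = 0.
Proof. by move=> u0; apply: dot_eq0; rewrite -sqr_enorm u0 expr0n. Qed.

Lemma enormZ a u : enorm (a *: u) = `|a| * enorm u.
Proof. by rewrite /enorm dotZl dotZr mulrA -expr2 sqrtrM ?sqr_ge0// sqrtr_sqr. Qed.

Lemma sphereP x : sphere x <-> dot x x = 1.
Proof.
rewrite /sphere/= /enorm; split => [x1|->]; last by rewrite sqrtr1.
by rewrite -[LHS]sqr_sqrtr ?dot_ge0// x1 expr1n.
Qed.

Lemma sphere_normalize x : x != 0 -> sphere (normalize x).
Proof.
move=> x0; rewrite /sphere/= enormZ ger0_norm ?invr_ge0 ?enorm_ge0//.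
by rewrite mulVf//; apply: contraNneq x0 => /enorm_eq0 ->.
Qed.

Lemma normalize_sphere x : sphere x -> normalize x = x.
Proof. by rewrite /sphere/normalize/= => ->; rewrite invr1 scale1r. Qed.

Lemma sphere_coord_le1 x i : sphere x -> `|x 0 i| <= 1.
Proof.
move=> /sphereP x1; rewrite -(@expr_le1 _ 2)// real_normK ?num_real// -x1 /dot (bigD1 i)//= -expr2 lerDl.
by apply: sumr_ge0 => j _; rewrite -expr2 sqr_ge0.
Qed.

Lemma dot_sphere_le1 x y : sphere x -> sphere y -> `|dot x y| <= 1.
Proof.
move=> /sphereP x1 /sphereP y1; rewrite ler_norml.
have := dot_ge0 (x + y); have := dot_ge0 (x - y).
rewrite !(dotBl, dotBr, dotDl, dotDr) x1 y1 (dotC y x) => *.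
by apply/andP; split; lra.
Qed.

Lemma dot_sphereB x y : sphere x -> sphere y ->
  dot (x - y) (x - y) = 2 - 2 * dot x y.
Proof.
move=> /sphereP x1 /sphereP y1; rewrite !(dotBl, dotBr) x1 y1 (dotC y x); ring.
Qed.

End dot_theory.

Section omega_theory.
Context {R : realType} {d : nat}.
Local Notation V := 'rV[R]_d.
Implicit Types (x y z : V).

Lemma measurable_sphere : measurable (@sphere R d).
Proof.
rewrite (_ : sphere = setT `&` enorm @^-1` [set 1]); last by rewrite setTI.
exact: (measurable_enorm _ (measurable_set1 _)).
Qed.

Lemma omega_sphereC : omega (~` (@sphere R d)) = 0%E.
Proof.
rewrite /omega [X in lebesgue_rV X](_ : _ = set0) ?measure0 ?mule0//.
rewrite -subset0 => x /= [/andP[x0 _]]; apply; apply: sphere_normalize.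
apply: contraTneq x0 => ->.
by rewrite /enorm dot0l sqrtr0 ltxx.
Qed.

Lemma enorm_coord x i : `|x 0 i| <= enorm x.
Proof.
rewrite -(@ler_pXn2r _ 2)// ?nnegrE ?enorm_ge0// real_normK ?num_real//.
rewrite sqr_enorm /dot (bigD1 i)//= -expr2 lerDl.
by apply: sumr_ge0 => j _; rewrite -expr2 sqr_ge0.
Qed.

Lemma omega_setT_lty : (@omega R d setT < +oo)%E.
Proof.
rewrite /omega lte_mul_pinfty//.
have -> : [set x : V | punctured_ball x /\ setT (normalize x)] = @punctured_ball R d.
  by apply/seteqP; split => x //= -[].
have b11 : forall i : 'I_d, (-1 : R) <= 1 by move=> _; lra.
apply: (@le_lt_trans _ _ (lebesgue_rV [set v : V | forall i, -1 <= v 0 i <= 1])).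
  apply: le_measure; rewrite ?inE; first exact: measurable_punctured_ball.
    rewrite (_ : mkset _ = \bigcap_(i in [set: 'I_d]) (setT `&` (fun v : V => v 0 i) @^-1` `[-1, 1])).
      apply: fin_bigcap_measurable => // i _.
      exact: measurable_rV_coord.
    apply/seteqP; split => v /= vb i.
      by move=> _; split => //; rewrite /= in_itv/=; exact: vb.
    by have [_] := vb i I; rewrite /= in_itv.
  move=> x /andP[_ x1] i; rewrite -ler_norml.
  exact: le_trans (enorm_coord _ _) x1.
by rewrite lebesgue_rV_box// ltry.
Qed.

Let omega_fin : fin_num_fun (@omega R d).
Proof.
move=> A mA; rewrite ge0_fin_numE//.
apply: le_lt_trans omega_setT_lty; apply: le_measure => //; rewrite inE//.
Qed.

HB.instance Definition _ := Measure_isFinite.Build _ _ _ (@omega R d) omega_fin.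

(* The rotation by the angle [2 atan t] in the plane of [e_i] and [e_j]. *)
Definition plane_rot (i j : 'I_d) (t : R) (x : V) : V :=
  x + (2 * t / (1 + t ^+ 2)) *: ((- t * x 0 i - x 0 j) *: delta_mx 0 i +
    (x 0 i - t * x 0 j) *: delta_mx 0 j).

Let t2_neq0 (t : R) : 1 + t ^+ 2 != 0.
Proof. by rewrite gt_eqF// ltr_pwDl// sqr_ge0. Qed.

Lemma delta_dot (i j : 'I_d) : dot (delta_mx 0 i) (delta_mx 0 j) = (i == j)%:R :> R.
Proof. by rewrite dot_delta mxE eqxx eq_sym. Qed.

Lemma dot_rot i j t x : i != j -> dot (plane_rot i j t x) (plane_rot i j t x) = dot x x.
Proof.
move=> ij; rewrite /plane_rot !(dotDl, dotDr, dotZl, dotZr, delta_dot).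
rewrite !(dotC (delta_mx 0 _) x) !dot_delta !eqxx (eq_sym j i) (negbTE ij) /=.
field; exact: t2_neq0.
Qed.

Lemma enorm_rot i j t x : i != j -> enorm (plane_rot i j t x) = enorm x.
Proof. by move=> ij; rewrite /enorm dot_rot. Qed.

Lemma sphere_rot i j t x : i != j -> sphere (plane_rot i j t x) <-> sphere x.
Proof. by move=> ij; rewrite /sphere/= enorm_rot. Qed.

Lemma rotZ i j t a x : plane_rot i j t (a *: x) = a *: plane_rot i j t x.
Proof.
rewrite /plane_rot; apply/rowP => k; rewrite !mxE/=; ring.
Qed.

Lemma normalize_rot i j t x : i != j -> normalize (plane_rot i j t x) = plane_rot i j t (normalize x).
Proof. by move=> ij; rewrite /normalize enorm_rot// rotZ. Qed.

Let sh (i j : 'I_d) (a : R) (v : V) : V := v + (a * v 0 j) *: delta_mx 0 i.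

Let msh i j a : measurable_fun setT (sh i j a).
Proof.
apply: measurable_fun_rV => k.
rewrite (_ : (fun _ => _) = (fun v : V => v 0 k + a * v 0 j * (k == i)%:R)); last first.
  by apply/funext => v; rewrite !mxE/=.
apply: measurable_funD; first exact: measurable_rV_coord.
by do 2 (apply: measurable_funM => //); exact: measurable_rV_coord.
Qed.

Let lebesgue_sh i j a A : i != j -> measurable A ->
  lebesgue_rV (sh i j a @^-1` A) = lebesgue_rV A.
Proof.
move=> ij mA; apply: (@lebesgue_rV_shear _ _ i (fun v : V => a * v 0 j)) => //.
- by apply: measurable_funM => //; exact: measurable_rV_coord.
- by move=> v w ->//; rewrite eq_sym.
Qed.

(** For the angle [theta = 2 atan t] one has [t = tan (theta / 2)] and
    [2 t / (1 + t^2) = sin theta]: this is the classical factorization of a plane rotation into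
    three shears. It explains the rational parametrization. *)
Let rotE i j t : i != j ->
  plane_rot i j t = sh i j (- t) \o sh j i (2 * t / (1 + t ^+ 2)) \o sh i j (- t).
Proof.
move=> ij; apply/funext => x; apply/rowP => k.
rewrite /plane_rot /sh/= !mxE/= !eqxx (eq_sym j i) (negbTE ij) /=.
by field; exact: t2_neq0.
Qed.

Lemma measurable_rot i j t : i != j -> measurable_fun setT (plane_rot i j t).
Proof.
by move=> ij; rewrite rotE//; do 2 apply: measurableT_comp => //; exact: msh.
Qed.

Lemma lebesgue_rot i j t A : i != j -> measurable A ->
  lebesgue_rV (plane_rot i j t @^-1` A) = lebesgue_rV A.
Proof.
move=> ij mA; rewrite rotE//.
rewrite -[LHS]/(lebesgue_rV (sh i j (- t) @^-1` (sh j i (2 * t / (1 + t ^+ 2)) @^-1`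
  (sh i j (- t) @^-1` A)))).
have mp i' j' a B : measurable B -> measurable (sh i' j' a @^-1` B).
  by move=> mB; rewrite -[X in measurable X]setTI; exact: msh.
rewrite lebesgue_sh//; last by apply: (mp); apply: (mp).
rewrite lebesgue_sh 1?eq_sym//; last by apply: (mp).
by rewrite lebesgue_sh.
Qed.

Lemma omega_rot i j t A : i != j -> measurable A ->
  omega (plane_rot i j t @^-1` A) = omega A.
Proof.
move=> ij mA; rewrite /omega; congr (_ * _)%E.
have mpA : measurable [set x : V | punctured_ball x /\ A (normalize x)].
  rewrite (_ : mkset _ = punctured_ball `&` (setT `&` normalize @^-1` A)).
    by apply: measurableI; [exact: measurable_punctured_ball|exact: measurable_normalize].
  by rewrite setTI.
rewrite -[RHS](lebesgue_rot t ij mpA); congr (lebesgue_rV _).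
by apply/seteqP; split => x /=; rewrite /punctured_ball/= enorm_rot// normalize_rot.
Qed.

Let rot_pre i j t : i != j -> plane_rot i j t @^-1` sphere = @sphere R d.
Proof. by move=> ij; apply/seteqP; split => x Sx; apply/(sphere_rot t x ij). Qed.

Let ge0_integral_rot i j t (f : V -> \bar R) : i != j ->
  measurable_fun setT f -> (forall x, 0 <= f x)%E ->
  (\int[omega]_(x in sphere) f (plane_rot i j t x) = \int[omega]_(x in sphere) f x)%E.
Proof.
move=> ij mf f0.
have := @ge0_integral_pushforward _ _ _ _ _ _ (measurable_rot t ij) (@omega R d)
  sphere f measurable_sphere (measurable_funS measurableT (@subsetT _ _) mf)
  (fun x _ => f0 x).
rewrite rot_pre// => <-; apply: eq_measure_integral; first exact: measurable_rot.
by move=> mr A mA _; rewrite -[RHS](omega_rot t ij mA).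
Qed.

Lemma Rintegral_rot i j t (h : V -> R) : i != j ->
  omega.-integrable sphere (EFin \o h) ->
  \int[omega]_(x in sphere) h (plane_rot i j t x) = \int[omega]_(x in sphere) h x.
Proof.
move=> ij ih.
pose f := (EFin \o h) \_ sphere.
have mf : measurable_fun setT f.
  apply/(measurable_restrictT _ measurable_sphere).
  by case/integrableP : ih.
have fE x : sphere x -> f x = (h x)%:E by move=> Sx; rewrite /f patchE mem_set.
rewrite /Rintegral; congr fine.
transitivity (\int[omega]_(x in sphere) f (plane_rot i j t x))%E.
  by apply: eq_integral => x /set_mem Sx; rewrite fE//; exact/sphere_rot.
transitivity (\int[omega]_(x in sphere) f x)%E; last first.
  by apply: eq_integral => x /set_mem Sx; rewrite fE.
rewrite [LHS]integralE [RHS]integralE; congr (_ - _)%E.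
  rewrite -[RHS](ge0_integral_rot t ij (measurable_funepos mf) (funepos_ge0 f)).
  by apply: eq_integral => x _; rewrite !funeposE.
rewrite -[RHS](ge0_integral_rot t ij (measurable_funeneg mf) (funeneg_ge0 f)).
by apply: eq_integral => x _; rewrite !funenegE.
Qed.

End omega_theory.

Section omega_gt0.
Context {R : realType} {d : nat}.
Local Notation V := 'rV[R]_d.

Lemma continuous_rV_sum (I : Type) (r : seq I) (F : I -> V -> R) (x : V) :
  (forall i, {for x, continuous (F i)}) ->
  {for x, continuous (fun y => \sum_(i <- r) F i y)}.
Proof.
move=> cF; elim: r => [|a r IH].
  rewrite (_ : (fun _ => _) = cst 0); first exact: cst_continuous.
  by apply/funext => y; rewrite big_nil.
rewrite (_ : (fun _ => _) = (fun y => F a y + \sum_(i <- r) F i y)).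
  by apply: continuousD; [exact: cF|exact: IH].
by apply/funext => y; rewrite big_cons.
Qed.

Lemma continuous_dot (u : V) : continuous (fun x : V => dot x u).
Proof.
move=> x; apply: continuous_rV_sum => i; apply: continuousM; last exact: cst_continuous.
exact: coord_continuous.
Qed.

Lemma continuous_enorm : continuous (@enorm R d).
Proof.
move=> x; apply: (@continuous_comp _ _ _ (fun x : V => dot x x) Num.sqrt).
  by apply: continuous_rV_sum => i; apply: continuousM; exact: coord_continuous.
exact: sqrt_continuous.
Qed.

Lemma continuous_normalize (x : V) : x != 0 -> {for x, continuous (@normalize R d)}.
Proof.
move=> x0; apply: continuousZ; last exact: cvg_id.
apply: continuousV; last exact: continuous_enorm.
by apply: contraNneq x0 => /enorm_eq0 ->.
Qed.

Lemma omega_gt0 (O : set V) : open O -> sphere `&` O !=set0 ->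
  (0 < omega (sphere `&` O))%E.
Proof.
move=> oO [x0 [Sx0 Ox0]].
have d0 : (0 < d)%N.
  rewrite lt0n; apply/eqP => d0; move: Sx0 => /sphereP; rewrite /dot big1.
    by move/eqP; rewrite eq_sym oner_eq0.
  by move=> [i ilt]; exfalso; move: ilt; rewrite d0.
(* Half of [x0] is an interior point of the cone over the open set, so a whole cube at [z0] fits
   into the cone. *)
pose z0 : V := 2^-1 *: x0.
have ez0 : enorm z0 = 2^-1 by rewrite enormZ Sx0 mulr1 ger0_norm.
have z0n0 : z0 != 0.
  by apply/eqP => z00; move: ez0; rewrite z00 /enorm dot0l sqrtr0; lra.
have nz0 : normalize z0 = x0.
  by rewrite /normalize ez0 /z0 scalerA invrK divff// scale1r.
have [e e0 eP] : exists2 e : R, 0 < e & ball z0 e `<=`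
    [set z | punctured_ball z /\ (sphere `&` O) (normalize z)].
  have : nbhs z0 [set z | punctured_ball z /\ (sphere `&` O) (normalize z)].
    have n1 : \forall z \near z0, 0 < enorm z.
      by apply: (cvgr_gt _ (@continuous_enorm z0)); rewrite ez0 invr_gt0.
    have n2 : \forall z \near z0, enorm z < 1.
      by apply: (cvgr_lt _ (@continuous_enorm z0)); rewrite ez0 invf_lt1// ltr1n.
    have n3 : \forall z \near z0, O (normalize z).
      by apply: (continuous_normalize z0n0); rewrite nz0; exact: open_nbhs_nbhs.
    near=> z; split.
      apply/andP; split; first by near: z.
      by apply: ltW; near: z.
    split; last by near: z.
    apply: sphere_normalize; apply/eqP => zz.
    suff : 0 < enorm z by rewrite zz /enorm dot0l sqrtr0 ltxx.
    by near: z.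
  by move=> /nbhs_ballP[e /= e0 eb]; exists e.
rewrite /omega mule_gt0// ?lte_fin ?ltr0n//.
pose B := [set v : V | forall i, z0 0 i <= v 0 i <= z0 0 i + e / 2].
have e20 : 0 < e / 2 by rewrite divr_gt0.
have BE : lebesgue_rV B = (\prod_(i < d) (e / 2))%:E.
  rewrite lebesgue_rV_box; last by move=> i; rewrite lerDl ltW.
  by congr EFin; apply: eq_bigr => i _; ring.
apply: (@lt_le_trans _ _ (lebesgue_rV B)).
  by rewrite BE lte_fin; apply: prodr_gt0.
apply: le_measure; rewrite ?inE.
- rewrite (_ : B = \bigcap_(i in [set: 'I_d]) (setT `&` (fun v : V => v 0 i) @^-1` `[z0 0 i, z0 0 i + e / 2])).
    by apply: fin_bigcap_measurable => // i _; exact: measurable_rV_coord.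
  apply/seteqP; split => v /= vb i.
    by move=> _; split => //; rewrite /= in_itv/=; exact: vb.
  by have [_] := vb i I; rewrite /= in_itv.
- rewrite (_ : mkset _ = punctured_ball `&` (setT `&` normalize @^-1` (sphere `&` O))).
    apply: measurableI; first exact: measurable_punctured_ball.
    apply: measurable_normalize => //; apply: measurableI; first exact: measurable_sphere.
    exact: open_measurable_rV.
  by rewrite setTI.
- move=> v vB; apply: eP; apply/ball_rVP => // i.
  have /andP[v1 v2] := vB i.
  rewrite ler0_norm ?subr_le0// opprB ltrBlDl (le_lt_trans v2)// ltrD2l; lra.
Unshelve. all: end_near. Qed.

End omega_gt0.

(** * Smooth functions near the sphere and integration by parts *)

Section near_differentiable.
Context {R : realType} {V W : normedModType R}.

Lemma near_differentiable (f g : V -> W) x : (\near x, f x = g x) ->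
  differentiable f x -> differentiable g x.
Proof.
move=> fg df; have fgx : f x = g x by exact: nbhs_singleton fg.
have [cdf dfE] := (diff_locallyP x f).1 df.
have gE : g \o shift x = cst (g x) + 'd f x +o_ 0 id.
  apply/eqaddoP => e e0; move/eqaddoP : dfE => /(_ e e0) H.
  have fg0 : \forall y \near 0, f (y + x) = g (y + x).
    by move: fg; rewrite (near_shift 0 x) /= subr0; apply: filterS => y /=.
  near=> y.
  rewrite (_ : _ y = (f \o shift x - (cst (f x) + 'd f x)) y); first by near: y.
  rewrite !fctE /= fgx; congr (_ - _); apply/esym.
  by near: y.
apply/diff_locallyP; rewrite (diff_unique cdf gE); split => //.
Unshelve. all: end_near. Qed.

End near_differentiable.

Section Ckon.
Context {R : realType} {d : nat}.
Local Notation V := 'rV[R]_d.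
Implicit Types (f g : V -> R) (O : set V) (i j : 'I_d).

Definition pd i f (x : V) : R := 'D_(delta_mx 0 i) f x.

(** A local version of [Ck]: the kernels in use are smooth only away from their poles. *)
Fixpoint Ckon O (k : nat) f : Prop :=
  match k with
  | 0 => forall x, O x -> {for x, continuous f}
  | m.+1 => (forall x, O x -> differentiable f x) /\ forall i, Ckon O m (pd i f)
  end.

Definition smooth_on O f := forall k, Ckon O k f.

Lemma Ckon_setT k f : Ckon setT k f <-> Ck k f.
Proof.
elim: k f => [|k IH] f /=; first by split=> cf x; [exact: cf|move=> _; exact: cf].
split=> -[df Df]; split.
- by move=> x; exact: df.
- by move=> i; apply/IH; exact: Df.
- by move=> x _; exact: df.
- by move=> i; apply/IH; exact: Df.
Qed.

Lemma smooth_on_setT f : smooth_on setT f <-> smooth f.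
Proof. by split=> sf k; apply/Ckon_setT; exact: sf. Qed.

Lemma Ckon_subset O1 O2 k f : O1 `<=` O2 -> Ckon O2 k f -> Ckon O1 k f.
Proof.
move=> O12; elim: k f => [|k IH] f /=; first by move=> cf x /O12; exact: cf.
by move=> [df Df]; split=> [x /O12|i]; [exact: df|exact/IH/Df].
Qed.

Lemma CkonU O1 O2 k f : Ckon O1 k f -> Ckon O2 k f -> Ckon (O1 `|` O2) k f.
Proof.
elim: k f => [|k IH] f /=; first by move=> c1 c2 x [/c1|/c2].
by move=> [d1 D1] [d2 D2]; split=> [x [/d1|/d2]//|i]; exact: IH.
Qed.

Lemma Ckon_le O k f : Ckon O k.+1 f -> Ckon O k f.
Proof.
elim: k f => [|k IH] f /= [df Df].
  by move=> x /df; exact: differentiable_continuous.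
by split=> // i; exact: IH.
Qed.

Lemma Ckon_cont O k f : Ckon O k f -> forall x, O x -> {for x, continuous f}.
Proof. by elim: k f => // k IH f /Ckon_le/IH. Qed.

Lemma Ckon_ext O k f g : open O -> (forall x, O x -> f x = g x) ->
  Ckon O k f -> Ckon O k g.
Proof.
move=> oO; have nO x : O x -> \near x, O x by move=> Ox; exact: open_nbhs_nbhs.
elim: k f g => [|k IH] f g fg /=.
  move=> cf x Ox.
  have nfg : {near x, f =1 g} by apply: filterS (nO x Ox).
  have := cf x Ox; rewrite /prop_for /continuous_at -fg// => cfx.
  exact: cvg_trans (near_eq_cvg nfg) cfx.
move=> [df Df]; split=> [x Ox|i].
  apply: near_differentiable (df x Ox).
  by apply: filterS (nO x Ox) => y Oy; exact: fg.
apply: IH (Df i) => x Ox; apply: near_eq_derive.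
by apply: filterS (nO x Ox) => y Oy; exact: fg.
Qed.

Lemma pd_near i f g x : (\near x, f x = g x) -> pd i f x = pd i g x.
Proof. exact: near_eq_derive. Qed.

Lemma pd_cst i (a : R) : pd i (cst a) = cst 0.
Proof. by apply/funext => x; rewrite /pd derive_cst. Qed.

Lemma pdD i f g x : differentiable f x -> differentiable g x ->
  pd i (f \+ g) x = pd i f x + pd i g x.
Proof. by move=> df dg; rewrite /pd -deriveD//; exact: diff_derivable. Qed.

Lemma pdM i f g x : differentiable f x -> differentiable g x ->
  pd i (f \* g) x = pd i f x * g x + f x * pd i g x.
Proof.
move=> df dg; rewrite addrC [pd i f x * _]mulrC /pd.
by rewrite -[LHS]/('D_(delta_mx 0 i) (f * g) x) deriveM//; exact: diff_derivable.
Qed.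

Lemma pd_coord i j x : pd i (fun y : V => y 0 j) x = (j == i)%:R.
Proof.
rewrite /pd deriveE; last exact: differentiable_coord.
have lc : linear (fun y : V => y 0 j : R^o) by move=> a u v; rewrite !mxE.
pose lM := GRing.isLinear.Build _ _ _ _ _ lc.
pose L : {linear V -> R^o} := HB.pack (fun y : V => y 0 j : R^o) lM.
rewrite (_ : 'd _ x = L :> (V -> R)).
  by rewrite /= mxE eqxx.
by apply: (@diff_lin R V R^o L); exact: coord_continuous.
Qed.

Lemma Ckon_cst O k (a : R) : Ckon O k (cst a).
Proof.
elim: k a => [|k IH] a /=; first by move=> x _; exact: cst_continuous.
by split=> // i; rewrite pd_cst; exact: IH.
Qed.

Lemma Ckon_coord O k j : Ckon O k (fun y : V => y 0 j).
Proof.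
case: k => [|k] /=; first by move=> x _; exact: coord_continuous.
split=> [x _|i]; first exact: differentiable_coord.
by rewrite (funext (pd_coord i j)); exact: Ckon_cst.
Qed.

Lemma CkonD O k f g : open O -> Ckon O k f -> Ckon O k g -> Ckon O k (f \+ g).
Proof.
move=> oO; elim: k f g => [|k IH] f g /=.
  by move=> cf cg x Ox; apply: continuousD; [exact: cf|exact: cg].
move=> [df Df] [dg Dg]; split=> [x Ox|i].
  by apply: differentiableD; [exact: df|exact: dg].
apply: (@Ckon_ext O k (pd i f \+ pd i g)) => //; last exact: IH.
by move=> x Ox; rewrite pdD//; [exact: df|exact: dg].
Qed.

Lemma CkonM O k f g : open O -> Ckon O k f -> Ckon O k g -> Ckon O k (f \* g).
Proof.
move=> oO; elim: k f g => [|k IH] f g.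
  by move=> cf cg x Ox; apply: continuousM; [exact: cf|exact: cg].
move=> /[dup] Cf [df Df] /[dup] Cg [dg Dg]; split=> [x Ox|i].
  by apply: differentiableM; [exact: df|exact: dg].
apply: (@Ckon_ext O k ((pd i f \* g) \+ (f \* pd i g))) => //.
  by move=> x Ox; rewrite pdM//; [exact: df|exact: dg].
apply: CkonD => //; apply: IH => //; solve [exact: Df|exact: Dg|exact: Ckon_le Cf|exact: Ckon_le Cg].
Qed.

Lemma smooth_on_cst O a : smooth_on O (cst a).
Proof. by move=> k; exact: Ckon_cst. Qed.

Lemma smooth_on_coord O j : smooth_on O (fun y : V => y 0 j).
Proof. by move=> k; exact: Ckon_coord. Qed.

Lemma smooth_onD O f g : open O -> smooth_on O f -> smooth_on O g ->
  smooth_on O (fun x => f x + g x).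
Proof. by move=> oO sf sg k; exact: CkonD. Qed.

Lemma smooth_onM O f g : open O -> smooth_on O f -> smooth_on O g ->
  smooth_on O (fun x => f x * g x).
Proof. by move=> oO sf sg k; exact: CkonM. Qed.

Lemma smooth_onZ O a f : open O -> smooth_on O f -> smooth_on O (fun x => a * f x).
Proof. by move=> oO; apply: smooth_onM => //; exact: smooth_on_cst. Qed.

Lemma smooth_onN O f : open O -> smooth_on O f -> smooth_on O (fun x => - f x).
Proof.
move=> oO /(smooth_onZ (-1) oO); rewrite (_ : (fun x => -1 * f x) = fun x => - f x)//.
by apply/funext => x; rewrite mulN1r.
Qed.

Lemma smooth_onB O f g : open O -> smooth_on O f -> smooth_on O g ->
  smooth_on O (fun x => f x - g x).
Proof. by move=> oO sf sg; apply: smooth_onD => //; exact: smooth_onN. Qed.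

Lemma smooth_on_sum O (I : Type) (r : seq I) (P : pred I) (F : I -> V -> R) : open O ->
  (forall e, smooth_on O (F e)) -> smooth_on O (fun x => \sum_(e <- r | P e) F e x).
Proof.
move=> oO sF; elim: r => [|a r IH].
  rewrite (_ : (fun _ => _) = cst 0); first exact: smooth_on_cst.
  by apply/funext => y; rewrite big_nil.
rewrite (_ : (fun _ => _) =
    (fun y => (if P a then F a y else 0) + \sum_(e <- r | P e) F e y)).
  apply: smooth_onD => //; case: (P a) => //; exact: smooth_on_cst.
by apply/funext => y; rewrite big_cons; case: (P a) => //; rewrite add0r.
Qed.

Lemma smooth_on_pd O i f : smooth_on O f -> smooth_on O (pd i f).
Proof. by move=> sf k; have [_] := sf k.+1; exact. Qed.

Lemma smooth_on_diff O f x : smooth_on O f -> O x -> differentiable f x.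
Proof. by move=> /(_ 1) [df _] Ox; exact: df. Qed.

Lemma smooth_on_ext O f g : open O -> (forall x, O x -> f x = g x) ->
  smooth_on O f -> smooth_on O g.
Proof. by move=> oO fg sf k; exact: (Ckon_ext oO fg (sf k)). Qed.

Lemma smooth_onU O1 O2 f : smooth_on O1 f -> smooth_on O2 f -> smooth_on (O1 `|` O2) f.
Proof. by move=> s1 s2 k; exact: CkonU. Qed.

Lemma smooth_on_subset O1 O2 f : O1 `<=` O2 -> smooth_on O2 f -> smooth_on O1 f.
Proof. by move=> O12 s k; exact: (Ckon_subset O12 (s k)). Qed.

Lemma differentiable_comp1 (u : R -> R) (a : V -> R) x : differentiable a x ->
  derivable u (a x) 1 -> differentiable (fun y => u (a y)) x.
Proof.
by move=> da /derivable1_diffP du; exact: (differentiable_comp da du).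
Qed.

Lemma pd_comp (u u' : R -> R) (a : V -> R) x i : differentiable a x ->
  is_derive (a x) 1 u (u' (a x)) ->
  pd i (fun y => u (a y)) x = u' (a x) * pd i a x.
Proof.
move=> da [du <-]; rewrite /pd (deriveE _ (differentiable_comp1 da du)).
move/derivable1_diffP : (du) => dua.
rewrite (deriveE _ da) (deriveE _ dua).
rewrite -[X in 'd X x]/(u \o a) (diff_comp da dua)/=.
by rewrite -[in LHS](mulr1 ('d a x _)) -[X in 'd u (a x) X]/(_ *: 1) linearZ mulrC.
Qed.

(** The induction on the order of differentiability needs the derivative of [u] to be of the same
    kind, hence a whole family [F] closed under differentiation: multiples of powers for kernels,
    [flat P] for cutoffs. *)
Lemma smooth_on_comp (F : set (R -> R)) (I : set R) O (a : V -> R) :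
  open O -> smooth_on O a -> (forall x, O x -> I (a x)) ->
  (forall u, F u -> exists2 u', F u' & forall t, I t -> is_derive t 1 u (u' t)) ->
  forall u, F u -> smooth_on O (fun x => u (a x)).
Proof.
move=> oO sa aI F' u Fu k; elim: k u Fu => [|k IH] u /F'[u' Fu' uu'].
  move=> x Ox; have [du _] := uu' _ (aI _ Ox).
  apply: (@continuous_comp _ _ _ a u); first exact: (sa 0).
  by apply: differentiable_continuous; exact/derivable1_diffP.
split=> [x Ox|i].
  apply: differentiable_comp1; first exact: smooth_on_diff sa Ox.
  by have [] := uu' _ (aI _ Ox).
apply: (@Ckon_ext O k ((fun x => u' (a x)) \* pd i a)) => //; last first.
  by apply: CkonM => //; [exact: IH|exact: smooth_on_pd].
by move=> x Ox; rewrite (pd_comp i (smooth_on_diff sa Ox) (uu' _ (aI _ Ox))).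
Qed.

End Ckon.

Section is_derive1.
Context {R : realType}.
Implicit Types (f g : R -> R) (x df dg a : R).

Lemma is_derive1_eq f x df dg : is_derive x 1 f df -> df = dg -> is_derive x 1 f dg.
Proof. by move=> ? <-. Qed.

Lemma is_derive1D f g x df dg : is_derive x 1 f df -> is_derive x 1 g dg ->
  is_derive x 1 (fun y => f y + g y) (df + dg).
Proof. exact: is_deriveD. Qed.

Lemma is_derive1B f g x df dg : is_derive x 1 f df -> is_derive x 1 g dg ->
  is_derive x 1 (fun y => f y - g y) (df - dg).
Proof. exact: is_deriveB. Qed.

Lemma is_derive1M f g x df dg : is_derive x 1 f df -> is_derive x 1 g dg ->
  is_derive x 1 (fun y => f y * g y) (df * g x + f x * dg).
Proof.
move=> Df Dg; apply: is_derive1_eq (is_deriveM Df Dg) _.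
by rewrite addrC /GRing.scale/= mulrC.
Qed.

Lemma is_derive1Z a f x df : is_derive x 1 f df ->
  is_derive x 1 (fun y => a * f y) (a * df).
Proof. exact: is_deriveZ. Qed.

Lemma is_derive1X n f x df : is_derive x 1 f df ->
  is_derive x 1 (fun y => f y ^+ n) (n%:R * f x ^+ n.-1 * df).
Proof.
move=> Df; rewrite (_ : (fun y => f y ^+ n) = f ^+ n); first exact: is_deriveX.
by apply/funext => y; rewrite fctE.
Qed.

Lemma is_derive1V f x df : f x != 0 -> is_derive x 1 f df ->
  is_derive x 1 (fun y => (f y)^-1) (- df / f x ^+ 2).
Proof.
move=> f0 [Df <-]; split; first exact: derivableV.
by rewrite deriveV// /GRing.scale/= mulNr mulrC mulNr.
Qed.

End is_derive1.

Section rot_derive.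
Context {R : realType} {d : nat}.
Local Notation V := 'rV[R]_d.
Implicit Types (f h : V -> R) (O : set V) (i j : 'I_d) (x : V).

Lemma pdE i f x : differentiable f x -> 'd f x (delta_mx 0 i) = pd i f x.
Proof. by move=> df; rewrite /pd deriveE. Qed.

Lemma is_derive1_scalel (a : R -> R) (t da : R) (v : V) : is_derive t 1 a da ->
  is_derive t 1 (fun s => a s *: v) (da *: v).
Proof.
move=> [/derivable1_diffP dfa <-].
have dav := differentiableZl v dfa.
split; first exact/derivable1_diffP.
by rewrite deriveE// diffZl// deriveE.
Qed.

Lemma is_derive1_curve f (g : R -> V) (t : R) (v : V) : differentiable f (g t) ->
  is_derive t 1 g v -> is_derive t 1 (fun s => f (g s)) ('d f (g t) v).
Proof.
move=> df [/derivable1_diffP dg <-].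
have dc : differentiable (f \o g) t by exact: differentiable_comp.
split; first exact/derivable1_diffP.
by rewrite (deriveE _ dc) (diff_comp dg df)/= deriveE.
Qed.

(** The generator of the rotations in the plane of [e_i] and [e_j]. *)
Definition angular i j f x : R := x 0 i * pd j f x - x 0 j * pd i f x.

(** The factor [2 / (1 + t^2)] is the derivative of the angle [2 atan t]. *)
Lemma is_derive_rot i j f t x : i != j -> differentiable f (plane_rot i j t x) ->
  is_derive t 1 (fun s => f (plane_rot i j s x))
    (2 / (1 + t ^+ 2) * angular i j f (plane_rot i j t x)).
Proof.
move=> ij df.
have t2 : 1 + t ^+ 2 != 0 by rewrite gt_eqF// ltr_pwDl// sqr_ge0.
pose S (s : R) : R := 2 * s * (1 + s ^+ 2)^-1.
pose a s := S s * (- s * x 0 i - x 0 j).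
pose b s := S s * (x 0 i - s * x 0 j).
have rotE s : plane_rot i j s x = x + (a s *: delta_mx 0 i + b s *: delta_mx 0 j).
  by rewrite /plane_rot scalerDr !scalerA.
have dS : is_derive t 1 S (2 * (1 - t ^+ 2) / (1 + t ^+ 2) ^+ 2).
  have d1 := is_derive1D (is_derive_cst (1 : R) t 1) (is_derive1X 2 (is_derive_id t 1)).
  have d2 := is_derive1Z 2 (is_derive_id t 1).
  apply: is_derive1_eq (is_derive1M d2 (@is_derive1V R (fun s => 1 + s ^+ 2) t _ t2 d1)) _.
  by rewrite /=; field.
have d0 (u v : R) : is_derive t 1 (fun s => u - s * v) (- v).
  have d1 := is_derive1M (is_derive_id t 1) (is_derive_cst v t 1).
  apply: is_derive1_eq (is_derive1B (is_derive_cst u t 1) d1) _.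
  by rewrite /=; ring.
pose p := plane_rot i j t x.
have p_ k : p 0 k = x 0 k + (a t * (k == i)%:R + b t * (k == j)%:R).
  by rewrite /p rotE !mxE/=.
have da : is_derive t 1 a (- (2 / (1 + t ^+ 2) * p 0 j)).
  have aE : a = fun s => S s * (- x 0 j - s * x 0 i).
    by apply/funext => s; rewrite /a; ring.
  rewrite aE; apply: is_derive1_eq (is_derive1M dS (d0 (- x 0 j) (x 0 i))) _.
  rewrite p_ eqxx eq_sym (negbTE ij)/= /a /b /S.
  by field.
have db : is_derive t 1 b (2 / (1 + t ^+ 2) * p 0 i).
  apply: is_derive1_eq (is_derive1M dS (d0 (x 0 i) (x 0 j))) _.
  rewrite p_ eqxx (negbTE ij)/= /a /b /S.
  by field.
have dg := is_deriveD (is_derive_cst x t 1)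
  (is_deriveD (is_derive1_scalel (delta_mx 0 i : V) da)
    (is_derive1_scalel (delta_mx 0 j : V) db)).
have rotE' : (fun s => plane_rot i j s x) = cst x +
  ((fun s => a s *: delta_mx 0 i) + (fun s => b s *: delta_mx 0 j)).
  by apply/funext => s; rewrite rotE.
rewrite -rotE' in dg.
have := is_derive1_curve df dg.
rewrite add0r linearD !linearZ /= !pdE// -/p /angular /GRing.scale/=.
by move=> H; apply: is_derive1_eq H _; ring.
Qed.

End rot_derive.

Section sphere_integral.
Context {R : realType} {d : nat}.
Local Notation V := 'rV[R]_d.
Local Notation S := (@sphere R d).
Implicit Types (f g h : V -> R) (O : set V) (i j : 'I_d) (x : V).

Lemma measurable_fun_continuous_at (D : set V) f : measurable D ->
  (forall x, D x -> {for x, continuous f}) -> measurable_fun D f.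
Proof.
move=> mD cf; apply: (measurability _ (RGenOpens.measurableE R)).
move=> _ [_ [a [b ->]] <-].
rewrite (_ : _ `&` _ = D `&` interior (f @^-1` `]a, b[)).
  by apply: measurableI => //; apply: open_measurable_rV; exact: open_interior.
apply/seteqP; split => x [Dx fx]; split => //; last exact: interior_subset.
by apply: cf => //; apply: open_nbhs_nbhs; split => //; exact: interval_open.
Qed.

Definition contS f := forall x, S x -> {for x, continuous f}.

Lemma contSD f g : contS f -> contS g -> contS (fun x => f x + g x).
Proof. by move=> cf cg x Sx; apply: continuousD; [exact: cf|exact: cg]. Qed.

Lemma contSN f : contS f -> contS (fun x => - f x).
Proof. by move=> cf x Sx; apply: continuousN; exact: cf. Qed.

Lemma contSM f g : contS f -> contS g -> contS (fun x => f x * g x).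
Proof. by move=> cf cg x Sx; apply: continuousM; [exact: cf|exact: cg]. Qed.

Lemma contS_cst (a : R) : contS (fun=> a).
Proof. by move=> x Sx; exact: cst_continuous. Qed.

Lemma contS_coord i : contS (fun x => x 0 i).
Proof. by move=> x Sx; exact: coord_continuous. Qed.

Lemma contS_sum (I : Type) (r : seq I) (P : pred I) (F : I -> V -> R) :
  (forall e, contS (F e)) -> contS (fun x => \sum_(e <- r | P e) F e x).
Proof.
move=> cF x Sx; rewrite (_ : (fun _ => _) = fun x => \sum_(e <- r) if P e then F e x else 0).
  apply: continuous_rV_sum => e; case: (P e); [exact: cF|exact: cst_continuous].
by apply/funext => y; rewrite big_mkcond.
Qed.

Lemma contS_Ckon O k f : S `<=` O -> Ckon O k f -> contS f.
Proof. by move=> SO /Ckon_cont cf x /SO; exact: cf. Qed.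

Lemma compact_sphere : compact S.
Proof.
apply: bounded_closed_compact.
  exists 1; split; first exact: num_real.
  move=> M M1 x Sx; suff : mx_norm x <= M by [].
  rewrite mx_normrE; apply/bigmax_leP; split.
    by rewrite (le_trans _ (ltW M1)).
  move=> [i j] _ /=; rewrite ord1 (le_trans (sphere_coord_le1 _ Sx))//.
  exact: ltW.
rewrite (_ : sphere = enorm @^-1` [set 1])//.
apply: closed_comp; last exact: closed_eq.
by move=> x _; exact: continuous_enorm.
Qed.

Lemma contS_bounded f : contS f -> exists M : R, forall x, S x -> `|f x| <= M.
Proof.
move=> cf.
have cfS : {within S, continuous f}.
  by apply: continuous_in_subspaceT => x /set_mem; exact: cf.
have [M [_ Mf]] := compact_bounded (continuous_compact cfS compact_sphere).
exists (M + 1) => x Sx; apply: (Mf (M + 1)); first by rewrite ltrDl.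
by exists x.
Qed.

Lemma contS_measurable f : contS f -> measurable_fun S f.
Proof. by move=> cf; apply: measurable_fun_continuous_at => //; exact: measurable_sphere. Qed.

Lemma omega_sphere_lty : (omega S < +oo)%E.
Proof. by rewrite -ge0_fin_numE//; apply: fin_num_measure; exact: measurable_sphere. Qed.

Lemma bounded_integrableS f (M : R) : measurable_fun S f -> (forall x, S x -> `|f x| <= M) ->
  omega.-integrable S (EFin \o f).
Proof.
move=> mf fM; apply: measurable_bounded_integrable => //.
- exact: measurable_sphere.
- exact: omega_sphere_lty.
- exists M; split; first exact: num_real.
  by move=> N MN x Sx; apply: le_trans (fM _ Sx) (ltW MN).
Qed.

Lemma contS_integrable f : contS f -> omega.-integrable S (EFin \o f).
Proof.
move=> cf; have [M fM] := contS_bounded cf.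
by apply: bounded_integrableS fM; exact: contS_measurable.
Qed.

Lemma intSD f g : contS f -> contS g ->
  \int[omega]_(x in S) (f x + g x) = \int[omega]_(x in S) f x + \int[omega]_(x in S) g x.
Proof.
move=> cf cg; rewrite RintegralD//; [exact: measurable_sphere|exact: contS_integrable..].
Qed.

Lemma intSZ (a : R) f : contS f ->
  \int[omega]_(x in S) (a * f x) = a * \int[omega]_(x in S) f x.
Proof.
move=> cf; rewrite RintegralZl//; [exact: measurable_sphere|exact: contS_integrable].
Qed.

Lemma intSN f : contS f -> \int[omega]_(x in S) (- f x) = - \int[omega]_(x in S) f x.
Proof.
move=> cf; rewrite -mulN1r -intSZ//; apply: eq_Rintegral => x _.
by rewrite mulN1r.
Qed.

Lemma intS_sum (I : Type) (r : seq I) (F : I -> V -> R) : (forall e, contS (F e)) ->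
  \int[omega]_(x in S) (\sum_(e <- r) F e x) = \sum_(e <- r) \int[omega]_(x in S) F e x.
Proof.
move=> cF; elim: r => [|a r IH].
  rewrite big_nil (@eq_Rintegral _ _ _ _ _ (cst 0)); last by move=> x _; rewrite big_nil.
  by rewrite Rintegral_cst ?mul0r//; exact: measurable_sphere.
rewrite big_cons -IH -intSD//; last exact: contS_sum.
by apply: eq_Rintegral => x _; rewrite big_cons.
Qed.

Lemma plane_rot0 i j x : plane_rot i j 0 x = x.
Proof. by rewrite /plane_rot mulr0 mul0r scale0r addr0. Qed.

(** By rotation invariance the integral of [h] composed with the rotation does not depend on [t].
    Its derivative at [t = 0], taken under the integral sign, is twice the integral in question. *)
Lemma intS_angular O i j h : open O -> S `<=` O -> Ckon O 1 h -> i != j ->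
  \int[omega]_(x in S) angular i j h x = 0.
Proof.
move=> oO SO Ch ij; have [dh Dh] := Ch.
have ca : contS (angular i j h).
  have cpd k : contS (pd k h) by exact: (@contS_Ckon O 0 (pd k h) SO (Dh k)).
  apply: contSD; first by apply: contSM => //; exact: contS_coord.
  by apply: contSN; apply: contSM => //; exact: contS_coord.
have [M aM] := contS_bounded ca.
have ch := contS_Ckon SO Ch.
have Srot t x : S x -> S (plane_rot i j t x) by move=> Sx; apply/(sphere_rot t x ij).
have crot t : contS (fun x => h (plane_rot i j t x)).
  move=> x Sx; apply: (@continuous_comp _ _ _ (plane_rot i j t) h).
    rewrite /plane_rot.
    apply: (@continuousD _ _ _ id); first exact: cvg_id.
    apply: continuousZ; first exact: cst_continuous.
    by apply: continuousD; apply: continuousZ; try exact: cst_continuous;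
      apply: continuousB; do ?(apply: continuousM; first exact: cst_continuous);
      exact: coord_continuous.
  exact: (ch _ (Srot t x Sx)).
pose F (t : R) := \int[omega]_(x in S) h (plane_rot i j t x).
have F0 t : F t = F 0 by rewrite /F !Rintegral_rot//; exact: contS_integrable.
have dd (t : R) y : S y -> is_derive t 1 (fun s => h (plane_rot i j s y))
    (2 / (1 + t ^+ 2) * angular i j h (plane_rot i j t y)).
  by move=> Sy; apply: is_derive_rot => //; apply/dh/SO; exact: Srot.
have M0 : 0 <= `|M| *+ 2 by rewrite mulrn_wge0.
have I0 : `]-1, 1[%classic (0 : R) by rewrite /= in_itv/=; apply/andP; split; lra.
have dF : derive1 F 0 = \int[omega]_(x in S)
    partial1of2 (fun t y => h (plane_rot i j t y)) 0 x.
  apply: (@differentiation_under_integral R _ _ (@omega R d)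
    (fun t y => h (plane_rot i j t y)) S measurable_sphere 0 (-1) 1 I0 _ _
    (fun=> `|M| *+ 2)) => //.
  - by move=> t _; exact: contS_integrable.
  - by move=> t y _ Sy; have [] := dd t y Sy.
  - by apply: contS_integrable; exact: contS_cst.
  - move=> t y _ Sy; rewrite partial1of2E; have [_ ->] := dd t y Sy.
    rewrite normrM -[leRHS]mulr_natl ler_pM//; last first.
      by apply: le_trans (aM _ (Srot t y Sy)) (ler_norm _).
    rewrite ger0_norm ?divr_ge0// ?addr_ge0 ?sqr_ge0//.
    by rewrite ler_pdivrMr ?ltr_pwDl ?sqr_ge0// ler_peMr// lerDl sqr_ge0.
have F00 : derive1 F 0 = 0.
  clearbody F; rewrite (_ : F = cst (F 0)) ?derive1_cst//.
  by apply/funext => t; exact: F0.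
move: dF; rewrite F00.
rewrite (@eq_Rintegral _ _ _ _ _ (fun x => 2 * angular i j h x)); last first.
  move=> x /set_mem Sx; rewrite partial1of2E; have [_ ->] := dd 0 x Sx.
  by rewrite plane_rot0 expr0n addr0 divr1.
rewrite intSZ// => /esym/eqP; rewrite mulf_eq0 pnatr_eq0/= => /eqP ->//.
Qed.

End sphere_integral.

Section sphere_ibp.
Context {R : realType} {d : nat}.
Local Notation V := 'rV[R]_d.
Local Notation S := (@sphere R d).
Implicit Types (f g h : V -> R) (O : set V) (i j : 'I_d) (x : V).

Definition sg i f x : R := sgrad f x 0 i.

Definition euler f x : R := \sum_j x 0 j * pd j f x.

Lemma sgE i f x : sg i f x = pd i f x - euler f x * x 0 i.
Proof.
rewrite /sg /sgrad !mxE /dot /euler; congr (_ - _ * _).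
by apply: eq_bigr => j _; rewrite mxE.
Qed.

Lemma eulerM f g x : differentiable f x -> differentiable g x ->
  euler (fun y => f y * g y) x = euler f x * g x + f x * euler g x.
Proof.
move=> df dg; rewrite /euler mulr_suml mulr_sumr -big_split; apply: eq_bigr => j _ /=.
by rewrite pdM//; ring.
Qed.

Lemma eulerD f g x : differentiable f x -> differentiable g x ->
  euler (fun y => f y + g y) x = euler f x + euler g x.
Proof.
move=> df dg; rewrite /euler -big_split; apply: eq_bigr => j _ /=.
by rewrite pdD// mulrDr.
Qed.

Lemma sgM i f g x : differentiable f x -> differentiable g x ->
  sg i (fun y => f y * g y) x = sg i f x * g x + f x * sg i g x.
Proof. by move=> df dg; rewrite !sgE pdM// eulerM//; ring. Qed.

Lemma sgD i f g x : differentiable f x -> differentiable g x ->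
  sg i (fun y => f y + g y) x = sg i f x + sg i g x.
Proof. by move=> df dg; rewrite !sgE pdD// eulerD//; ring. Qed.

Lemma sg_cst i (a : R) x : sg i (fun=> a) x = 0.
Proof.
rewrite sgE pd_cst /euler big1 ?mul0r ?subr0// => j _.
by rewrite pd_cst mulr0.
Qed.

Lemma sgZ i (a : R) f x : differentiable f x -> sg i (fun y => a * f y) x = a * sg i f x.
Proof. by move=> df; rewrite sgM// sg_cst mul0r add0r. Qed.

Lemma sg_coord i j x : sg i (fun y => y 0 j) x = (j == i)%:R - x 0 j * x 0 i.
Proof.
rewrite sgE pd_coord; congr (_ - _ * _).
rewrite /euler (bigD1 j)//= pd_coord eqxx mulr1 big1 ?addr0// => k kj.
by rewrite pd_coord eq_sym (negbTE kj) mulr0.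
Qed.

Lemma sg_near i f g x : (\near x, f x = g x) -> sg i f x = sg i g x.
Proof.
move=> fg; have pdfg j : pd j f x = pd j g x by exact: pd_near.
have ee : euler f x = euler g x by apply: eq_bigr => j _; rewrite pdfg.
by rewrite 2!sgE pdfg ee.
Qed.

Lemma sum_sg_normal f x : S x -> \sum_i x 0 i * sg i f x = 0.
Proof.
move=> /sphereP x1; under eq_bigr do rewrite sgE mulrBr.
rewrite sumrB -/(euler f x).
have -> : \sum_i x 0 i * (euler f x * x 0 i) = euler f x * dot x x.
  by rewrite /dot mulr_sumr; apply: eq_bigr => i _; ring.
by rewrite x1 mulr1 subrr.
Qed.

(** Reduces tangential derivatives to generators of rotations, whose integrals vanish; [|x| = 1]
    enters through the factor of [pd i f]. *)
Lemma sg_angular i f x : S x -> sg i f x = \sum_(j | j != i) x 0 j * angular j i f x.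
Proof.
move=> /sphereP x1.
transitivity (\sum_j x 0 j * angular j i f x); last first.
  by rewrite (bigD1 i)//= /angular subrr mulr0 add0r.
rewrite /angular; under eq_bigr do rewrite mulrBr.
rewrite sumrB sgE; congr (_ - _).
  transitivity (pd i f x * dot x x); first by rewrite x1 mulr1.
  by rewrite /dot mulr_sumr; apply: eq_bigr => j _; ring.
by rewrite /euler mulr_suml; apply: eq_bigr => j _; ring.
Qed.

Lemma smooth_on_euler O f : open O -> smooth_on O f -> smooth_on O (euler f).
Proof.
move=> oO sf; apply: smooth_on_sum => // j.
by apply: smooth_onM => //; [exact: smooth_on_coord|exact: smooth_on_pd].
Qed.

Lemma smooth_on_sg O i f : open O -> smooth_on O f -> smooth_on O (sg i f).
Proof.
move=> oO sf; rewrite (funext (sgE i f)).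
apply: smooth_onB => //; first exact: smooth_on_pd.
apply: smooth_onM => //; [exact: smooth_on_euler|exact: smooth_on_coord].
Qed.

Lemma contS_smooth O f : S `<=` O -> smooth_on O f -> contS f.
Proof. by move=> SO sf; exact: (contS_Ckon SO (sf 0)). Qed.

Variable O : set V.
Hypotheses (oO : open O) (SO : S `<=` O).

(** Apply [intS_angular] to [x_j h]. For [j != i], [angular j i (x_j h)] is
    [x_j angular j i h - x_i h]; the first terms add up to [sg i h], and the [d - 1] others give the
    mean curvature term. *)
Lemma intS_sg i h : smooth_on O h ->
  \int[omega]_(x in S) sg i h x = (d%:R - 1) * \int[omega]_(x in S) (x 0 i * h x).
Proof.
move=> sh.
have shj j : smooth_on O (fun x => x 0 j * h x).
  by apply: smooth_onM => //; exact: smooth_on_coord.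
have ch := contS_smooth SO sh.
have cxh : contS (fun x => x 0 i * h x) by exact: (contS_smooth SO (shj i)).
have ca j k g : smooth_on O g -> contS (angular j k g).
  move=> sg'; apply: (contS_smooth SO); rewrite /angular.
  by apply: smooth_onB => //; apply: smooth_onM => //;
    solve [exact: smooth_on_coord|exact: smooth_on_pd].
pose G j x := if j != i then angular j i (fun x => x 0 j * h x) x else 0.
have : \int[omega]_(x in S) (\sum_j G j x) = 0.
  rewrite (@intS_sum R d _ _ G); last first.
    by move=> j; rewrite /G; case: (j != i); [exact: ca|exact: contS_cst].
  apply: big1 => j _; rewrite /G; case: (boolP (j != i)) => ji.
    by apply: (intS_angular oO SO) => //; exact: (shj j 1).
  by rewrite Rintegral_cst ?mul0r//; exact: measurable_sphere.
rewrite (@eq_Rintegral _ _ _ _ _ (fun x => sg i h x + (1 - d%:R) * (x 0 i * h x))).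
  rewrite intSD//; last by apply: contSM => //; exact: contS_cst.
    by rewrite intSZ//; move/eqP; rewrite addr_eq0 => /eqP ->; ring.
  exact: (contS_smooth SO (smooth_on_sg i oO sh)).
move=> x /set_mem Sx; rewrite sg_angular// /G -big_mkcond/=.
have dh : differentiable h x by exact: (smooth_on_diff sh (SO Sx)).
transitivity (\sum_(j < d | j != i) (x 0 j * angular j i h x - x 0 i * h x)).
  apply: eq_bigr => j ji; rewrite /angular.
  have dx := differentiable_coord x (0 : 'I_1) j.
  have pdx k : pd k (fun y => y 0 j * h y) x = (j == k)%:R * h x + x 0 j * pd k h x.
    by rewrite pdM// pd_coord.
  rewrite !pdx eqxx (negbTE ji)/=.
  ring.
rewrite big_split/= sumr_const; congr (_ + _).
have dE : d%:R = d.-1%:R + 1 :> R.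
  by rewrite natr1 prednK// (leq_ltn_trans _ (ltn_ord i)).
by rewrite cardC1 card_ord dE -[LHS]mulr_natl; ring.
Qed.

(** The Laplace-Beltrami operator, as a sum of squares of tangential derivatives. *)
Definition lap f x : R := \sum_i sg i (sg i f) x.

Lemma smooth_on_lap f : smooth_on O f -> smooth_on O (lap f).
Proof. by move=> sf; apply: smooth_on_sum => // i; do 2 apply: smooth_on_sg => //. Qed.

(** The curvature terms of [intS_sg], applied to [sg i f * g], cancel in the sum because a surface
    gradient is orthogonal to the normal. *)
Lemma green f g : smooth_on O f -> smooth_on O g ->
  \int[omega]_(x in S) (lap f x * g x) =
  - \int[omega]_(x in S) (\sum_i sg i f x * sg i g x).
Proof.
move=> sf sg'.
have sfi i : smooth_on O (sg i f) by exact: smooth_on_sg.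
have sgi i : smooth_on O (sg i g) by exact: smooth_on_sg.
have sfg i : smooth_on O (fun x => sg i f x * g x) by exact: smooth_onM.
have cS := contS_smooth SO.
have : \int[omega]_(x in S) (\sum_i sg i (fun y => sg i f y * g y) x) = 0.
  rewrite (@intS_sum R d _ _ (fun i x => sg i (fun y => sg i f y * g y) x)); last first.
    by move=> i; apply: cS; exact: smooth_on_sg.
  under eq_bigr do rewrite intS_sg//.
  rewrite -mulr_sumr -(@intS_sum R d _ _ (fun i x => x 0 i * (sg i f x * g x))); last first.
    by move=> i; apply: contSM; [exact: contS_coord|exact: cS].
  rewrite (@eq_Rintegral _ _ _ _ _ (cst 0)).
    by rewrite Rintegral_cst ?mul0r ?mulr0//; exact: measurable_sphere.
  move=> x /set_mem Sx /=; under eq_bigr do rewrite mulrA.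
  by rewrite -mulr_suml sum_sg_normal// mul0r.
rewrite (@eq_Rintegral _ _ _ _ _ (fun x => lap f x * g x + \sum_i sg i f x * sg i g x)).
  rewrite intSD.
  - by move/eqP; rewrite addr_eq0 => /eqP.
  - by apply: contSM; [exact/cS/smooth_on_lap|exact: cS].
  - by apply: contS_sum => i; apply: contSM; exact: cS.
move=> x /set_mem /SO Ox; rewrite /lap mulr_suml -big_split; apply: eq_bigr => i _.
by rewrite sgM//; [exact: (smooth_on_diff (sfi i))|exact: (smooth_on_diff sg')].
Qed.

Lemma green_sym f g : smooth_on O f -> smooth_on O g ->
  \int[omega]_(x in S) (lap f x * g x) = \int[omega]_(x in S) (f x * lap g x).
Proof.
move=> sf sg'; rewrite (green sf sg').
have -> : \int[omega]_(x in S) (f x * lap g x) = \int[omega]_(x in S) (lap g x * f x).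
  by apply: eq_Rintegral => x _; rewrite mulrC.
rewrite (green sg' sf).
suff -> : \int[omega]_(x in S) (\sum_i sg i f x * sg i g x) =
    \int[omega]_(x in S) (\sum_i sg i g x * sg i f x) by [].
by apply: eq_Rintegral => x _; apply: eq_bigr => i _; rewrite mulrC.
Qed.

End sphere_ibp.

(** * Spherical harmonics *)

Section eigenpolynomials.
Context {R : realType} {d : nat}.
Local Notation V := 'rV[R]_d.
Local Notation S := (@sphere R d).
Implicit Types (f g p q e : V -> R) (O : set V) (i j : 'I_d) (x y : V).

Let oT : open [set: V] := @openT V.

(** Homogeneous polynomial functions. The zero function is given every degree, so that derivatives
    of constants and partial sums stay in the class. *)
Inductive hpoly : nat -> (V -> R) -> Prop :=
| hpoly_cst a : hpoly 0 (fun=> a)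
| hpoly0 n : hpoly n (fun=> 0)
| hpolyX n i p : hpoly n p -> hpoly n.+1 (fun x => x 0 i * p x)
| hpolyD n p q : hpoly n p -> hpoly n q -> hpoly n (fun x => p x + q x).

Lemma hpolyZ n (a : R) p : hpoly n p -> hpoly n (fun x => a * p x).
Proof.
elim=> [b|{}n|{}n i {}p _ IH|{}n {}p q _ IHp _ IHq].
- exact: hpoly_cst.
- by rewrite mulr0; exact: hpoly0.
- rewrite (_ : (fun _ => _) = (fun x => x 0 i * (a * p x))); first exact: hpolyX.
  by apply/funext => x; rewrite mulrCA.
- rewrite (_ : (fun _ => _) = (fun x => a * p x + a * q x)); first exact: hpolyD.
  by apply/funext => x; rewrite mulrDr.
Qed.

Lemma hpoly_sum n (I : Type) (r : seq I) (F : I -> V -> R) :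
  (forall k, hpoly n (F k)) -> hpoly n (fun x => \sum_(k <- r) F k x).
Proof.
move=> hF; elim: r => [|k r IH].
  rewrite (_ : (fun _ => _) = fun=> 0); first exact: hpoly0.
  by apply/funext => x; rewrite big_nil.
rewrite (_ : (fun _ => _) = (fun x => F k x + \sum_(k <- r) F k x)); first exact: hpolyD.
by apply/funext => x; rewrite big_cons.
Qed.

Lemma hpoly_smooth n p : hpoly n p -> smooth_on setT p.
Proof.
elim=> [b|{}n|{}n i {}p _ IH|{}n {}p q _ IHp _ IHq].
- exact: smooth_on_cst.
- exact: smooth_on_cst.
- by apply: smooth_onM => //; exact: smooth_on_coord.
- exact: smooth_onD.
Qed.

Lemma hpoly_diff n p x : hpoly n p -> differentiable p x.
Proof. by move=> /hpoly_smooth hp; exact: (smooth_on_diff hp). Qed.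

Lemma pd_coordM i j f x : differentiable f x ->
  pd i (fun y => y 0 j * f y) x = (j == i)%:R * f x + x 0 j * pd i f x.
Proof.
move=> df; have dx := differentiable_coord x (0 : 'I_1) j.
by rewrite pdM// pd_coord.
Qed.

Lemma hpoly_pd n p : hpoly n p ->
  if n is m.+1 then forall i, hpoly m (pd i p) else forall i, pd i p = fun=> 0.
Proof.
elim=> [b|{}n|{}n j {}p hp IH|{}n {}p q hp IHp hq IHq].
- by move=> i; rewrite pd_cst.
- by case: n => [|n] i; rewrite pd_cst //; exact: hpoly0.
- move=> i; rewrite (_ : pd _ _ = fun x => (j == i)%:R * p x + x 0 j * pd i p x).
    apply: hpolyD; first exact: hpolyZ.
    case: n hp IH => [|n] hp IH.
      rewrite IH (_ : (fun _ => _) = fun=> 0); first exact: hpoly0.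
      by apply/funext => x; rewrite mulr0.
    by apply: hpolyX; exact: IH.
  by apply/funext => x; rewrite pd_coordM//; exact: hpoly_diff hp.
- have pdE i : pd i (fun x => p x + q x) = fun x => pd i p x + pd i q x.
    by apply/funext => x; rewrite pdD//; [exact: hpoly_diff hp|exact: hpoly_diff hq].
  case: n hp hq IHp IHq => [|n] hp hq IHp IHq i; rewrite pdE.
    by rewrite IHp IHq; apply/funext => x; rewrite addr0.
  by apply: hpolyD; [exact: IHp|exact: IHq].
Qed.

Lemma hpoly_euler n p x : hpoly n p -> euler p x = n%:R * p x.
Proof.
elim=> [b|{}n|{}n j {}p hp IH|{}n {}p q hp IHp hq IHq].
- by rewrite mul0r /euler big1// => i _; rewrite pd_cst mulr0.
- by rewrite mulr0 /euler big1// => i _; rewrite pd_cst mulr0.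
- have dx := differentiable_coord x (0 : 'I_1) j.
  rewrite eulerM//; last exact: hpoly_diff hp.
  rewrite IH -natr1 (_ : euler _ x = x 0 j); first by ring.
  rewrite /euler (bigD1 j)//= pd_coord eqxx mulr1 big1 ?addr0// => k kj.
  by rewrite pd_coord eq_sym (negbTE kj) mulr0.
- rewrite eulerD; [|exact: hpoly_diff hp|exact: hpoly_diff hq].
  by rewrite IHp IHq mulrDr.
Qed.

Definition flap f x : R := \sum_i pd i (pd i f) x.

(** The Euclidean Laplacian [flap] in polar coordinates: on the unit sphere, its radial part on a
    function homogeneous of degree [n] is [n (n - 1) + (d - 1) n = n (n + d - 2)]. *)
Lemma hpoly_lap n p x : hpoly n p -> S x ->
  lap p x = flap p x - n%:R * (n%:R + d%:R - 2) * p x.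
Proof.
move=> hp Sx; have /sphereP x1 := Sx.
have dp z : differentiable p z by exact: hpoly_diff hp.
have sgp i : sg i p = fun z => pd i p z + (- n%:R) * (p z * z 0 i).
  by apply/funext => z; rewrite sgE (hpoly_euler _ hp); ring.
have sp := hpoly_smooth hp.
have spd i : smooth_on setT (pd i p) by exact: smooth_on_pd.
have dpd i z : differentiable (pd i p) z by exact: (smooth_on_diff (spd i)).
have epd i : euler (pd i p) x = (n%:R - 1) * pd i p x.
  have := hpoly_pd hp; case: n hp sgp => [|n] hp sgp hpd.
    by rewrite hpd /euler mulr0 big1// => j _; rewrite pd_cst mulr0.
  by rewrite (hpoly_euler _ (hpd i)) -natr1; ring.
have dc i := differentiable_coord x (0 : 'I_1) i.
have lapi i : sg i (sg i p) x = pd i (pd i p) x - (n%:R - 1) * (x 0 i * pd i p x)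
    - n%:R * (x 0 i * sg i p x + p x * (1 - x 0 i * x 0 i)).
  have dpx : differentiable (fun z => p z * z 0 i) x by exact: differentiableM.
  have dnp : differentiable (fun z => - n%:R * (p z * z 0 i)) x.
    by apply: differentiableM.
  rewrite {1}[X in sg i X](sgp i) sgD// sgZ// sgM// sg_coord eqxx/=.
  by rewrite [sg i (pd i p) x]sgE epd; ring.
rewrite /lap; under eq_bigr do rewrite lapi.
rewrite !sumrB -!mulr_sumr -/(euler p x) (hpoly_euler _ hp) big_split/= sum_sg_normal//.
rewrite -mulr_sumr sumrB sumr_const card_ord -/(dot x x) x1 -/(flap p x); ring.
Qed.

Lemma hpoly_flap n p : hpoly n p ->
  if n is m.+2 then hpoly m (flap p) else flap p = fun=> 0.
Proof.
move=> hp; have := hpoly_pd hp; case: n hp => [|[|n]] hp hpd.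
- apply/funext => x; rewrite /flap big1// => i _.
  by rewrite hpd pd_cst.
- apply/funext => x; rewrite /flap big1// => i _.
  by rewrite (hpoly_pd (hpd i)).
- by apply: hpoly_sum => i; exact: (hpoly_pd (hpd i)).
Qed.

Lemma hpoly_const p : hpoly 0 p -> exists a, p = fun=> a.
Proof.
suff H n q : hpoly n q -> n = 0%N -> exists a, q = fun=> a by move=> /H; apply.
elim=> [b|{}n|{}n j {}p' hp IH|{}n {}p' q' hp IHp hq IHq] // En.
- by exists b.
- by exists 0.
- have [a ->] := IHp En; have [b ->] := IHq En.
  by exists (a + b).
Qed.

Lemma lapD f g x : smooth_on setT f -> smooth_on setT g ->
  lap (fun y => f y + g y) x = lap f x + lap g x.
Proof.
move=> sf sg_; rewrite /lap -big_split; apply: eq_bigr => i _ /=.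
have df z : differentiable f z by exact: (smooth_on_diff sf).
have dg z : differentiable g z by exact: (smooth_on_diff sg_).
rewrite (_ : sg i (fun y => f y + g y) = fun y => sg i f y + sg i g y).
  by rewrite sgD//; [exact: (smooth_on_diff (smooth_on_sg i oT sf))|
    exact: (smooth_on_diff (smooth_on_sg i oT sg_))].
by apply/funext => z; rewrite sgD.
Qed.

Lemma lap_cst (a : R) x : lap (fun=> a) x = 0.
Proof.
rewrite /lap big1// => i _.
have -> : sg i (fun=> a) = (fun=> 0) :> (V -> R) by apply/funext => z; rewrite sg_cst.
exact: sg_cst.
Qed.

Lemma lapZ (a : R) f x : smooth_on setT f -> lap (fun y => a * f y) x = a * lap f x.
Proof.
move=> sf; rewrite /lap mulr_sumr; apply: eq_bigr => i _ /=.
have df z : differentiable f z by exact: (smooth_on_diff sf).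
rewrite (_ : sg i (fun y => a * f y) = fun y => a * sg i f y).
  by rewrite sgZ//; exact: (smooth_on_diff (smooth_on_sg i oT sf)).
by apply/funext => z; rewrite sgZ.
Qed.

Lemma lap_sum (I : Type) (r : seq I) (F : I -> V -> R) x :
  (forall k, smooth_on setT (F k)) ->
  lap (fun y => \sum_(k <- r) F k y) x = \sum_(k <- r) lap (F k) x.
Proof.
move=> sF; elim: r => [|k r IH].
  rewrite big_nil (_ : (fun _ => _) = fun=> 0) ?lap_cst//.
  by apply/funext => y; rewrite big_nil.
have sr : smooth_on setT (fun y => \sum_(k <- r) F k y) by exact: smooth_on_sum.
have E : (fun y => \sum_(j <- k :: r) F j y) = fun y => F k y + \sum_(j <- r) F j y.
  by apply/funext => y; rewrite big_cons.
by rewrite E (lapD x (sF k) sr) IH big_cons.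
Qed.

Definition eigval (l : nat) : R := l%:R * (l%:R + d%:R - 2).

(** The clause at [l = 0] takes the place of the theorem that harmonic functions on the sphere are
    constant; it serves where the kernel of [T - 1] has to be identified. *)
Definition eigenfun (l : nat) e := [/\ smooth_on setT e,
  forall x, S x -> lap e x = - eigval l * e x &
  l = 0 -> exists a, e = fun=> a].

Lemma eigenfun0 l : eigenfun l (fun=> 0).
Proof.
split; first exact: smooth_on_cst.
  by move=> x _; rewrite lap_cst mulr0.
by move=> _; exists 0.
Qed.

Lemma eigenfunZ l (a : R) e : eigenfun l e -> eigenfun l (fun x => a * e x).
Proof.
move=> [se le ce]; split; first exact: smooth_onZ.
  by move=> x Sx; rewrite lapZ// le//; ring.
by move=> /ce[b ->]; exists (a * b).
Qed.

Lemma eigval_neq (l n : nat) : (2 <= d)%N -> (l < n)%N -> eigval n - eigval l != 0.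
Proof.
move=> d2 ln.
rewrite (_ : _ - _ = (n%:R - l%:R) * (n%:R + l%:R + (d%:R - 2))); last by rewrite /eigval; ring.
rewrite mulf_neq0//; first by rewrite subr_eq0 eqr_nat gtn_eqF.
rewrite gt_eqF// ltr_wpDr ?subr_ge0 ?ler_nat//.
by rewrite -natrD ltr0n addn_gt0 (leq_ltn_trans _ ln).
Qed.

(** On the sphere, [lap p + eigval n * p] is [flap p], a polynomial of degree [n - 2] and so, by
    induction, a sum of eigenfunctions of lower degree. Correcting [p] by a combination of these
    makes it an eigenfunction. No division by [|x|^2] is involved. *)
Lemma hpoly_eigen_decomp n p : (2 <= d)%N -> hpoly n p ->
  exists2 e : nat -> V -> R, (forall l, eigenfun l (e l)) &
    forall x, S x -> p x = \sum_(l < n.+1) e l x.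
Proof.
move=> d2; have [m] := ubnP n; elim: m n p => // m IH [|n] p nm hp.
  have [a pa] := hpoly_const hp.
  exists (fun l x => if l == 0%N then a else 0).
    case=> [|l] /=; last exact: eigenfun0.
    split=> //; first exact: smooth_on_cst.
      by move=> x _; rewrite lap_cst /eigval mul0r oppr0 mul0r.
    by move=> _; exists a.
  by move=> x _; rewrite big_ord1 pa.
have [e' ee' pe'] : exists2 e : nat -> V -> R, (forall l, eigenfun l (e l)) &
    forall x, S x -> flap p x = \sum_(l < n.+1) e l x.
  have := hpoly_flap hp; case: n => [|n] in nm hp *.
    move=> ->; exists (fun _ _ => 0); first by move=> l; exact: eigenfun0.
    by move=> x _; rewrite big1.
  move=> /(IH n)[|e ee pe]; first by rewrite -ltnS (leq_trans _ nm).
  exists (fun l => if (l < n.+1)%N then e l else fun=> 0).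
    by move=> l; case: ifP => // _; exact: eigenfun0.
  move=> x Sx; rewrite pe// [RHS]big_ord_recr/= ltnn addr0.
  by apply: eq_bigr => l _; rewrite ltn_ord.
(* This coefficient solves [(lap + eigval n.+1) (c l * e' l) = e' l], so that [lap + eigval n.+1]
   kills [p - q]. *)
pose c l := (eigval n.+1 - eigval l)^-1.
pose q x := \sum_(l < n.+1) c l * e' l x.
have sce l : smooth_on setT (fun x => c l * e' l x).
  by apply: smooth_onZ => //; have [] := ee' l.
have sq : smooth_on setT q by exact: smooth_on_sum.
exists (fun l => if (l < n.+1)%N then fun x => c l * e' l x else
  if l == n.+1 then fun x => p x + (-1) * q x else fun=> 0).
  move=> l; case: ifPn => [ln|]; first exact: eigenfunZ.
  rewrite -leqNgt => nl; case: eqP => [->|_]; last exact: eigenfun0.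
  have sp := hpoly_smooth hp.
  split => //; first by apply: smooth_onD => //; exact: smooth_onZ.
  move=> x Sx; rewrite lapD//; last exact: smooth_onZ.
  rewrite lapZ// (hpoly_lap hp Sx) pe'// /q.
  rewrite (@lap_sum _ _ (fun (l : 'I_n.+1) x => c l * e' l x))//.
  have -> : \sum_(k < n.+1) e' k x = \sum_(k < n.+1) (lap (fun y => c k * e' k y) x + eigval n.+1 * (c k * e' k x)).
    apply: eq_bigr => k _; have [se le _] := ee' k.
    rewrite lapZ// le//.
    have := eigval_neq d2 (ltn_ord k); rewrite /c => ne.
    by rewrite -[LHS]mul1r -(mulVf ne); ring.
  by rewrite big_split/= -mulr_sumr /eigval; ring.
move=> x Sx; rewrite big_ord_recr/= ltnn eqxx /q.
rewrite (eq_bigr (fun l : 'I_n.+1 => c l * e' l x)); last by move=> l _; rewrite ltn_ord.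
by ring.
Qed.

End eigenpolynomials.

(** * Zonal kernels *)

Section zonal.
Context {R : realType} {d : nat}.
Local Notation V := 'rV[R]_d.
Local Notation S := (@sphere R d).
Implicit Types (f g : V -> R) (O : set V) (i j : 'I_d) (x y : V) (a A B : R).

Lemma pd_sum i (I : Type) (r : seq I) (F : I -> V -> R) x :
  (forall k, differentiable (F k) x) ->
  differentiable (fun y => \sum_(k <- r) F k y) x /\
  pd i (fun y => \sum_(k <- r) F k y) x = \sum_(k <- r) pd i (F k) x.
Proof.
move=> dF; elim: r => [|k r [IHd IH]].
  have E : (fun y => \sum_(j <- [::]) F j y) = cst 0.
    by apply/funext => y; rewrite big_nil.
  by rewrite E pd_cst big_nil; split => //; exact: differentiable_cst.
have E : (fun y => \sum_(j <- k :: r) F j y) = (F k) \+ (fun y => \sum_(j <- r) F j y).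
  by apply/funext => y; rewrite big_cons.
rewrite E big_cons -IH; split; first exact: differentiableD.
exact: pdD.
Qed.

Lemma smooth_on_dot O y : open O -> smooth_on O (fun x => dot x y).
Proof.
move=> oO; apply: smooth_on_sum => // k.
by apply: smooth_onM => //; [exact: smooth_on_coord|exact: smooth_on_cst].
Qed.

Lemma differentiable_dot y x : differentiable (fun z => dot z y) x.
Proof.
have := @smooth_on_dot setT y (@openT V).
by move=> /smooth_on_diff; apply.
Qed.

Lemma pd_dot i y x : pd i (fun z => dot z y) x = y 0 i.
Proof.
have dk (k : 'I_d) : differentiable (fun z : V => z 0 k * y 0 k) x.
  by apply: differentiableM; [exact: differentiable_coord|exact: differentiable_cst].
have [_ ->] := pd_sum i (index_enum 'I_d) dk.
rewrite (bigD1 i)//= big1 ?addr0 => [|k ki].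
  by rewrite (pd_coordM _ _ (differentiable_cst _ _)) pd_cst eqxx mul1r mulr0 addr0.
by rewrite (pd_coordM _ _ (differentiable_cst _ _)) pd_cst (negbTE ki) mul0r mulr0 addr0.
Qed.

Lemma sg_dot i y x : sg i (fun z => dot z y) x = y 0 i - dot x y * x 0 i.
Proof.
rewrite sgE pd_dot; congr (_ - _ * _).
by apply: eq_bigr => j _; rewrite pd_dot.
Qed.

Lemma sg_comp i (u u' : R -> R) f x : differentiable f x ->
  is_derive (f x) 1 u (u' (f x)) ->
  sg i (fun y => u (f y)) x = u' (f x) * sg i f x.
Proof.
move=> df du; have pdu j : pd j (fun y => u (f y)) x = u' (f x) * pd j f x.
  exact: pd_comp.
have eu : euler (fun y => u (f y)) x = u' (f x) * euler f x.
  by rewrite /euler mulr_sumr; apply: eq_bigr => j _; rewrite pdu; ring.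
by rewrite 2!sgE pdu eu; ring.
Qed.

(** For [x] and [y] on the sphere, [A = B = 2] gives [|x - y|^(-2 a)], while [A = 1 + r^2] and
    [B = 2 r] give [|x - r y|^(-2 a)]. *)
Definition zonal a A B y x : R := (A - B * dot x y) `^ (- a).

Definition zonal_dom A B y : set V := [set x | 0 < A - B * dot x y].

Lemma smooth_on_affine O A B y : open O -> smooth_on O (fun x => A - B * dot x y).
Proof.
move=> oO; apply: smooth_onB => //; first exact: smooth_on_cst.
by apply: smooth_onZ => //; exact: smooth_on_dot.
Qed.

Lemma open_zonal_dom A B y : open (zonal_dom A B y).
Proof.
rewrite (_ : zonal_dom A B y = (fun x => A - B * dot x y) @^-1` [set t | 0 < t])//.
apply: open_comp; last exact: open_gt.
by move=> x _; exact: (@smooth_on_affine setT A B y (@openT V) 0).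
Qed.

Lemma smooth_on_powR O (f : V -> R) a : open O -> smooth_on O f ->
  (forall x, O x -> 0 < f x) -> smooth_on O (fun x => f x `^ a).
Proof.
move=> oO sf f0.
apply: (@smooth_on_comp _ _ [set u | exists c b, u = fun t => c * t `^ b] [set t | 0 < t]
  O f oO sf f0 _ (fun t => t `^ a)).
  move=> _ [c [b ->]]; exists (fun t => c * b * t `^ (b - 1)); first by exists (c * b), (b - 1).
  move=> t /= t0; rewrite -mulrA; apply: is_derive1Z; exact: is_derive1_powR.
by exists 1, a; apply/funext => t; rewrite mul1r.
Qed.

Lemma smooth_on_zonal a A B y : smooth_on (zonal_dom A B y) (zonal a A B y).
Proof.
have oO := @open_zonal_dom A B y.
by apply: smooth_on_powR => //; exact: smooth_on_affine.
Qed.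

Lemma sg_zonal i a A B y x : zonal_dom A B y x ->
  sg i (zonal a A B y) x = a * B * zonal (a + 1) A B y x * (y 0 i - dot x y * x 0 i).
Proof.
move=> Ox; pose f z := A - B * dot z y.
have df : differentiable f x.
  exact: (smooth_on_diff (smooth_on_affine A B y (@open_zonal_dom A B y)) Ox).
have du : is_derive (f x) 1 (fun t => t `^ (- a)) (- a * f x `^ (- a - 1)).
  by apply: is_derive1_powR; exact: Ox.
rewrite (@sg_comp i _ (fun t => - a * t `^ (- a - 1)) f x df du).
have -> : sg i f x = - B * (y 0 i - dot x y * x 0 i).
  rewrite -sg_dot.
  rewrite (_ : f = fun z => A + (- B) * dot z y); last first.
    by apply/funext => z; rewrite /f mulNr.
  rewrite sgD ?sg_cst ?add0r ?sgZ//; try exact: differentiable_dot.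
  by apply: differentiableM => //; exact: differentiable_dot.
by rewrite /zonal /f opprD; ring.
Qed.

(** For a function [u] of [t = x . y], the Laplace-Beltrami operator is
    [(1 - t^2) u'' - (d - 1) t u']. *)
Lemma lap_zonal a A B y x : S x -> S y -> zonal_dom A B y x ->
  lap (zonal a A B y) x =
  a * (a + 1) * B ^+ 2 * (1 - dot x y ^+ 2) * zonal (a + 2) A B y x
  - (d%:R - 1) * a * B * dot x y * zonal (a + 1) A B y x.
Proof.
move=> Sx Sy Ox; have /sphereP x1 := Sx; have /sphereP y1 := Sy.
have oO := @open_zonal_dom A B y.
pose w i z := y 0 i - dot z y * z 0 i.
have dz b : differentiable (zonal b A B y) x.
  exact: (smooth_on_diff (smooth_on_zonal b A B y) Ox).
have dx i := differentiable_coord x (0 : 'I_1) i.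
have ddot := differentiable_dot y x.
have sww i : sg i (w i) x = - ((y 0 i - dot x y * x 0 i) * x 0 i + dot x y * (1 - x 0 i * x 0 i)).
  have E : w i = fun z => y 0 i + (-1) * (dot z y * z 0 i).
    by apply/funext => z; rewrite /w; ring.
  have dm : differentiable (fun z => dot z y * z 0 i) x by exact: differentiableM.
  have dm' : differentiable (fun z => -1 * (dot z y * z 0 i)) x by exact: differentiableM.
  rewrite E sgD// sg_cst add0r sgZ// sgM// sg_dot sg_coord eqxx/=; ring.
have dw i : differentiable (w i) x.
  by apply: differentiableB => //; exact: differentiableM.
have ssi i : sg i (sg i (zonal a A B y)) x =
    a * B * ((a + 1) * B * zonal (a + 2) A B y x * w i x * w i x + zonal (a + 1) A B y x * sg i (w i) x).
  transitivity (sg i (fun z => a * B * (zonal (a + 1) A B y z * w i z)) x).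
    apply: sg_near; near=> z; rewrite sg_zonal ?mulrA//.
    by near: z; exact: open_nbhs_nbhs.
  have dm : differentiable (fun z => zonal (a + 1) A B y z * w i z) x by exact: differentiableM.
  rewrite sgZ// sgM// sg_zonal// -addrA (_ : 1 + 1 = 2 :> R)//.
rewrite /lap; under eq_bigr do rewrite ssi.
rewrite -mulr_sumr big_split/= -mulr_sumr.
have -> : \sum_i sg i (w i) x = - ((d%:R - 1) * dot x y).
  under eq_bigr do rewrite sww.
  rewrite sumrN; congr (- _).
  have E i : (y 0 i - dot x y * x 0 i) * x 0 i + dot x y * (1 - x 0 i * x 0 i) =
    x 0 i * y 0 i + dot x y * (1 - 2 * (x 0 i * x 0 i)) by ring.
  under eq_bigr do rewrite E.
  rewrite big_split/= -/(dot x y) -mulr_sumr sumrB sumr_const card_ord -mulr_sumr.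
  by rewrite -/(dot x x) x1; ring.
have -> : \sum_i (a + 1) * B * zonal (a + 2) A B y x * w i x * w i x =
    (a + 1) * B * zonal (a + 2) A B y x * (1 - dot x y ^+ 2).
  under eq_bigr do rewrite -mulrA.
  rewrite -mulr_sumr; congr (_ * _).
  have E i : w i x * w i x = y 0 i * y 0 i - 2 * dot x y * (x 0 i * y 0 i) + dot x y ^+ 2 * (x 0 i * x 0 i).
    by rewrite /w; ring.
  under eq_bigr do rewrite E.
  rewrite big_split sumrB/= -!mulr_sumr -/(dot x y) -/(dot y y) -/(dot x x) x1 y1; ring.
ring.
Unshelve. all: end_near. Qed.

End zonal.

Section integral_parameter.
Context {R : realType} {d : nat}.
Local Notation V := 'rV[R]_d.
Local Notation S := (@sphere R d).

(** Differentiation under the integral followed by the mean value theorem. The bounds on [f'] are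
    only asked for [|r| <= rho < 1], since the kernels to be inserted blow up as [r] tends to
    [1]. *)
Lemma intS_const (f f' : R -> V -> R) :
  (forall r, `|r| < 1 -> contS (f r)) ->
  (forall (r : R) y, `|r| < 1 -> S y -> is_derive r 1 (f ^~ y) (f' r y)) ->
  (forall rho, 0 <= rho < 1 -> exists K, forall r y, `|r| <= rho -> S y -> `|f' r y| <= K) ->
  (forall r, 0 <= r < 1 -> \int[omega]_(y in S) f' r y = 0) ->
  forall r, 0 <= r < 1 -> \int[omega]_(y in S) f r y = \int[omega]_(y in S) f 0 y.
Proof.
move=> cf df bf f'0 r /andP[r0 r1].
have [->//|rn0] := eqVneq r 0.
have {rn0}r0 : 0 < r by rewrite lt_neqAle eq_sym rn0.
pose F s := \int[omega]_(y in S) f s y.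
have dF (s : R) : 0 <= s < 1 -> is_derive s 1 F 0.
  move=> /[dup] s01 /andP[s0 s1']; have s1 : `|s| < 1 by rewrite ger0_norm.
  pose rho := (1 + `|s|) / 2.
  have rho01 : 0 <= rho < 1.
    by rewrite /rho divr_ge0 ?addr_ge0//=; lra.
  have srho : `|s| < rho by rewrite /rho; lra.
  have [K fK] := bf _ rho01.
  have Irho t : `]-rho, rho[%classic t -> `|t| < rho by rewrite /= in_itv/= ltr_norml.
  have Irho1 t : `]-rho, rho[%classic t -> `|t| < 1.
    by move=> /Irho ht; apply: lt_trans ht _; case/andP : rho01.
  have Is : `]-rho, rho[%classic s by rewrite /= in_itv/= -ltr_norml.
  have intf t : `]-rho, rho[%classic t -> omega.-integrable S (EFin \o f t).
    by move=> /Irho1 t1; exact/contS_integrable/cf.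
  have der t y : `]-rho, rho[%classic t -> S y -> derivable (f ^~ y) t 1.
    by move=> /Irho1 t1 Sy; have [] := df t y t1 Sy.
  have G0 (y : V) : 0 <= `|K| by [].
  have intG : omega.-integrable S (EFin \o (fun _ : V => `|K|)).
    by apply: contS_integrable; exact: contS_cst.
  have Gub t y : `]-rho, rho[%classic t -> S y -> `|partial1of2 f t y| <= `|K|.
    move=> It Sy; rewrite partial1of2E; have [_ ->] := df t y (Irho1 _ It) Sy.
    by apply: le_trans (ler_norm _); apply: fK => //; exact/ltW/Irho.
  have dd := derivable_under_integral measurable_sphere Is intf der G0 intG Gub.
  have := differentiation_under_integral measurable_sphere Is intf der G0 intG Gub.
  rewrite derive1E => DF; split => //; rewrite DF.
  rewrite -[RHS](f'0 s s01); apply: eq_Rintegral => y /set_mem Sy.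
  by rewrite partial1of2E; have [_ ->] := df s y s1 Sy.
have [|||z _] := @MVT _ F (cst 0) 0 r => //.
- move=> z; rewrite in_itv/= => /andP[z0 zr]; apply: dF.
  by rewrite ltW//= (lt_trans zr).
- apply: derivable_within_continuous => z; rewrite in_itv/= => /andP[z0 zr].
  by have [] : is_derive z 1 F 0 by apply: dF; rewrite z0 (le_lt_trans zr).
- by rewrite mul0r => /eqP; rewrite subr_eq0 => /eqP.
Qed.

End integral_parameter.

(** * The Poisson kernel tested against eigenfunctions *)

Section poisson.
Context {R : realType} {d : nat} (d_ge3 : (3 <= d)%N).
Local Notation V := 'rV[R]_d.
Local Notation S := (@sphere R d).
Let c : R := (d%:R - 2) / 2.

Lemma c_gt0 : 0 < c.
Proof. by rewrite /c divr_gt0// subr_gt0 ltr_nat. Qed.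

Let cd : d%:R = 2 * c + 2. Proof. by rewrite /c; field. Qed.

Variable x : V.
Hypothesis Sx : S x.

(** For [y] on the sphere, [|y - r x|^(-2 a)]: the Newtonian kernel for [a = c], and for
    [a = c + 1 = d / 2] the Poisson kernel up to the factor [1 - r^2]. *)
Definition pker (a r : R) : V -> R := zonal a (1 + r ^+ 2) (2 * r) x.

Let Q r y : R := 1 + r ^+ 2 - 2 * r * dot y x.

Lemma Q_ge r y : S y -> (1 - `|r|) ^+ 2 <= Q r y.
Proof.
move=> Sy; have := dot_sphere_le1 Sy Sx; rewrite /Q => t1.
have : r * dot y x <= `|r|.
  apply: le_trans (ler_norm _) _; rewrite normrM.
  by rewrite -[leRHS]mulr1 ler_wpM2l.
by rewrite -(real_normK (num_real r)); nra.
Qed.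

Lemma Q_gt0 r y : `|r| < 1 -> S y -> 0 < Q r y.
Proof.
move=> r1 Sy; apply: lt_le_trans (Q_ge _ Sy).
by rewrite exprn_gt0// subr_gt0.
Qed.

Lemma pker_dom r : `|r| < 1 -> S `<=` zonal_dom (1 + r ^+ 2) (2 * r) x.
Proof. by move=> r1 y Sy; exact: Q_gt0. Qed.

Lemma smooth_pker a r : smooth_on (zonal_dom (1 + r ^+ 2) (2 * r) x) (pker a r).
Proof. exact: smooth_on_zonal. Qed.

Lemma contS_pker a r : `|r| < 1 -> contS (pker a r).
Proof. by move=> r1; apply: (contS_smooth (pker_dom r1)); exact: smooth_pker. Qed.

Lemma pker_ge0 a r y : 0 <= pker a r y.
Proof. exact: powR_ge0. Qed.

Lemma powRN_le (u v a : R) : 0 <= a -> 0 < u -> u <= v -> v `^ (- a) <= u `^ (- a).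
Proof.
move=> a0 u0 uv; rewrite !powRN lef_pV2 ?posrE ?powR_gt0 ?(lt_le_trans u0)//.
by rewrite ge0_ler_powR// nnegrE ltW// (lt_le_trans u0).
Qed.

Lemma pker_le a r rho y : 0 <= a -> `|r| <= rho -> rho < 1 -> S y ->
  pker a r y <= ((1 - rho) ^+ 2) `^ (- a).
Proof.
move=> a0 rr rho1 Sy; apply: powRN_le => //.
  by rewrite exprn_gt0// subr_gt0.
apply: le_trans (Q_ge r Sy).
by rewrite ler_sqr ?nnegrE ?lerD2l ?lerN2// subr_ge0// ltW// (le_lt_trans rr).
Qed.

Lemma pker_succ a r y : 0 < Q r y -> pker a r y = Q r y * pker (a + 1) r y.
Proof.
move=> Q0; rewrite /pker /zonal -/(Q r y).
rewrite -[X in _ = X * _](powRr1 (ltW Q0)) -powRD; last by rewrite (gt_eqF Q0) implybT.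
by rewrite opprD addrCA subrr addr0.
Qed.

Lemma is_derive_pker a r y : 0 < Q r y ->
  is_derive r 1 (fun r => pker a r y) (- a * (2 * r - 2 * dot y x) * pker (a + 1) r y).
Proof.
move=> Q0.
have dQ : is_derive r 1 (Q ^~ y) (2 * r - 2 * dot y x).
  have d1 := is_derive1D (is_derive_cst (1 : R) r 1) (is_derive1X 2 (is_derive_id r 1)).
  have d2 := is_derive1M (is_derive1Z 2 (is_derive_id r 1)) (is_derive_cst (dot y x) r 1).
  by apply: is_derive1_eq (is_derive1B d1 d2) _; rewrite /=; ring.
have dp : is_derive (Q r y) 1 (fun t => t `^ (- a)) (- a * Q r y `^ (- a - 1)).
  exact: is_derive1_powR.
rewrite (_ : (fun r => pker a r y) = (fun t => t `^ (- a)) \o (Q ^~ y))//.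
apply: is_derive1_eq (@is_derive1_comp R (fun t => t `^ (- a)) (Q ^~ y) r _ _ dp dQ) _.
by rewrite /pker /zonal -/(Q r y) opprD; ring.
Qed.

Let normM_le (a b A B : R) : `|a| <= A -> `|b| <= B -> `|a * b| <= A * B.
Proof. by move=> aA bB; rewrite normrM ler_pM. Qed.

Let normD_le (a b A B : R) : `|a| <= A -> `|b| <= B -> `|a + b| <= A + B.
Proof. by move=> aA bB; apply: le_trans (ler_normD _ _) _; rewrite lerD. Qed.

Lemma norm_pker_le a r rho y : 0 <= a -> `|r| <= rho -> rho < 1 -> S y ->
  `|pker a r y| <= ((1 - rho) ^+ 2) `^ (- a).
Proof. by move=> *; rewrite ger0_norm ?pker_ge0//; exact: pker_le. Qed.

(* With [N = pker c] and the Poisson kernel [P = (1 - r^2) pker (c + 1)], the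
   [r]-derivative of [r ^ (l + 2 c) ((l + c) N - c P)] is
   [r ^ (l + 2 c - 1) (lap N + eigval l N)], which is orthogonal to [e]. *)
Lemma intS_poisson (l : nat) (e : V -> R) r : eigenfun l e -> 0 < r < 1 ->
  (l%:R + c) * \int[omega]_(y in S) (e y * pker c r y) =
  c * \int[omega]_(y in S) (e y * ((1 - r ^+ 2) * pker (c + 1) r y)).
Proof.
move=> [se le _] /andP[r0 r1].
have ce : contS e by apply: (contS_smooth (O := setT)).
have [K eK] := contS_bounded ce.
(* Thus [n + 1 = l + 2 c], a positive integer as [d >= 3]; hence [M] vanishes at [s = 0] and its
   constant integral is [0]. *)
pose n := (l + (d - 3))%N.
have nE : n.+1%:R = l%:R + 2 * c :> R.
  by rewrite -natr1 natrD natrB// cd; ring.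
pose M s y := s ^+ n.+1 * ((l%:R + c) * pker c s y - c * ((1 - s ^+ 2) * pker (c + 1) s y)).
pose M' s y := s ^+ n * (c * (c + 1) * (2 * s) ^+ 2 * (1 - dot y x ^+ 2) * pker (c + 2) s y
  - (d%:R - 1) * c * (2 * s) * dot y x * pker (c + 1) s y + @eigval R d l * pker c s y).
have M'E (s : R) y : `|s| < 1 -> S y ->
    M' s y = s ^+ n * (lap (pker c s) y + @eigval R d l * pker c s y).
  by move=> s1 Sy; rewrite /pker lap_zonal//; exact: pker_dom.
have cM (s : R) : `|s| < 1 -> contS (M s).
  move=> s1; have cp a : contS (pker a s) by exact: contS_pker.
  apply: contSM; first exact: contS_cst.
  apply: contSD; first by apply: contSM => //; exact: contS_cst.
  by apply: contSN; do 2 (apply: contSM; first exact: contS_cst).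
have dM (s : R) y : `|s| < 1 -> S y -> is_derive s 1 (M ^~ y) (M' s y).
  move=> s1 Sy; have Q0 := Q_gt0 s1 Sy.
  have d1 := is_derive1X n.+1 (is_derive_id s 1).
  have d2 := is_derive1Z (l%:R + c) (is_derive_pker c Q0).
  have d3 := is_derive1B (is_derive_cst (1 : R) s 1) (is_derive1X 2 (is_derive_id s 1)).
  have d4 := is_derive1Z c (is_derive1M d3 (is_derive_pker (c + 1) Q0)).
  apply: is_derive1_eq (is_derive1M d1 (is_derive1B d2 d4)) _.
  rewrite /M' /= nE (pker_succ c Q0) (pker_succ (c + 1) Q0) -(addrA c) (_ : 1 + 1 = 2)//.
  by rewrite /Q /eigval cd (exprS s n); ring.
have r01 : 0 <= r < 1 by rewrite (ltW r0).
have := @intS_const R d (fun s y => e y * M s y) (fun s y => e y * M' s y) _ _ _ _ r r01.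
have -> : \int[omega]_(y in S) (e y * M 0 y) = 0.
  rewrite (@eq_Rintegral _ _ _ _ _ (cst 0)); last by move=> y _; rewrite /M exprS !mul0r mulr0.
  by rewrite Rintegral_cst ?mul0r//; exact: measurable_sphere.
have nr1 : `|r| < 1 by rewrite ger0_norm// ltW.
have cp a : contS (pker a r) by exact: contS_pker.
have ceN : contS (fun y => e y * pker c r y) by exact: contSM.
have ceP : contS (fun y => e y * ((1 - r ^+ 2) * pker (c + 1) r y)).
  by apply: contSM => //; apply: contSM => //; exact: contS_cst.
have -> : \int[omega]_(y in S) (e y * M r y) = r ^+ n.+1 *
    ((l%:R + c) * \int[omega]_(y in S) (e y * pker c r y) +
     - c * \int[omega]_(y in S) (e y * ((1 - r ^+ 2) * pker (c + 1) r y))).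
  rewrite -!intSZ// -intSD; [|by apply: contSM => //; exact: contS_cst..].
  rewrite -intSZ; last by apply: contSD; apply: contSM => //; exact: contS_cst.
  by apply: eq_Rintegral => y _; rewrite /M; ring.
move=> H.
suff : r ^+ n.+1 * ((l%:R + c) * \int[omega]_(y in S) (e y * pker c r y) +
     - c * \int[omega]_(y in S) (e y * ((1 - r ^+ 2) * pker (c + 1) r y))) = 0.
  move/eqP; rewrite mulf_eq0 expf_eq0 (gt_eqF r0) andbF/= mulNr subr_eq0.
  by move/eqP.
apply: H.
- by move=> s s1; apply: contSM => //; exact: cM.
- by move=> s y s1 Sy; apply: is_derive1Z; exact: dM.
- move=> rho /andP[rho0 rho1].
  pose B a : R := ((1 - rho) ^+ 2) `^ (- a).
  exists (K * (1 * (`|c * (c + 1)| * (2 * 1) ^+ 2 * 2 * B (c + 2)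
    + `|(d%:R - 1) * c| * (2 * 1) * 1 * B (c + 1) + `|@eigval R d l| * B c))) => s y srho Sy.
  have s1 : `|s| <= 1 by rewrite (le_trans srho)// ltW.
  have n2s : `|2 * s| <= 2 * 1 by apply: normM_le => //; rewrite ger0_norm.
  have t1 := dot_sphere_le1 Sy Sx.
  have B_ a : 0 <= a -> `|pker a s y| <= B a by move=> a0; exact: norm_pker_le.
  have c0 := ltW c_gt0.
  apply: normM_le; first exact: eK.
  apply: normM_le; first by rewrite normrX exprn_ile1.
  apply: normD_le; last by apply: normM_le => //; exact: B_.
  apply: normD_le.
    apply: normM_le; last by apply: B_; rewrite addr_ge0.
    apply: normM_le.
      by apply: normM_le => //; rewrite normrX lerXn2r ?nnegrE.
    rewrite (_ : 2 = 1 + 1 :> R)//; apply: normD_le; first by rewrite normr1.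
    by rewrite normrN normrX exprn_ile1.
  rewrite normrN; apply: normM_le; last by apply: B_; rewrite addr_ge0.
  by do 2 (apply: normM_le => //).
- move=> s /andP[s0 s1']; have s1 : `|s| < 1 by rewrite ger0_norm.
  have cps a : contS (pker a s) by exact: contS_pker.
  have slp : smooth_on (zonal_dom (1 + s ^+ 2) (2 * s) x) (lap (pker c s)).
    by apply: smooth_on_lap; [exact: open_zonal_dom|exact: smooth_pker].
  have clp := contS_smooth (pker_dom s1) slp.
  transitivity (s ^+ n * (\int[omega]_(y in S) (e y * lap (pker c s) y) +
      @eigval R d l * \int[omega]_(y in S) (e y * pker c s y))).
    rewrite -intSZ; last exact: contSM.
    rewrite -intSD; [|by apply: contSM..|by apply: contSM; [exact: contS_cst|exact: contSM]].
    rewrite -intSZ; last first.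
      apply: contSD; first exact: contSM.
      by apply: contSM; [exact: contS_cst|exact: contSM].
    by apply: eq_Rintegral => y /set_mem Sy; rewrite M'E//; ring.
  (* Moves the Laplacian onto [e], where it produces [- eigval l * e] and cancels the other term. *)
  rewrite -(@green_sym R d _ (@open_zonal_dom _ _ _ _ _) (pker_dom s1)).
  + rewrite -intSZ; last exact: contSM.
    rewrite (@eq_Rintegral _ _ _ _ _ (fun y => - (@eigval R d l * (e y * pker c s y)))).
      rewrite intSN ?addNr ?mulr0//.
      by apply: contSM; [exact: contS_cst|exact: contSM].
    by move=> y /set_mem Sy; rewrite le//; ring.
  + exact: (smooth_on_subset (@subsetT _ _) se).
  + exact: smooth_pker.
Qed.

End poisson.

(** * The kernel [|x - y|^(2 - d)] as the limit of [pker] at [r = 1] *)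

Section kernel.
Context {R : realType} {d : nat} (d_ge3 : (3 <= d)%N).
Local Notation V := 'rV[R]_d.
Local Notation S := (@sphere R d).
Let c : R := (d%:R - 2) / 2.
Let W : R := @sphere_area R d.
Variable x : V.
Hypothesis Sx : S x.

Let c_gt0' : 0 < c. Proof. exact: c_gt0. Qed.

Let c_ge12 : 2^-1 <= c.
Proof.
rewrite /c -[leLHS]mul1r ler_pM2r ?invr_gt0// lerBrDr (_ : 1 + 2 = 3%:R)//.
by rewrite ler_nat.
Qed.

Lemma intS_cst (a : R) : \int[omega]_(y in S) a = a * W.
Proof. by rewrite Rintegral_cst//; exact: measurable_sphere. Qed.

Lemma intS_coord0 i : \int[omega]_(y in S) (y 0 i : R) = 0.
Proof.
have := @intS_sg R d setT (@openT V) (@subsetT _ _) i (fun=> 1) (@smooth_on_cst _ _ _ _).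
rewrite (@eq_Rintegral _ _ _ _ _ (cst 0)); last by move=> y _; rewrite sg_cst.
rewrite intS_cst mul0r.
rewrite (@eq_Rintegral _ _ _ _ _ (fun y : V => y 0 i) (fun y => y 0 i * 1)); last first.
  by move=> y _; rewrite mulr1.
move=> /esym/eqP; rewrite mulf_eq0 subr_eq0 pnatr_eq1 => /orP[/eqP d1|/eqP//].
by exfalso; have := d_ge3; rewrite d1.
Qed.

Lemma eigenfun_cst (a : R) : @eigenfun R d 0 (fun=> a).
Proof.
split; first exact: smooth_on_cst.
  by move=> y _; rewrite lap_cst /eigval mul0r oppr0 mul0r.
by move=> _; exists a.
Qed.

(** Mean value property. [r] times the [r]-derivative of [pker c r] is [c] times the difference of
    the Poisson kernel and [pker c r], whose integral vanishes by [intS_poisson] at [l = 0]. That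
    identity requires [r > 0]; at [r = 0] the derivative is linear in [y] and integrates to [0] by
    symmetry. *)
Lemma intS_pker r : 0 <= r < 1 -> \int[omega]_(y in S) pker x c r y = W.
Proof.
move=> r01.
rewrite (@intS_const R d (fun r => pker x c r)
  (fun r y => - c * (2 * r - 2 * dot y x) * pker x (c + 1) r y) _ _ _ _ r r01).
- rewrite -[RHS]mul1r -intS_cst; apply: eq_Rintegral => y _.
  by rewrite /pker /zonal mulr0 mul0r subr0 expr0n addr0 powR1.
- by move=> s s1; exact: contS_pker.
- by move=> s y s1 Sy; apply: is_derive_pker; exact: Q_gt0.
- move=> rho /andP[rho0 rho1].
  exists (c * (2 * rho + 2) * ((1 - rho) ^+ 2) `^ (- (c + 1))) => s y srho Sy.
  rewrite !normrM normrN ler_pM ?mulr_ge0 ?normr_ge0//.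
    rewrite (gtr0_norm c_gt0') ler_pM2l//.
    apply: le_trans (ler_normB _ _) _; rewrite !normrM !(ger0_norm (ler0n _ _)) lerD//.
      by rewrite ler_pM2l.
    by rewrite -[leRHS]mulr1 ler_pM2l// dot_sphere_le1.
  by apply: norm_pker_le => //; rewrite addr_ge0// ltW.
- move=> s /andP[s0 s1]; have [->|sn0] := eqVneq s 0.
    rewrite (@eq_Rintegral _ _ _ _ _ (fun y : V => \sum_i (2 * c * x 0 i) * y 0 i)); last first.
      move=> y _; rewrite /pker /zonal !mulr0 mul0r subr0 expr0n addr0 powR1 mulr1.
      transitivity (2 * c * dot y x); first by ring.
      by rewrite /dot mulr_sumr; apply: eq_bigr => i _; ring.
    rewrite (@intS_sum R d _ _ (fun i (y : V) => (2 * c * x 0 i) * y 0 i)).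
      by apply: big1 => i _; rewrite intSZ ?intS_coord0 ?mulr0//; exact: contS_coord.
    by move=> i; apply: contSM; [exact: contS_cst|exact: contS_coord].
  have {sn0}s0 : 0 < s by rewrite lt_neqAle eq_sym sn0.
  have ns1 : `|s| < 1 by rewrite gtr0_norm.
  have cp a : contS (pker x a s) by exact: contS_pker.
  apply: (mulfI (lt0r_neq0 s0)); rewrite mulr0 -intSZ; last first.
    by apply: contSM => //; apply: contSM; first exact: contS_cst;
      apply: (contS_smooth (O := setT)) => //; apply: smooth_onB; try exact: openT;
      [exact: smooth_on_cst|apply: smooth_onZ; [exact: openT|exact: (smooth_on_dot _ (@openT V))]].
  have := intS_poisson d_ge3 Sx (eigenfun_cst 1) (r := s).
  rewrite s0 s1 => /(_ isT); rewrite -/c add0r.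
  have c1 : contS (fun y => 1 * pker x c s y) by apply: contSM; [exact: contS_cst|].
  have c2 : contS (fun y => 1 * ((1 - s ^+ 2) * pker x (c + 1) s y)).
    by do 2 (apply: contSM; first exact: contS_cst).
  rewrite -!intSZ// => H.
  rewrite (@eq_Rintegral _ _ _ _ _ (fun y => c * (1 * ((1 - s ^+ 2) * pker x (c + 1) s y)) +
     - (c * (1 * pker x c s y)))).
    rewrite intSD ?intSN ?H ?subrr//; last 2 first.
      by apply: contSM => //; exact: contS_cst.
    - by apply: contSN; apply: contSM => //; exact: contS_cst.
    by apply: contSM => //; exact: contS_cst.
  move=> y /set_mem Sy; rewrite (pker_succ c (Q_gt0 Sx ns1 Sy)); ring.
Qed.

(** Radii tending to [1]. Starting at [1/2] keeps them in the range of [intS_poisson] and makes the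
    dominating function of [kernel_eigen] independent of [k]. *)
Let rr (k : nat) : R := 1 - k.+2%:R^-1.

Let rr_bound k : 2^-1 <= rr k < 1.
Proof.
rewrite /rr ltrBlDr ltrDl invr_gt0 ltr0n andbT lerBrDr -lerBrDl.
apply: (@le_trans _ _ 2^-1); first by rewrite lef_pV2 ?posrE ?ler_nat ?ltr0n.
lra.
Qed.

Let rr01 k : 0 <= rr k < 1.
Proof. by have /andP[h ->] := rr_bound k; rewrite andbT (le_trans _ h). Qed.

Let rr01' k : 0 < rr k < 1.
Proof. by have /andP[h ->] := rr_bound k; rewrite andbT (lt_le_trans _ h). Qed.

Let norm_rr k : `|rr k| < 1.
Proof. by have /andP[h1 h2] := rr01 k; rewrite ger0_norm. Qed.

Let cvg_rr : rr k @[k --> \oo] --> (1 : R).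
Proof.
rewrite -[X in _ --> X]subr0; apply: cvgB; first exact: cvg_cst.
by have := @cvg_harmonic R; rewrite -(cvg_shiftS (@harmonic R)).
Qed.

Lemma kap_ge0 y : S y -> 0 <= 2 - 2 * dot y x.
Proof. by move=> Sy; have := dot_sphere_le1 Sy Sx; rewrite ler_norml; lra. Qed.

Lemma kap_gt0 y : S y -> y != x -> 0 < 2 - 2 * dot y x.
Proof.
move=> Sy yx; rewrite -dot_sphereB// lt_neqAle dot_ge0 andbT eq_sym.
by apply: contra yx => /eqP/dot_eq0/eqP; rewrite subr_eq0.
Qed.

Lemma intS_poisson_kernel r : 0 < r < 1 ->
  \int[omega]_(y in S) ((1 - r ^+ 2) * pker x (c + 1) r y) = W.
Proof.
move=> /[dup] r01 /andP[r0 r1].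
have := intS_poisson d_ge3 Sx (eigenfun_cst 1) r01.
rewrite -/c add0r => /(mulfI (lt0r_neq0 c_gt0')).
rewrite (@eq_Rintegral _ _ _ _ _ (pker x c r)); last by move=> y _; rewrite mul1r.
rewrite intS_pker ?(ltW r0)// => ->.
by apply: eq_Rintegral => y _; rewrite mul1r.
Qed.

(** The Poisson kernel is an approximate identity. Instead of splitting the sphere, bound
    [|e y - e x|] by [eps1 + K |x - y|^2]: the factor [|x - y|^2] lowers the exponent of the kernel
    by one, and what is left has integral at most [b k * W]. *)
Lemma poisson_cvg (e : V -> R) : contS e ->
  \int[omega]_(y in S) (e y * ((1 - rr k ^+ 2) * pker x (c + 1) (rr k) y))
    @[k --> \oo] --> e x * W.
Proof.
move=> ce; have [M eM] := contS_bounded ce.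
have W0 : 0 <= W by rewrite /W fine_ge0.
(* Comes from [r |x - y|^2 <= |y - r x|^2], where the difference of the two sides is [(1 - r)^2]. *)
pose b k := (1 - rr k ^+ 2) / rr k.
have cb : b k @[k --> \oo] --> (0 : R).
  rewrite (_ : 0 = (1 - 1 ^+ 2) / 1 :> R); last by rewrite expr1n subrr mul0r.
  apply: cvgM; last by apply: cvgV => //; exact: oner_neq0.
  apply: cvgB; first exact: cvg_cst.
  by apply: cvgM; exact: cvg_rr.
apply/cvgrPdist_le => eps eps0.
pose eps1 := eps / (2 * (W + 1)).
have eps10 : 0 < eps1 by rewrite divr_gt0// mulr_gt0// ltr_wpDl.
(* Near [x] this is continuity; at distance at least [de] the choice [K = 2 M / de^2] makes the
   quadratic term exceed [2 M]. *)
have [K K0 eK] : exists2 K, 0 <= K & forall y, S y ->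
    `|e y - e x| <= eps1 + K * (2 - 2 * dot y x).
  have /cvgrPdist_lt/(_ _ eps10)/nbhs_ballP[de /= de0 H] := ce x Sx.
  have M0 : 0 <= M by apply: le_trans (eM x Sx).
  have K0 : 0 <= 2 * M / de ^+ 2 by apply: divr_ge0; [exact: mulr_ge0|exact: sqr_ge0].
  exists (2 * M / de ^+ 2) => // y Sy; have [xy|xy] := pselect (ball x de y).
    have := H y xy; rewrite /= distrC => /ltW exy; apply: le_trans exy _.
    by rewrite lerDl; apply: mulr_ge0 => //; exact: kap_ge0.
  have [i xyi] : exists i, de <= `|x 0 i - y 0 i|.
    apply: contrapT => /forallNP nxy; apply: xy; apply/ball_rVP => // i.
    by rewrite ltNge; apply/negP; exact: nxy.
  have k2 : de ^+ 2 <= 2 - 2 * dot y x.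
    rewrite (dotC y) -dot_sphereB// -sqr_enorm ler_sqr ?nnegrE ?enorm_ge0 ?(ltW de0)//.
    by apply: le_trans xyi _; have := enorm_coord (x - y) i; rewrite !mxE.
  apply: (@le_trans _ _ (2 * M)).
    apply: le_trans (ler_normB _ _) _; rewrite mulr_natl mulr2n.
    by rewrite lerD// eM.
  apply: ler_wpDl; first exact: ltW.
  by rewrite mulrAC ler_pdivlMr ?exprn_gt0// ler_wpM2l// mulr_ge0.
have key k : `|\int[omega]_(y in S) (e y * ((1 - rr k ^+ 2) * pker x (c + 1) (rr k) y)) - e x * W|
    <= eps1 * W + K * b k * W.
  have /andP[r0 r1] := rr01' k.
  have cp a : contS (pker x a (rr k)) by exact: contS_pker.
  have cP : contS (fun y => (1 - rr k ^+ 2) * pker x (c + 1) (rr k) y).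
    by apply: contSM => //; exact: contS_cst.
  have P0 y : S y -> 0 <= (1 - rr k ^+ 2) * pker x (c + 1) (rr k) y.
    move=> Sy; rewrite mulr_ge0 ?pker_ge0// subr_ge0 expr_le1 ?ltW//.
  rewrite -(intS_poisson_kernel (rr01' k)) -intSZ//.
  rewrite -RintegralB//; last 3 first.
  - exact: measurable_sphere.
  - by apply: contS_integrable; exact: contSM.
  - by apply: contS_integrable; apply: contSM => //; exact: contS_cst.
  apply: le_trans (le_normr_Rintegral _ _) _.
  - exact: measurable_sphere.
  - apply: contS_integrable; apply: contSD; first exact: contSM.
    by apply: contSN; apply: contSM => //; exact: contS_cst.
  have -> : eps1 * \int[omega]_(y in S) ((1 - rr k ^+ 2) * pker x (c + 1) (rr k) y) + K * b k *
      \int[omega]_(y in S) ((1 - rr k ^+ 2) * pker x (c + 1) (rr k) y) =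
      \int[omega]_(y in S) (eps1 * ((1 - rr k ^+ 2) * pker x (c + 1) (rr k) y) + K * b k * pker x c (rr k) y).
    rewrite intSD; [|by apply: contSM => //; exact: contS_cst..].
    by rewrite (intSZ eps1 cP) (intSZ (K * b k) (cp c)) (intS_poisson_kernel (rr01' k)) intS_pker.
  apply: le_Rintegral.
  - exact: measurable_sphere.
  - apply: (contS_integrable (f := fun y => `|e y * ((1 - rr k ^+ 2) * pker x (c + 1) (rr k) y)
      - e x * ((1 - rr k ^+ 2) * pker x (c + 1) (rr k) y)|)).
    have cd : contS (fun y => e y * ((1 - rr k ^+ 2) * pker x (c + 1) (rr k) y)
      - e x * ((1 - rr k ^+ 2) * pker x (c + 1) (rr k) y)).
      apply: contSD; first exact: contSM.
      by apply: contSN; apply: contSM => //; exact: contS_cst.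
    by move=> y Sy; apply: continuous_comp; [exact: cd|exact: norm_continuous].
  - by apply: contS_integrable; apply: contSD; apply: contSM => //; exact: contS_cst.
  move=> y Sy; rewrite -mulrBl normrM (ger0_norm (P0 y Sy)).
  apply: le_trans (ler_wpM2r (P0 y Sy) (eK y Sy)) _.
  rewrite mulrDl lerD2l -!mulrA ler_wpM2l//.
  rewrite (pker_succ c (Q_gt0 Sx (norm_rr k) Sy)) /b.
  rewrite mulrCA ler_wpM2l ?subr_ge0 ?expr_le1 ?(ltW r0) ?(ltW r1)//.
  rewrite mulrA ler_wpM2r ?pker_ge0// ler_pdivlMl//.
  rewrite -subr_ge0 (_ : _ - _ = (1 - rr k) ^+ 2) ?sqr_ge0//; ring.
have cb2 : K * b k * W @[k --> \oo] --> (0 : R).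
  rewrite (_ : 0 = K * 0 * W :> R); last by rewrite mulr0 mul0r.
  by apply: cvgM; [apply: cvgM => //; exact: cvg_cst|exact: cvg_cst].
have eps20 : 0 < eps / 2 by rewrite divr_gt0.
near=> k; rewrite distrC; apply: le_trans (key k) _.
rewrite (splitr eps) lerD//.
  have W1 : 0 < W + 1 by rewrite ltr_wpDl.
  have -> : eps1 * W = eps / 2 * (W / (W + 1)) by rewrite /eps1; field; rewrite gt_eqF.
  by apply: ler_piMr; [exact: ltW|rewrite ler_pdivrMr// mul1r lerDl].
apply: le_trans (ler_norm _) _; rewrite -[X in `|X|]subr0 distrC.
near: k; by move/cvgrPdist_le : cb2; apply.
Unshelve. all: end_near. Qed.

Let kap : V -> R := zonal c 2 2 x.

Let kap_cvg y : S y -> y != x -> pker x c (rr k) y @[k --> \oo] --> kap y.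
Proof.
move=> Sy yx; have k0 := kap_gt0 Sy yx.
have cQ : 1 + rr k ^+ 2 - 2 * rr k * dot y x @[k --> \oo] --> 2 - 2 * dot y x.
  rewrite (_ : 2 - _ = 1 + 1 * 1 - 2 * 1 * dot y x :> R); last by ring.
  apply: cvgB; last first.
    apply: cvgM; last exact: cvg_cst.
    by apply: cvgM; [exact: cvg_cst|exact: cvg_rr].
  by apply: cvgD; [exact: cvg_cst|apply: cvgM; exact: cvg_rr].
have cp : {for (2 - 2 * dot y x), continuous (fun t : R => t `^ (- c))}.
  apply: differentiable_continuous; apply/derivable1_diffP.
  by have [] := is_derive1_powR (- c) k0.
exact: (cvg_comp _ _ cQ cp).
Qed.

Let mkap : measurable_fun setT kap.
Proof.
have H : measurable_fun setT (fun y : V => 2 - 2 * dot y x).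
  apply: measurable_fun_continuous.
  by move=> y; exact: (@smooth_on_affine R d setT 2 2 x (@openT V) 0).
exact: (measurableT_comp (f := fun t : R => t `^ (- c)) (measurable_powR _) H).
Qed.

Let intS_fin f : contS f -> (\int[omega]_(y in S) (f y)%:E)%E = (\int[omega]_(y in S) f y)%:E.
Proof.
move=> cf; rewrite /Rintegral fineK//.
by apply: integrable_fin_num; [exact: measurable_sphere|exact: contS_integrable].
Qed.

Let measurable_x : measurable [set x].
Proof.
rewrite -[X in measurable X]setCK; apply: measurableC; apply: open_measurable_rV.
by apply: closed_openC; exact: (accessible_closed_set1 (hausdorff_accessible (@norm_hausdorff _ _))).
Qed.

(* [pker x c r] has integral [W] for all [r], but equals [(1 - r) ^ (- 2 c)] at [x]. *)
Lemma omega_set1 : omega [set x] = 0%E.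
Proof.
have xS : [set x] `<=` S by move=> _ ->.
have [m m0 ox] : exists2 m : R, 0 <= m & omega [set x] = m%:E.
  exists (fine (omega [set x])); first exact: fine_ge0.
  by rewrite fineK//; exact: fin_num_measure.
have key k : m * k.+2%:R <= W.
  have /andP[r0 r1] := rr01 k.
  have cp : contS (pker x c (rr k)) by exact: contS_pker.
  have mN : measurable_fun S (fun y => (pker x c (rr k) y)%:E).
    by apply/measurable_EFinP; exact: contS_measurable.
  have := ge0_subset_integral (@omega R d) measurable_x measurable_sphere mN
    (fun y _ => pker_ge0 x c (rr k) y : (0 <= (pker x c (rr k) y)%:E)%E) xS.
  rewrite (intS_fin cp) intS_pker//.
  rewrite (eq_integral (fun=> ((k.+2%:R ^+ 2) `^ c)%:E)); last first.
    move=> y; rewrite inE => ->; congr EFin; rewrite /pker /zonal (sphereP x).1// mulr1.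
    rewrite (_ : _ - _ = (1 - rr k) ^+ 2); last by ring.
    rewrite /rr opprB addrC subrK exprVn.
    by rewrite -powR_inv1 ?sqr_ge0// -powRrM mulN1r opprK.
  rewrite integral_cst//= ox -EFinM lee_fin; apply: le_trans.
  rewrite mulrC; apply: ler_wpM2r => //.
  (* The value at [x] is [(k + 2)^(2 c)], and [2 c >= 1]. *)
  apply: (@le_trans _ _ ((k.+2%:R ^+ 2) `^ 2^-1)).
    by rewrite powR12_sqrt ?sqr_ge0// sqrtr_sqr ger0_norm.
  by rewrite ler_powR// exprn_ege1// ler1n.
rewrite ox; congr EFin; apply/eqP; rewrite eq_le m0 andbT.
rewrite leNgt; apply/negP => m_gt0.
have := key (Num.truncn (W / m)).
rewrite -ler_pdivlMl// mulrC leNgt => /negP; apply.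
apply: lt_le_trans (truncnS_gt _) _.
by rewrite ler_nat.
Qed.

(** Fatou along [rr], all integrals being [W]. The point [x], where the convergence fails, is
    removed first; this is the purpose of [omega_set1]. *)
Let kap_int : (\int[omega]_(y in S) (kap y)%:E <= W%:E)%E.
Proof.
have cp k : contS (pker x c (rr k)) by exact: contS_pker.
have F k : (\int[omega]_(y in S) (pker x c (rr k) y)%:E = W%:E)%E.
  by rewrite intS_fin// intS_pker.
have mp k : measurable_fun S (fun y => (pker x c (rr k) y)%:E).
  by apply/measurable_EFinP; exact: contS_measurable.
pose D := S `\` [set x].
have mD : measurable D by apply: measurableD => //; exact: measurable_sphere.
have DS : D `<=` S by move=> y [].
have FD k : (\int[omega]_(y in D) (pker x c (rr k) y)%:E = W%:E)%E.
  rewrite -(F k) [RHS](@ge0_negligible_integral _ _ _ _ _ [set x])//.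
  - exact: measurable_sphere.
  - by move=> y _; rewrite lee_fin pker_ge0.
  - exact: omega_set1.
have mpD k : measurable_fun D (fun y => (pker x c (rr k) y)%:E).
  by apply: measurable_funS (mp k) => //; exact: measurable_sphere.
have p0 k y : D y -> (0 <= (pker x c (rr k) y)%:E)%E by rewrite lee_fin pker_ge0.
have := fatou (@omega R d) mD mpD p0.
rewrite [X in (_ <= limn_einf X)%E -> _](_ : _ = fun=> W%:E); last exact/funext.
rewrite (cvg_limn_einf_sup (@cvg_cst _ W%:E _ _ _)).1; apply: le_trans.
rewrite [leLHS](@ge0_negligible_integral _ _ _ _ _ [set x])//.
- rewrite le_eqVlt; apply/orP; left; apply/eqP; apply: eq_integral => y; rewrite inE => -[Sy /eqP yx].
  have H := kap_cvg Sy yx.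
  rewrite (cvg_limn_einf_sup (l := (kap y)%:E) _).1//.
  by apply: cvg_EFin => //; exact: nearW.
- exact: measurable_sphere.
- by apply/measurable_EFinP; exact: measurable_funS mkap.
- by move=> y _; rewrite lee_fin powR_ge0.
- exact: omega_set1.
Qed.

Lemma kernel_integrable : omega.-integrable S (EFin \o zonal c 2 2 x).
Proof.
apply/integrableP; split; first by apply/measurable_EFinP; exact: measurable_funS mkap.
rewrite (eq_integral (fun y => (kap y)%:E)); last first.
  by move=> y _; rewrite /= ger0_norm ?powR_ge0.
by apply: le_lt_trans kap_int _; rewrite ltry.
Qed.

(** The limit of [intS_poisson] at [r = 1]: dominated convergence on the left, [poisson_cvg] on the
    right. *)
Lemma kernel_eigen l (e : V -> R) : eigenfun l e ->
  (l%:R + c) * \int[omega]_(y in S) (e y * zonal c 2 2 x y) = c * (e x * W).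
Proof.
move=> ee; have [se _ _] := ee.
have ce : contS e by exact: (contS_smooth (O := setT)).
have [K eK] := contS_bounded ce.
have cp k a : contS (pker x a (rr k)) by exact: contS_pker.
(* For [r >= 1/2], [|y - r x|^2 = (1 - r)^2 + r |x - y|^2] is at least [|x - y|^2 / 2], hence
   [pker x c r <= B * kap]. *)
pose B : R := 2^-1 `^ (- c).
have ix : {ae (@omega R d), forall y, y != x}.
  exists [set x]; split => //; first exact: omega_set1.
  by move=> y /= /negP; rewrite negbK => /eqP.
have ig : omega.-integrable S (fun y => (K * B * kap y)%:E).
  rewrite (_ : (fun _ => _) = fun y => ((K * B)%:E * (kap y)%:E)%E); last exact/funext.
  by apply: integrableZl; [exact: measurable_sphere|exact: kernel_integrable].
have dom : {ae (@omega R d), forall y k, S y -> (`|(e y * pker x c (rr k) y)%:E| <= (K * B * kap y)%:E)%E}.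
  apply: filterS ix => y yx k Sy; rewrite lee_fin normrM -mulrA ler_pM ?normr_ge0//; first exact: eK.
  rewrite ger0_norm ?pker_ge0// /B /kap /pker /zonal -powRM ?kap_ge0//.
  have kp := kap_gt0 Sy yx; have /andP[h1 h2] := rr_bound k.
  apply: powRN_le; first exact: ltW.
    by rewrite mulr_gt0.
  rewrite -subr_ge0 (_ : _ - _ = (1 - rr k) ^+ 2 + (rr k - 2^-1) * (2 - 2 * dot y x)); last by field.
  apply: addr_ge0; first exact: sqr_ge0.
  by apply: mulr_ge0; [rewrite subr_ge0|exact: ltW].
have cv : {ae (@omega R d), forall y, S y ->
    (e y * pker x c (rr k) y)%:E @[k --> \oo] --> (e y * kap y)%:E}.
  apply: filterS ix => y yx Sy; apply: cvg_EFin; first exact: nearW.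
  by apply: cvgM; [exact: cvg_cst|exact: kap_cvg].
have mf k : measurable_fun S (fun y => (e y * pker x c (rr k) y)%:E).
  by apply/measurable_EFinP; apply: contS_measurable; exact: contSM.
have mk : measurable_fun S (fun y => (e y * kap y)%:E).
  apply/measurable_EFinP; apply: measurable_funM; first exact: contS_measurable.
  exact: measurable_funS mkap.
have [ik _ lim] := dominated_convergence measurable_sphere mf mk cv ig dom.
have {}lim : \int[omega]_(y in S) (e y * pker x c (rr k) y) @[k --> \oo] -->
    \int[omega]_(y in S) (e y * kap y).
  by apply: fine_cvg; rewrite fineK//; apply: integrable_fin_num => //; exact: measurable_sphere.
have l1 : (l%:R + c) * \int[omega]_(y in S) (e y * pker x c (rr k) y) @[k --> \oo] -->
    (l%:R + c) * \int[omega]_(y in S) (e y * kap y).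
  by apply: cvgM => //; exact: cvg_cst.
have l2 : (l%:R + c) * \int[omega]_(y in S) (e y * pker x c (rr k) y) @[k --> \oo] --> c * (e x * W).
  rewrite (_ : (fun k => _) = fun k => c *
    \int[omega]_(y in S) (e y * ((1 - rr k ^+ 2) * pker x (c + 1) (rr k) y))).
    by apply: cvgM; [exact: cvg_cst|exact: poisson_cvg].
  by apply/funext => k; rewrite intS_poisson.
exact: (cvg_unique _ l1 l2).
Qed.

End kernel.

(** * Algebras closed under bounded limits *)

Section bounded_limits.
Context dd (X : measurableType dd) (R : realType).
Variables (mu : {measure set X -> \bar R}) (D : set X) (mD : measurable D).
Variables (I : Type) (u : I -> X -> R).

(** A functional form of the monotone class theorem: the algebra generated by the [u i], closed
    under uniformly bounded pointwise limits. Orthogonality to an integrable function passes from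
    monomials to all of it. *)
Inductive blc : (X -> R) -> Prop :=
| blc_cst (a : R) : blc (fun=> a)
| blc_gen i : blc (u i)
| blc_add f g : blc f -> blc g -> blc (fun x => f x + g x)
| blc_mul f g : blc f -> blc g -> blc (fun x => f x * g x)
| blc_lim (f_ : nat -> X -> R) (f : X -> R) (K : R) : (forall k, blc (f_ k)) ->
    (forall k x, D x -> `|f_ k x| <= K) ->
    (forall x, D x -> f_ k x @[k --> \oo] --> f x) -> blc f.

Lemma integrable_mulb (h w : X -> R) (K : R) : mu.-integrable D (EFin \o h) ->
  measurable_fun D w -> (forall x, D x -> `|w x| <= K) ->
  mu.-integrable D (EFin \o (fun x => h x * w x)).
Proof.
move=> ih mw wK; rewrite (_ : _ \o _ = (EFin \o h) \* (EFin \o w))%E; last first.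
  by apply/funext => x /=; rewrite EFinM.
apply: integrableMl => //; exists K; split; first exact: num_real.
by move=> y Ky x Dx; exact: le_trans (wK _ Dx) (ltW Ky).
Qed.

Lemma Rintegral_dominated (f_ : nat -> X -> R) (f g : X -> R) :
  (forall k, measurable_fun D (f_ k)) -> mu.-integrable D (EFin \o g) ->
  (forall k x, D x -> `|f_ k x| <= g x) ->
  (forall x, D x -> f_ k x @[k --> \oo] --> f x) ->
  mu.-integrable D (EFin \o f) /\
  \int[mu]_(x in D) f_ k x @[k --> \oo] --> \int[mu]_(x in D) f x.
Proof.
move=> mf ig fg ff.
have mf' : measurable_fun D f by exact: measurable_fun_cvg mf ff.
have H k : measurable_fun D (EFin \o f_ k) by apply/measurable_EFinP.
have H' : measurable_fun D (EFin \o f) by apply/measurable_EFinP.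
have cv : {ae mu, forall x, D x -> (EFin \o f_ k) x @[k --> \oo] --> (EFin \o f) x}.
  by apply: aeW => x Dx; apply: cvg_EFin; [exact: nearW|exact: ff].
have dom : {ae mu, forall x k, D x -> (`|(EFin \o f_ k) x| <= (EFin \o g) x)%E}.
  by apply: aeW => x k Dx; rewrite /= lee_fin fg.
have [ik _ lim] := dominated_convergence mD H H' cv ig dom.
split => //; apply: fine_cvg; rewrite fineK//.
exact: integrable_fin_num.
Qed.

Hypothesis mu_u : forall i, measurable_fun D (u i).
Variable B : R.
Hypothesis u_le : forall i x, D x -> `|u i x| <= B.

Lemma blc_bounded_measurable f : blc f ->
  measurable_fun D f /\ exists K : R, forall x, D x -> `|f x| <= K.
Proof.
elim => [a|i|{}f g _ [mf [K fK]] _ [mg [L gL]]|{}f g _ [mf [K fK]] _ [mg [L gL]]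
    |f_ {}f K _ IH fK ff].
- by split; [exact: measurable_cst|exists `|a|].
- by split; [exact: mu_u|exists B => x; exact: u_le].
- split; first exact: measurable_funD.
  by exists (K + L) => x Dx; rewrite (le_trans (ler_normD _ _))// lerD// ?fK// gL.
- split; first exact: measurable_funM.
  by exists (K * L) => x Dx; rewrite normrM ler_pM// ?fK// gL.
- split; first by apply: (measurable_fun_cvg _ ff) => k; have [] := IH k.
  exists K => x Dx; have cf : `|f_ k x| @[k --> \oo] --> `|f x| by apply: cvg_norm; exact: ff.
  by apply: (cvgr_to_le cf); apply: nearW => k; exact: fK.
Qed.

Lemma blc_scale (a : R) f : blc f -> blc (fun x => a * f x).
Proof. by move=> bf; apply: blc_mul => //; exact: blc_cst. Qed.

Lemma blc_sub f g : blc f -> blc g -> blc (fun x => f x - g x).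
Proof.
move=> bf bg; rewrite (_ : (fun _ => _) = fun x => f x + (-1) * g x).
  by apply: blc_add => //; exact: blc_scale.
by apply/funext => x; rewrite mulN1r.
Qed.

Lemma blc_exp f k : blc f -> blc (fun x => f x ^+ k).
Proof.
move=> bf; elim: k => [|k IH]; first exact: blc_cst.
rewrite (_ : (fun _ => _) = fun x => f x * f x ^+ k); first exact: blc_mul.
by apply/funext => x; rewrite exprS.
Qed.

Lemma blc_eq f g : blc f -> (forall x, D x -> f x = g x) -> blc g.
Proof.
move=> bf fg; have [_ [K fK]] := blc_bounded_measurable bf.
apply: (@blc_lim (fun=> f) g K) => // x Dx; rewrite -fg//; exact: cvg_cst.
Qed.

(** Geometric series in [1 - f]; its partial sums are nonnegative and at most
    [1 / f <= 1 / delta]. *)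
Lemma blc_inv f (delta : R) : 0 < delta -> blc f ->
  (forall x, D x -> delta <= f x <= 1) -> blc (fun x => (f x)^-1).
Proof.
move=> delta0 bf f01.
have q1 x : D x -> 0 <= 1 - f x <= 1 - delta.
  by move=> /f01/andP[h1 h2]; rewrite subr_ge0 h2 lerD2l lerN2.
have fN0 x : D x -> f x != 0 by move=> /f01/andP[h1 _]; rewrite gt_eqF// (lt_le_trans delta0).
apply: (@blc_lim (fun k x => \sum_(j < k) (1 - f x) ^+ j) _ delta^-1).
- elim => [|k IH].
    by rewrite (_ : (fun _ => _) = fun=> 0); [exact: blc_cst|apply/funext => x; rewrite big_ord0].
  rewrite (_ : (fun _ => _) = fun x => \sum_(j < k) (1 - f x) ^+ j + (1 - f x) ^+ k).
    by apply: blc_add => //; apply: blc_exp; apply: blc_sub => //; exact: blc_cst.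
  by apply/funext => x; rewrite big_ord_recr.
- move=> k x Dx; have /andP[h1 h2] := q1 x Dx.
  rewrite ger0_norm; last by apply: sumr_ge0 => j _; exact: exprn_ge0.
  have e : f x * \sum_(j < k) (1 - f x) ^+ j = 1 - (1 - f x) ^+ k.
    by rewrite -[RHS]opprB subrX1 -mulNr; congr (_ * _); ring.
  have /andP[f1 f2] := f01 x Dx; have fx0 := lt_le_trans delta0 f1.
  apply: (@le_trans _ _ (f x)^-1); last by rewrite lef_pV2// posrE.
  rewrite -(ler_pM2l fx0) e divff ?gt_eqF// gerBl; exact: exprn_ge0.
- move=> x Dx; have /andP[h1 h2] := q1 x Dx.
  have : `|1 - f x| < 1.
    by rewrite ger0_norm// (le_lt_trans h2)// ltrBlDr ltrDl.
  move=> /(@cvg_geometric_series R 1).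
  rewrite (_ : 1 / _ = (f x)^-1); last by rewrite div1r; congr (_^-1); ring.
  rewrite /series/= => H; apply: cvg_trans H.
  apply: near_eq_cvg; apply: nearW => k; rewrite big_mkord; apply: eq_bigr => j _.
  by rewrite mul1r.
Qed.

(* Babylonian iteration [q <- q + (v - q ^ 2) / 2], which increases to [sqrt v]. *)
Lemma blc_sqrt f : blc f -> (forall x, D x -> 0 <= f x <= 1) ->
  blc (fun x => Num.sqrt (f x)).
Proof.
move=> bf f01.
pose q := fix q k (v : R) := if k is k'.+1 then q k' v + (v - q k' v ^+ 2) / 2 else 0.
(* With [t = sqrt v], one step multiplies the error [t - q] by [1 - (t + q) / 2], which lies between
   [0] and [1 - t / 2]. *)
have qP v k : 0 <= v <= 1 -> 0 <= q k v <= Num.sqrt v /\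
    Num.sqrt v - q k v <= Num.sqrt v * (1 - Num.sqrt v / 2) ^+ k.
  move=> /andP[v0 v1]; set t := Num.sqrt v.
  have t0 : 0 <= t by exact: sqrtr_ge0.
  have t1 : t <= 1 by rewrite -sqrtr1 ler_sqrt.
  have vt : v = t ^+ 2 by rewrite sqr_sqrtr.
  elim: k => [|k [/andP[q0 qt] IH]] /=; first by rewrite lexx t0 subr0 expr0 mulr1.
  have e : t - (q k v + (v - q k v ^+ 2) / 2) = (t - q k v) * (1 - (t + q k v) / 2).
    by move: (q k v) => w; rewrite vt; field.
  have a0 : 0 <= t - q k v by rewrite subr_ge0.
  have b0 : 0 <= 1 - (t + q k v) / 2 by lra.
  have b1 : 1 - (t + q k v) / 2 <= 1 - t / 2 by lra.
  split.
    apply/andP; split; last by rewrite -subr_ge0 e mulr_ge0.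
    by apply: addr_ge0 => //; apply: divr_ge0 => //; rewrite subr_ge0 [leRHS]vt ler_pXn2r ?nnegrE.
  rewrite e exprSr mulrA; apply: ler_pM => //.
apply: (@blc_lim (fun k x => q k (f x)) _ 1).
- elim => [|k IH] /=; first exact: blc_cst.
  apply: blc_add => //.
  rewrite (_ : (fun _ => _) = fun x => 2^-1 * (f x - q k (f x) ^+ 2)).
    by apply: blc_scale; apply: blc_sub => //; exact: blc_exp.
  by apply/funext => x; rewrite mulrC.
- move=> k x Dx; have [/andP[q0 q1] _] := qP (f x) k (f01 x Dx).
  rewrite ger0_norm//; apply: le_trans q1 _.
  by have /andP[v0 v1] := f01 x Dx; rewrite -sqrtr1 ler_sqrt.
- move=> x Dx; set t := Num.sqrt (f x).
  have /andP[v0 v1] := f01 x Dx.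
  have t0 : 0 <= t by exact: sqrtr_ge0.
  have t1 : t <= 1 by rewrite -sqrtr1 ler_sqrt.
  have cg : t * (1 - t / 2) ^+ k @[k --> \oo] --> (0 : R).
    have [->|tn0] := eqVneq t 0; first by rewrite (_ : (fun _ => _) = fun=> 0); [exact: cvg_cst|apply/funext => k; rewrite mul0r].
    apply: cvg_geometric; rewrite ger0_norm; last by lra.
    have : 0 < t by rewrite lt_neqAle eq_sym tn0.
    by lra.
  have cl : t - t * (1 - t / 2) ^+ k @[k --> \oo] --> t.
    by rewrite -[X in _ --> X]subr0; apply: cvgB => //; exact: cvg_cst.
  apply: (squeeze_cvgr _ cl (cvg_cst t)); apply: nearW => k.
  have [/andP[q0 q1] q2] := qP (f x) k (f01 x Dx).
  by rewrite q1 andbT lerBlDr addrC -lerBlDr.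
Qed.

Lemma blc_abs f (K : R) : blc f -> (forall x, D x -> `|f x| <= K) -> blc (fun x => `|f x|).
Proof.
move=> bf fK; pose L := `|K| + 1.
have L0 : 0 < L by rewrite ltr_wpDl.
have fL x : D x -> `|f x| <= L.
  by move=> Dx; rewrite (le_trans (fK x Dx))// (le_trans (ler_norm _))// lerDl.
rewrite (_ : (fun _ => _) = fun x => L * Num.sqrt ((L^-1 * f x) ^+ 2)).
  apply: blc_scale; apply: blc_sqrt; first by apply: blc_exp; exact: blc_scale.
  move=> x Dx; rewrite sqr_ge0/= -real_normK ?num_real// expr_le1//.
  by rewrite normrM normfV (gtr0_norm L0) ler_pdivrMl// mulr1 fL.
apply/funext => x; rewrite sqrtr_sqr normrM normfV (gtr0_norm L0) mulrA divff ?mul1r//.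
by rewrite gt_eqF.
Qed.

Lemma blc_min f g : blc f -> blc g -> blc (fun x => Num.min (f x) (g x)).
Proof.
move=> bf bg; have bd : blc (fun x => f x - g x) by exact: blc_sub.
have [_ [K dK]] := blc_bounded_measurable bd.
rewrite (_ : (fun _ => _) = fun x => 2^-1 * (f x + g x - `|f x - g x|)).
  by apply: blc_scale; apply: blc_sub; [exact: blc_add|exact: blc_abs dK].
by apply/funext => x; rewrite minr_absE mulrC.
Qed.

(** The indicator is the limit of [min 1 (k (f - s)^+)]. *)
Lemma blc_gt f (s : R) : blc f -> blc (fun x => (s < f x)%R%:R).
Proof.
move=> bf; pose g x := - Num.min (s - f x) 0.
have bg : blc g.
  rewrite (_ : g = fun x => (-1) * Num.min (s - f x) 0).
    by apply: blc_scale; apply: blc_min; [apply: blc_sub => //|]; exact: blc_cst.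
  by apply/funext => x; rewrite mulN1r.
have g0 x : 0 <= g x by rewrite /g oppr_ge0 ge_min lexx orbT.
apply: (@blc_lim (fun k x => Num.min 1 (k%:R * g x)) _ 1).
- by move=> k; apply: blc_min; [exact: blc_cst|exact: blc_scale].
- move=> k x Dx; rewrite ger0_norm ?ge_min ?lexx//.
  by rewrite le_min ler01 mulr_ge0.
move=> x Dx; have [sf|fs] := ltP s (f x); last first.
  have -> : g x = 0 by rewrite /g (min_idPr _) ?oppr0// subr_ge0.
  rewrite (_ : (fun _ => _) = fun=> 0); first exact: cvg_cst.
  by apply/funext => k; rewrite mulr0; apply/min_idPr; exact: ler01.
have gx : g x = f x - s by rewrite /g (min_idPl _) ?opprB// subr_le0 ltW.
have g1 : 0 < g x by rewrite gx subr_gt0.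
apply: cvg_near_cst; near=> k.
apply/min_idPl; rewrite -ler_pdivrMr// mul1r.
near: k; exact: nbhs_infty_ger.
Unshelve. all: end_near. Qed.

Lemma blc_int (h g : X -> R) : mu.-integrable D (EFin \o h) ->
  (forall s : seq I, \int[mu]_(x in D) (h x * \prod_(i <- s) u i x) = 0) ->
  blc g -> \int[mu]_(x in D) (h x * g x) = 0.
Proof.
move=> ih h0 bg.
(* A direct induction fails on products, because orthogonality of two factors says nothing about
   their product. Hence the stronger claim that multiplication by a member of [blc] preserves
   [P]. *)
pose P w := blc w /\ forall s : seq I, \int[mu]_(x in D) (h x * (w x * \prod_(i <- s) u i x)) = 0.
have bprod s : blc (fun x => \prod_(i <- s) u i x).
  elim: s => [|i s IH].
    by rewrite (_ : (fun _ => _) = fun=> 1); [exact: blc_cst|apply/funext => x; rewrite big_nil].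
  rewrite (_ : (fun _ => _) = fun x => u i x * \prod_(i <- s) u i x).
    by apply: blc_mul => //; exact: blc_gen.
  by apply/funext => x; rewrite big_cons.
have ib w : blc w -> mu.-integrable D (EFin \o (fun x => h x * w x)).
  by move=> /blc_bounded_measurable[mw [K wK]]; exact: integrable_mulb wK.
have closed v : blc v -> forall w, P w -> P (fun x => w x * v x).
  elim => [a|i|f g1 bf IHf bg1 IHg|f g1 bf IHf bg1 IHg|f_ f K bf IHf fK ff] w [bw Pw].
  - split; first by apply: blc_mul => //; exact: blc_cst.
    move=> s; rewrite (_ : (fun x => _) = fun x => a * (h x * (w x * \prod_(i <- s) u i x))).
      by rewrite RintegralZl ?Pw ?mulr0//; apply: ib; exact: blc_mul.
    by apply/funext => x; ring.
  - split; first by apply: blc_mul => //; exact: blc_gen.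
    move=> s; rewrite -[RHS](Pw (i :: s)); congr (Rintegral _ _ _).
    by apply/funext => x; rewrite big_cons; ring.
  - have [b1 P1] := IHf w (conj bw Pw); have [b2 P2] := IHg w (conj bw Pw); split.
      by apply: blc_mul => //; exact: blc_add.
    move=> s; rewrite (_ : (fun x => _) = fun x => h x * (w x * f x * \prod_(i <- s) u i x)
      + h x * (w x * g1 x * \prod_(i <- s) u i x)).
      by rewrite RintegralD// ?P1 ?P2 ?addr0//; apply: ib; exact: blc_mul.
    by apply/funext => x; ring.
  - have [b1 P1] := IHg _ (IHf w (conj bw Pw)).
    rewrite (_ : (fun x => w x * (f x * g1 x)) = (fun x => w x * f x * g1 x)) //.
    by apply/funext => x; ring.
  - have bf' : blc f by exact: blc_lim bf fK ff.
    split; first exact: blc_mul.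
    move=> s.
    have bws : blc (fun x => w x * \prod_(i <- s) u i x) by exact: blc_mul.
    have [_ [L wL]] := blc_bounded_measurable bws.
    have ih' : mu.-integrable D (EFin \o (fun x => K * L * `|h x|)).
      rewrite (_ : _ \o _ = fun x => ((K * L)%:E * `|(EFin \o h) x|)%E).
        by apply: integrableZl => //; exact: integrable_abse.
      by apply/funext => x.
    have m1 k : measurable_fun D (fun x => h x * (w x * f_ k x * \prod_(i <- s) u i x)).
      have bk : blc (fun x => w x * f_ k x * \prod_(i <- s) u i x).
        by apply: blc_mul => //; exact: blc_mul.
      by have /measurable_int/measurable_EFinP := ib _ bk.
    have m2 k x : D x -> `|h x * (w x * f_ k x * \prod_(i <- s) u i x)| <= K * L * `|h x|.
      move=> Dx; rewrite normrM [leRHS]mulrC ler_wpM2l//.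
      by rewrite mulrAC normrM mulrC ler_pM// ?fK ?wL.
    have m3 x : D x -> h x * (w x * f_ k x * \prod_(i <- s) u i x) @[k --> \oo] -->
        h x * (w x * f x * \prod_(i <- s) u i x).
      move=> Dx; apply: cvgM; first exact: cvg_cst.
      apply: cvgM; last exact: cvg_cst.
      by apply: cvgM; [exact: cvg_cst|exact: ff].
    have [_] := Rintegral_dominated m1 ih' m2 m3.
    rewrite (_ : (fun k => _) = fun=> 0).
      move=> H; apply/esym; apply: (cvg_unique _ (cvg_cst 0) H) => //.
    by apply/funext => k; have [_ ->] := IHf k w (conj bw Pw).
have P1 : P (fun=> 1).
  split; first exact: blc_cst.
  by move=> s; rewrite -[RHS](h0 s); congr (Rintegral _ _ _); apply/funext => x; rewrite mul1r.
have [_ /(_ [::]) H] := closed _ bg _ P1.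
rewrite -[RHS]H; congr (Rintegral _ _ _); apply/funext => x.
by rewrite big_nil mul1r mulr1.
Qed.

End bounded_limits.

Section blc_indic.
Context dd (X : measurableType dd) (R : realType).
Variables (mu : {measure set X -> \bar R}) (D : set X) (mD : measurable D).
Variables (I : Type) (u : I -> X -> R).
Hypothesis mu_u : forall i, measurable_fun D (u i).
Variable B : R.
Hypothesis u_le : forall i x, D x -> `|u i x| <= B.

(** A countable union is the bounded limit of [1 - \prod_j (1 - \1_(F j))]. The map [th] allows for
    preimages under one generator and, taken as the identity, for sets of points. *)
Lemma blc_sigma_algebra (T : Type) (th : X -> T) :
  sigma_algebra setT [set A : set T | blc D u (fun x => \1_A (th x))].
Proof.
split => /=.
- rewrite (_ : (fun _ => _) = fun=> 0); first exact: blc_cst.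
  by apply/funext => x; rewrite indic0.
- move=> A bA; rewrite (_ : (fun _ => _) = fun x => 1 - \1_A (th x)).
    by apply: (blc_sub (D := D)) => //; exact: blc_cst.
  apply/funext => x; rewrite !indicE in_setD in_setT /=.
  by case: (th x \in A) => /=; rewrite ?subrr ?subr0.
move=> F bF.
pose g k x : R := 1 - \prod_(j < k) (1 - \1_(F j) (th x)).
have g01 k x : 0 <= (\prod_(j < k) (1 - \1_(F j) (th x)) : R) <= 1.
  have h j : 0 <= (1 - \1_(F j) (th x) : R) <= 1.
    by rewrite !indicE; case: (_ \in _); rewrite /= ?subrr ?subr0 ?lexx ?ler01 ?andbT.
  apply/andP; split; first by apply: prodr_ge0 => j _; have /andP[] := h j.
  by apply: prodr_ile1 => j _; exact: h.
apply: (@blc_lim _ _ _ D I u g _ 1).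
- move=> k; apply: (blc_sub (D := D)); first exact: blc_cst.
  elim: k => [|k IH].
    by rewrite (_ : (fun _ => _) = fun=> 1); [exact: blc_cst|apply/funext => x; rewrite big_ord0].
  rewrite (_ : (fun _ => _) = fun x => \prod_(j < k) (1 - \1_(F j) (th x)) * (1 - \1_(F k) (th x))).
    by apply: blc_mul => //; apply: (blc_sub (D := D)); [exact: blc_cst|exact: bF].
  by apply/funext => x; rewrite big_ord_recr.
- move=> k x _; have /andP[h1 h2] := g01 k x.
  by rewrite ger0_norm ?subr_ge0// gerBl.
- move=> x _; have [[j _ Fjx]|nF] := pselect ((\bigcup_k F k) (th x)).
    rewrite indicE mem_set; last by exists j.
    apply: cvg_near_cst; exists j.+1 => // k /= jk.
    by rewrite /g (bigD1 (Ordinal jk))//= indicE mem_set// subrr mul0r subr0.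
  rewrite indicE memNset// (_ : (fun _ => _) = fun=> 0); first exact: cvg_cst.
  apply/funext => k; rewrite /g big1 ?subrr// => j _.
  by rewrite indicE memNset ?subr0// => Fj; apply: nF; exists j.
Qed.

Lemma blc_indic_preimage i (Y : set R) : measurable Y ->
  blc D u (fun x => \1_Y (u i x)).
Proof.
move=> mY; have {mY} : (@RGenOInfty.G R).-sigma.-measurable Y.
  by rewrite -RGenOInfty.measurableE.
move: Y; apply: (smallest_sub (blc_sigma_algebra (u i))) => _ [s ->] /=.
apply: (blc_eq mu_u u_le (f := fun x => (s < u i x)%R%:R)).
  exact: (blc_gt mu_u u_le s (blc_gen _ _ _)).
by move=> x _; rewrite indicE; rewrite mem_setE in_itv/= andbT.
Qed.
End blc_indic.

(** * Moments determine an integrable function on the sphere *)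

Section density.
Context {R : realType} {d : nat}.
Local Notation V := 'rV[R]_d.
Local Notation S := (@sphere R d).

(** Works for merely integrable [b]: indicators of Borel sets are obtained from the coordinates by
    bounded limits, so the integral of [b] over every measurable part of the sphere vanishes. *)
Lemma sphere_moments_eq0 (b : V -> R) : omega.-integrable S (EFin \o b) ->
  (forall s : seq 'I_d, \int[omega]_(x in S) (b x * \prod_(i <- s) x 0 i) = 0) ->
  {ae omega, forall x, S x -> b x = 0}.
Proof.
move=> ib b0; have mS := @measurable_sphere R d.
pose u (i : 'I_d) (x : V) : R := x 0 i.
have mu i : measurable_fun S (u i) by apply: measurable_funTS; exact: measurable_rV_coord.
have u1 i x : S x -> `|u i x| <= 1 by exact: sphere_coord_le1.
have bA (A : set V) : measurable A -> blc S u (fun x => \1_A x).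
  move: A; apply: (smallest_sub (blc_sigma_algebra S u id)) => A.
  rewrite -bigcup_seq => -[i _ [Y mY <-]] /=.
  rewrite (_ : (fun x => _) = fun x => \1_Y (u i x)).
    exact: (blc_indic_preimage mu u1).
  by apply/funext => x; rewrite setTI.
have := @integral_ae_eq _ _ R (@omega R d) S mS (cst 0%E) (EFin \o b) ib.
move=> /(_ (measurable_cst _)) H.
have : ae_eq omega S (EFin \o b) (cst 0%E).
  apply: H => E ES mE; rewrite integral0.
  have := congr1 EFin (blc_int mS mu u1 ib b0 (bA E mE)).
  have iE : omega.-integrable S (EFin \o (fun x => b x * \1_E x)).
    have [mI [K IK]] := blc_bounded_measurable mu u1 (bA E mE).
    exact: (integrable_mulb mS ib mI IK).
  rewrite /Rintegral fineK; last exact: integrable_fin_num.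
  move=> h0; have e : (\int[omega]_(x in E) (EFin \o b) x = 0)%E.
    rewrite -(setIidl ES) setIC integral_mkcondr -[RHS]h0; apply: eq_integral => x _.
    by rewrite epatch_indic /= EFinM.
  by rewrite e.
by apply: filterS => x h Sx; have := h Sx => -[].
Qed.

End density.

(** * Functions that are flat at the origin *)

Section bump.
Context {R : realType}.

(** The polynomial factor makes the class of flat exponentials closed under differentiation. *)
Definition flat (P : {poly R}) (t : R) : R :=
  if 0 < t then P.[t^-1] * expR (- t^-1) else 0.

(** Quadratic decay yields the derivative [0] at the origin. With [s = 1 / t >= 1], the polynomial
    grows at most like [s^m], whereas [expR s] is at least [s^(m + 2) / (m + 2)!]. *)
Lemma flat_quadratic (P : {poly R}) : exists2 C : R, 0 < C &
  forall t, `|t| <= 1 -> `|flat P t| <= C * t ^+ 2.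
Proof.
pose m := size P; pose A : R := \sum_(k < m) `|P`_k|.
exists ((A + 1) * (m.+2)`!%:R).
  by rewrite mulr_gt0 ?ltr0n ?fact_gt0// ltr_wpDl// sumr_ge0.
have C0 : 0 <= (A + 1) * (m.+2)`!%:R.
  by rewrite mulr_ge0// addr_ge0// sumr_ge0.
move=> t t1; rewrite /flat; case: ifPn => [t0|_]; last by rewrite normr0 mulr_ge0// sqr_ge0.
have {}t1 : t <= 1 by rewrite -(gtr0_norm t0).
set s := t^-1; have s1 : 1 <= s by rewrite -[leLHS]invr1 lef_pV2// posrE.
have s0 : 0 < s by rewrite invr_gt0.
rewrite normrM (gtr0_norm (expR_gt0 _)) expRN.
have Ps : `|P.[s]| <= (A + 1) * s ^+ m.
  rewrite horner_coef; apply: le_trans (ler_norm_sum _ _ _) _.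
  rewrite mulrDl mul1r; apply: ler_wpDr; first by rewrite exprn_ge0// ltW.
  rewrite mulr_suml; apply: ler_sum => k _; rewrite normrM ler_wpM2l//.
  by rewrite ger0_norm ?exprn_ge0 ?(ltW s0)// ler_weXn2l// ltnW.
have es : s ^+ m.+2 / (m.+2)`!%:R <= expR s.
  by apply: le_trans (expR_ge1Dxn m.+1 (ltW s0)); rewrite lerDr.
have e0 : 0 < s ^+ m.+2 / (m.+2)`!%:R by rewrite divr_gt0 ?exprn_gt0// ltr0n fact_gt0.
apply: (@le_trans _ _ ((A + 1) * s ^+ m * (s ^+ m.+2 / (m.+2)`!%:R)^-1)).
  by apply: ler_pM => //; rewrite lef_pV2// posrE ?expR_gt0.
rewrite le_eqVlt; apply/orP; left; apply/eqP.
have fn : (m.+2)`!%:R != 0 :> R by rewrite pnatr_eq0 -lt0n fact_gt0.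
rewrite /s !exprS; field.
rewrite fn (gt_eqF t0)/= expf_neq0 ?gt_eqF//.
Qed.

Lemma is_derive_flat (P : {poly R}) (t : R) :
  is_derive t 1 (flat P) (flat ('X^2 * P - 'X^2 * P^`()) t).
Proof.
have [t0|t0|->] := ltgtP t 0.
- have e : {near t, (cst 0 : R -> R) =1 flat P}.
    have : \forall s \near t, s < 0 by exact: lt_nbhsl.
    by apply: filterS => s s0; rewrite /flat ltNge (ltW s0).
  rewrite {2}/flat ltNge (ltW t0)/=.
  exact: (near_eq_is_derive e (is_derive_cst _ _ _)).
- have e : {near t, (fun s => P.[s^-1] * expR (- s^-1)) =1 flat P}.
    have : \forall s \near t, 0 < s by exact: lt_nbhsr.
    by apply: filterS => s s0; rewrite /flat s0.
  apply: (near_eq_is_derive e).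
  have tn0 : t != 0 by rewrite gt_eqF.
  have dV : is_derive t 1 (fun s : R => s^-1) (- 1 / t ^+ 2).
    exact: (@is_derive1V R (fun s : R => s) t 1 tn0 (is_derive_id _ _)).
  have dP := @is_derive1_comp R (fun s => P.[s]) (fun s => s^-1) t _ _ (is_derive_poly P t^-1) dV.
  have dE := @is_derive1_comp R expR (fun s => - s^-1) t _ _ (is_derive_expR _) (is_deriveN dV).
  apply: is_derive1_eq (is_derive1M dP dE) _.
  rewrite /flat t0 !hornerE /=; field.
  exact: tn0.
have [C C0 fC] := flat_quadratic P.
have f0 : flat P 0 = 0 by rewrite /flat ltxx.
rewrite {2}/flat ltxx.
have cv : h^-1 *: ((flat P \o shift 0) (h *: 1) - flat P 0) @[h --> 0^'] --> (0 : R).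
  apply/cvgr0Pnorm_le => eps eps0; near=> h.
  have h0 : h != 0 by near: h; exact: nbhs_dnbhs_neq.
  have h1 : `|h| <= 1 by near: h; exact: dnbhs0_le.
  have h2 : `|h| <= eps / C by near: h; apply: dnbhs0_le; rewrite divr_gt0.
  rewrite /= f0 subr0 addr0 /GRing.scale/= mulr1 normrM normfV.
  rewrite ler_pdivrMl ?normr_gt0//; apply: le_trans (fC _ h1) _.
  rewrite -real_normK ?num_real// expr2 mulrCA ler_wpM2l//.
  by rewrite mulrC -ler_pdivlMr.
split; first by apply/cvg_ex; exists 0.
exact/cvg_lim.
Unshelve. all: end_near. Qed.

End bump.

(** * The potential operator on the sphere *)

Section omega_setT.
Context {R : realType} {d : nat}.
Local Notation V := 'rV[R]_d.
Local Notation S := (@sphere R d).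

Lemma ae_sphere : {ae @omega R d, forall x, S x}.
Proof.
exists (~` S); split => //; last exact: omega_sphereC.
by apply: measurableC; exact: measurable_sphere.
Qed.

Lemma intST (F : V -> \bar R) : measurable_fun setT F ->
  (\int[omega]_(x in S) F x = \int[omega]_x F x)%E.
Proof.
move=> mF; rewrite integral_mkcond; apply: ae_eq_integral => //.
  apply/(measurable_restrictT _ (@measurable_sphere R d)).
  exact: measurable_funS mF.
by apply: filterS ae_sphere => x Sx _; rewrite patchE mem_set.
Qed.

Lemma RintST (F : V -> R) : measurable_fun setT F ->
  \int[omega]_(x in S) F x = \int[omega]_x F x.
Proof. by move=> mF; rewrite /Rintegral intST//; exact/measurable_EFinP. Qed.

Lemma integrableST (F : V -> \bar R) : measurable_fun setT F ->
  omega.-integrable S F <-> omega.-integrable setT F.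
Proof.
move=> mF; split; last first.
  by apply: integrableS => //; exact: measurable_sphere.
move=> /integrableP[_ foo]; apply/integrableP; split => //.
by rewrite -intST//; exact: measurableT_comp.
Qed.

Section swap.
Variables (f : V -> R) (K : V * V -> R) (M : R).
Hypothesis M0 : 0 <= M.
Hypothesis mf : measurable_fun setT f.
Hypothesis fi : omega.-integrable S (EFin \o f).
Hypothesis mK : measurable_fun setT K.
Hypothesis KM : forall y, S y -> f y != 0 -> (\int[omega]_(x in S) `|K (x, y)|%:E <= M%:E)%E.

Let mKx x : measurable_fun setT (fun y => K (x, y)).
Proof. exact: measurableT_comp. Qed.

Let mKy y : measurable_fun setT (fun x => K (x, y)).
Proof. exact: measurableT_comp. Qed.

Let mfK : measurable_fun setT (fun z : V * V => f z.2 * K z).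
Proof. by apply: measurable_funM => //; exact: measurableT_comp. Qed.

(** Tonelli with [x] as inner variable: the inner integral is at most [M |f y|] by [KM], and [f] is
    integrable. *)
Let ifK : ((@omega R d) \x (@omega R d))%E.-integrable setT (fun z : V * V => (f z.2 * K z)%:E).
Proof.
apply/integrable21ltyP; first exact/measurable_EFinP.
have mabs : measurable_fun setT (fun z : V * V => `|(f z.2 * K z)%:E|%E).
  by apply: measurableT_comp => //; exact/measurable_EFinP.
have mG := @measurable_fun_fubini_tonelli_G _ _ _ _ _ (@omega R d) _ mabs (fun z => abse_ge0 _).
rewrite /fubini_G/= in mG.
rewrite -intST//.
apply: (@le_lt_trans _ _ (\int[omega]_(y in S) (M%:E * `|(EFin \o f) y|))%E).
  apply: ge0_le_integral => //=.
  - exact: measurable_sphere.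
  - by move=> y Sy; apply: integral_ge0 => x _.
  - exact: measurable_funS mG.
  - by apply: emeasurable_funM => //; apply: measurableT_comp => //; apply: measurableT_comp => //; exact: measurable_funS mf.
  move=> y Sy; have [f0|fn0] := eqVneq (f y) 0.
    rewrite f0 normr0 mule0; under eq_integral do rewrite mul0r normr0.
    by rewrite integral0.
  rewrite -intST; last by do 2 apply: measurableT_comp => //; exact: (measurable_funM (measurable_cst (f y)) (mKy y)).
  rewrite (eq_integral (fun x => `|f y|%:E * `|K (x, y)|%:E)%E); last first.
    by move=> x _; rewrite /= normrM EFinM.
  rewrite ge0_integralZl//=.
  - by rewrite muleC lee_wpmul2r// KM.
  - exact: measurable_sphere.
  - by apply/measurable_EFinP; apply: measurableT_comp => //; exact: measurable_funS (mKy y).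
have := integrableZl (@measurable_sphere R d) M (integrable_abse fi).
move=> /integrableP[_]; apply: le_lt_trans; apply: ge0_le_integral => //=.
- exact: measurable_sphere.
- by move=> y _; rewrite mule_ge0// lee_fin.
- by apply: emeasurable_funM => //; apply/measurable_EFinP; apply: measurableT_comp => //; exact: measurable_funS mf.
- do 2 apply: measurableT_comp => //; apply: measurable_funM => //.
  by apply: measurableT_comp => //; exact: measurable_funS mf.
- by move=> y _; rewrite lee_fin ler_norm.
Qed.

Let im x : measurable_fun setT (fun y => f y * K (x, y)).
Proof. exact: measurable_funM. Qed.

Lemma swap_ae_integrable :
  {ae omega, forall x, omega.-integrable S (EFin \o (fun y => f y * K (x, y)))}.
Proof.
have := ae_integrable1 ifK; apply: filterS => x H.
by apply/integrableST => //; exact/measurable_EFinP.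
Qed.

Let E x : \int[omega]_(y in S) (f y * K (x, y)) =
  fine (fubini_F omega (fun z : V * V => (f z.2 * K z)%:E) x).
Proof. by rewrite RintST. Qed.

Lemma swap_measurable : measurable_fun setT (fun x => \int[omega]_(y in S) (f y * K (x, y))).
Proof.
rewrite (funext E); apply: measurableT_comp => //.
exact: measurable_fubini_F ifK.
Qed.

Lemma swap_integrable :
  omega.-integrable S (EFin \o (fun x => \int[omega]_(y in S) (f y * K (x, y)))).
Proof.
apply/integrableST; first by apply/measurable_EFinP; exact: swap_measurable.
have mF := measurable_fubini_F ifK.
have /integrableP[_ foo] := integrable_fubini_F ifK.
have mE : measurable_fun setT (EFin \o (fun x => \int[omega]_(y in S) (f y * K (x, y)))).
  by apply/measurable_EFinP; exact: swap_measurable.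
apply/integrableP; split => //; apply: le_lt_trans foo.
rewrite le_eqVlt; apply/orP; left; apply/eqP; apply: ae_eq_integral => //.
- exact: measurableT_comp.
- exact: measurableT_comp.
- have := ae_integrable1 ifK; apply: filterS => x H _.
  by rewrite [in LHS]/= E -abse_EFin fineK// /fubini_F; exact: integrable_fin_num.
Qed.

Lemma swap_Rintegral :
  \int[omega]_(x in S) (\int[omega]_(y in S) (f y * K (x, y))) =
  \int[omega]_(y in S) (f y * \int[omega]_(x in S) K (x, y)).
Proof.
have mG := measurable_fubini_G ifK.
have -> : \int[omega]_(y in S) (f y * \int[omega]_(x in S) K (x, y)) =
    \int[omega]_(y in S) \int[omega]_(x in S) (f y * K (x, y)).
  apply: eq_Rintegral => y /set_mem Sy.
  have [->|f0] := eqVneq (f y) 0.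
    rewrite mul0r (@eq_Rintegral _ _ _ _ _ (cst 0)) ?Rintegral_cst ?mul0r//.
      exact: measurable_sphere.
    by move=> x _; rewrite mul0r.
  rewrite RintegralZl//; first exact: measurable_sphere.
  apply/integrableP; split; first by apply/measurable_EFinP; exact: measurable_funS (mKy y).
  by apply: le_lt_trans (KM Sy f0) _; rewrite ltry.
rewrite RintST; last exact: swap_measurable.
have mG' : measurable_fun setT (fun y => \int[omega]_(x in S) (f y * K (x, y))).
  rewrite (_ : (fun _ => _) = fun y => fine (fubini_G omega (fun z : V * V => (f z.2 * K z)%:E) y)).
    exact: measurableT_comp.
  by apply/funext => y; rewrite RintST//; exact: measurable_funM.
rewrite (RintST mG') /Rintegral; congr fine.
transitivity (\int[omega]_x fubini_F omega (fun z : V * V => (f z.2 * K z)%:E) x)%E.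
  apply: ae_eq_integral => //.
  - by apply/measurable_EFinP; exact: swap_measurable.
  - exact: measurable_fubini_F ifK.
  - have := ae_integrable1 ifK; apply: filterS => x H _ /=.
    by rewrite -/(Rintegral _ _ _) E fineK// /fubini_F; exact: integrable_fin_num.
rewrite (Fubini ifK); apply: ae_eq_integral => //.
- exact/measurable_EFinP.
- have := ae_integrable2 ifK; apply: filterS => y H _ /=.
  rewrite -/(Rintegral _ _ _) RintST ?fineK//; last exact: measurable_funM.
  by rewrite /fubini_G; exact: integrable_fin_num.
Qed.

End swap.
End omega_setT.

Section potential.
Context {R : realType} {d : nat} (d_ge3 : (3 <= d)%N).
Local Notation V := 'rV[R]_d.
Local Notation S := (@sphere R d).
Let c : R := (d%:R - 2) / 2.
Let W : R := @sphere_area R d.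

Definition kern (x y : V) : R := (enorm (x - y) ^+ (d - 2))^-1.

(* A multiple of [layerS], normalized so as to fix the constants on the sphere. *)
Definition pot (f : V -> R) (x : V) : R := W^-1 * \int[omega]_(y in S) (f y * kern x y).

Let mS := @measurable_sphere R d.

Let c0 : 0 < c. Proof. exact: c_gt0. Qed.

Let d2E : (d - 2)%:R = 2 * c :> R.
Proof. by rewrite natrB ?(ltnW d_ge3)// mulrC divfK. Qed.

Lemma sphere_area_gt0 : 0 < W.
Proof.
have d0 : (0 < d)%N by exact: leq_trans d_ge3.
pose e : V := delta_mx 0 (Ordinal d0).
have Se : S e.
  apply/sphereP; rewrite dot_delta; apply/eqP; by rewrite mxE !eqxx.
apply: fine_gt0; apply/andP; split; last exact: omega_sphere_lty.
rewrite -(setIT S); apply: omega_gt0; first exact: openT.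
by exists e.
Qed.

Let Wn0 : W != 0. Proof. by rewrite gt_eqF// sphere_area_gt0. Qed.

Lemma kern_ge0 x y : 0 <= kern x y.
Proof. by rewrite invr_ge0 exprn_ge0// enorm_ge0. Qed.

Lemma kern_sym x y : kern x y = kern y x.
Proof.
rewrite /kern /enorm; congr ((Num.sqrt _ ^+ _)^-1).
by rewrite -opprB dotNl dotNr opprK.
Qed.

Lemma kernE x y : S x -> S y -> kern x y = zonal c 2 2 x y.
Proof.
move=> Sx Sy; rewrite /zonal (dotC y) -(dot_sphereB Sx Sy) -sqr_enorm /kern.
by rewrite -(powR_mulrn _ (enorm_ge0 _)) -(powR_mulrn _ (enorm_ge0 _)) powRN -powRrM d2E.
Qed.

Lemma measurable_fun_inv dd (T : measurableType dd) (D : set T) (f : T -> R) :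
  measurable_fun D f -> (forall t, 0 <= f t) -> measurable_fun D (fun t => (f t)^-1).
Proof.
move=> mf f0; rewrite (_ : (fun _ => _) = fun t => f t `^ (-1)).
  exact: (measurableT_comp (f := fun t : R => t `^ (-1)) (measurable_powR _) mf).
by apply/funext => t; rewrite powR_inv1.
Qed.

Lemma measurable_kern : measurable_fun setT (fun z : V * V => kern z.1 z.2).
Proof.
apply: measurable_fun_inv; last by move=> z; rewrite exprn_ge0// enorm_ge0.
apply: measurable_funX; apply: measurableT_comp; first exact: measurable_enorm.
apply: measurable_fun_rV => i.
rewrite (_ : (fun _ => _) = fun z : V * V => z.1 0 i - z.2 0 i); last first.
  by apply/funext => z; rewrite !mxE.
by apply: measurable_funB; [apply: (measurableT_comp (f := fun v : V => v 0 i))|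
  apply: (measurableT_comp (f := fun v : V => v 0 i))] => //; exact: measurable_rV_coord.
Qed.

Lemma int_kern y : S y -> (\int[omega]_(x in S) (kern x y)%:E = W%:E)%E.
Proof.
move=> Sy.
rewrite (eq_integral (EFin \o zonal c 2 2 y)); last first.
  by move=> x /set_mem Sx; rewrite /= kern_sym kernE.
have iz := kernel_integrable d_ge3 Sy.
have := kernel_eigen d_ge3 Sy (eigenfun_cst 1).
rewrite add0r mul1r => /(mulfI (lt0r_neq0 c0)) H.
rewrite -/W in H; rewrite -[in RHS]H /Rintegral fineK.
  by apply: eq_integral => x _; rewrite mul1r.
rewrite (eq_integral (EFin \o zonal c 2 2 y)); last by move=> x _; rewrite mul1r.
exact: integrable_fin_num.
Qed.

Lemma ae_eq_RintegralS (f g : V -> R) : measurable_fun setT f -> measurable_fun setT g ->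
  {ae omega, forall x, S x -> f x = g x} ->
  \int[omega]_(x in S) f x = \int[omega]_(x in S) g x.
Proof.
move=> mf mg fg; rewrite /Rintegral; congr fine; apply: ae_eq_integral => //.
- by apply/measurable_EFinP; exact: measurable_funS mf.
- by apply/measurable_EFinP; exact: measurable_funS mg.
- by apply: filterS fg => x h Sx /=; rewrite h.
Qed.

Lemma layerSE f x : layerS f x = - (d%:R - 2)^-1 * pot f x.
Proof.
by rewrite /layerS /pot /kern -/W; set I := Rintegral _ _ _; rewrite invfM; ring.
Qed.

Lemma pot_eigen l e x : S x -> eigenfun l e -> (l%:R + c) * pot e x = c * e x.
Proof.
move=> Sx ee; have H := kernel_eigen d_ge3 Sx ee.
rewrite /pot (@eq_Rintegral _ _ _ _ _ (fun y => e y * zonal c 2 2 x y)); last first.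
  by move=> y /set_mem Sy; rewrite kernE.
rewrite mulrCA H -/c -/W; field; exact: Wn0.
Qed.

Lemma pot_cst a x : S x -> pot (fun=> a) x = a.
Proof.
move=> Sx; have := pot_eigen Sx (eigenfun_cst a).
by rewrite add0r => /(mulfI (lt0r_neq0 c0)).
Qed.

Lemma kern_integrable x : S x -> omega.-integrable S (EFin \o kern x).
Proof.
move=> Sx; apply/integrableP; split.
  apply/measurable_EFinP; apply: measurable_funTS.
  exact: (measurableT_comp measurable_kern (measurable_pair1 x)).
rewrite (eq_integral (fun y => (kern y x)%:E)); last first.
  by move=> y _; rewrite /= ger0_norm ?kern_ge0// kern_sym.
by rewrite int_kern// ltry.
Qed.

Lemma mul_kern_integrable x (g : V -> R) M : measurable_fun setT g ->
  (forall y, S y -> `|g y| <= M) -> S x -> omega.-integrable S (EFin \o (fun y => g y * kern x y)).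
Proof.
move=> mg gM Sx; rewrite (_ : (fun y => _) = fun y => kern x y * g y).
  apply: integrable_mulb gM => //; [exact: kern_integrable|exact: measurable_funS mg].
by apply/funext => y; rewrite mulrC.
Qed.

Lemma pot_bounded (g : V -> R) M x : measurable_fun setT g ->
  (forall y, S y -> `|g y| <= M) -> S x -> `|pot g x| <= M.
Proof.
move=> mg gM Sx.
have k1 : \int[omega]_(y in S) kern x y = W.
  rewrite /Rintegral (eq_integral (fun y => (kern y x)%:E)) ?int_kern//.
  by move=> y _; rewrite kern_sym.
have W0 := sphere_area_gt0.
have ik := kern_integrable Sx; have igk := mul_kern_integrable mg gM Sx.
rewrite normrM normfV (gtr0_norm W0) ler_pdivrMl// mulrC -[X in M * X]k1.
rewrite -RintegralZl//.
apply: le_trans (le_normr_Rintegral mS igk) _; apply: le_Rintegral => //.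
- exact: (integrable_norm igk).
- rewrite (_ : _ \o _ = fun y => (M%:E * (EFin \o kern x) y)%E); last exact/funext.
  exact: integrableZl.
by move=> y Sy; rewrite normrM (ger0_norm (kern_ge0 _ _)) ler_wpM2r ?kern_ge0// gM.
Qed.

Section integrable_density.
Variable f : V -> R.
Hypothesis mf : measurable_fun setT f.
Hypothesis fi : omega.-integrable S (EFin \o f).

Let KM y : S y -> f y != 0 -> (\int[omega]_(x in S) `|kern (x, y).1 (x, y).2|%:E <= W%:E)%E.
Proof.
move=> Sy _ /=; rewrite -(int_kern Sy) le_eqVlt; apply/orP; left; apply/eqP.
by apply: eq_integral => x _; rewrite ger0_norm ?kern_ge0.
Qed.

Let W0 := ltW sphere_area_gt0.

Lemma pot_ae_integrable :
  {ae omega, forall x, omega.-integrable S (EFin \o (fun y => f y * kern x y))}.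
Proof. exact: (swap_ae_integrable W0 mf fi measurable_kern KM). Qed.

Lemma measurable_pot : measurable_fun setT (pot f).
Proof.
by apply: measurable_funM => //; exact: (swap_measurable W0 mf fi measurable_kern KM).
Qed.

Lemma pot_integrable : omega.-integrable S (EFin \o pot f).
Proof.
rewrite (_ : _ \o _ = fun x => ((W^-1)%:E * (EFin \o (fun x => (\int[omega]_(y in S) (f y * kern x y))%R)) x)%E); last exact/funext.
by apply: integrableZl => //; exact: (swap_integrable W0 mf fi measurable_kern KM).
Qed.

(** Fubini for the kernel [K], which absorbs [g]: boundedness of [g] gives the uniform bound on the
    integrals of [K] in [x], so [f] need only be integrable. *)
Lemma pot_sym (g : V -> R) M : measurable_fun setT g -> (forall y, S y -> `|g y| <= M) ->
  \int[omega]_(x in S) (pot f x * g x) = \int[omega]_(x in S) (f x * pot g x).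
Proof.
move=> mg gM; pose K (z : V * V) := kern z.1 z.2 * (W^-1 * g z.1).
have mK : measurable_fun setT K.
  apply: measurable_funM; first exact: measurable_kern.
  by apply: measurable_funM => //; exact: measurableT_comp.
have [M0 M0_ge0 gM'] : exists2 M', 0 <= M' & forall y, S y -> `|W^-1 * g y| <= M'.
  exists (W^-1 * `|M|); first by rewrite mulr_ge0// invr_ge0.
  move=> y Sy; rewrite normrM ger0_norm ?invr_ge0// ler_wpM2l ?invr_ge0//.
  by rewrite (le_trans (gM _ Sy))// ler_norm.
have KM' y : S y -> f y != 0 -> (\int[omega]_(x in S) `|K (x, y)|%:E <= (M0 * W)%:E)%E.
  move=> Sy _.
  have mk : measurable_fun S (fun x => kern x y).
    apply: measurable_funTS; exact: (measurableT_comp measurable_kern (measurable_pair2 y)).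
  apply: (@le_trans _ _ (\int[omega]_(x in S) (M0%:E * (kern x y)%:E))%E).
    apply: ge0_le_integral => //.
    - apply/measurable_EFinP; apply: measurable_funTS; apply: measurableT_comp => //.
      exact: (measurableT_comp mK (measurable_pair2 y)).
    - by apply: emeasurable_funM => //; exact/measurable_EFinP.
    - by move=> x Sx; rewrite -EFinM lee_fin /K normrM (ger0_norm (kern_ge0 _ _)) [leLHS]mulrC; apply: ler_wpM2r; [exact: kern_ge0|exact: gM'].
  rewrite ge0_integralZl//; last by move=> x _; rewrite lee_fin kern_ge0.
    by rewrite int_kern.
  exact/measurable_EFinP.
have EK x : S x -> omega.-integrable S (EFin \o (fun y => f y * kern x y)) ->
    \int[omega]_(y in S) (f y * K (x, y)) = pot f x * g x.
  move=> Sx ix; rewrite /pot mulrAC -RintegralZl//.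
  by apply: eq_Rintegral => y _; rewrite /K/=; ring.
have H := swap_Rintegral (mulr_ge0 M0_ge0 W0) mf fi mK KM'.
have EK' y : S y -> \int[omega]_(x in S) K (x, y) = pot g y.
  move=> Sy; rewrite /pot -RintegralZl//; last exact: mul_kern_integrable gM Sy.
  by apply: eq_Rintegral => x _; rewrite /K/= kern_sym; ring.
rewrite [RHS](@eq_Rintegral _ _ _ _ _ (fun y => f y * \int[omega]_(x in S) K (x, y))); last first.
  by move=> y /set_mem Sy; rewrite EK'.
rewrite -H; apply: ae_eq_RintegralS.
- by apply: measurable_funM => //; exact: measurable_pot.
- exact: (swap_measurable (mulr_ge0 M0_ge0 W0) mf fi mK KM').
- by apply: filterS pot_ae_integrable => x ix Sx; rewrite EK.
Qed.

End integrable_density.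

Lemma pot_lin (a b : R) (f g : V -> R) :
  measurable_fun setT f -> omega.-integrable S (EFin \o f) ->
  measurable_fun setT g -> omega.-integrable S (EFin \o g) ->
  {ae omega, forall x, S x -> pot (fun y => a * f y + b * g y) x = a * pot f x + b * pot g x}.
Proof.
move=> mf fi mg gi.
have := pot_ae_integrable mf fi; have := pot_ae_integrable mg gi.
apply: filterS2 => x ig if' Sx; rewrite /pot.
have iZ (e : R) (h : V -> R) : omega.-integrable S (EFin \o h) ->
    omega.-integrable S (EFin \o (fun y => e * h y)).
  move=> ih; rewrite (_ : _ \o _ = fun y => (e%:E * (EFin \o h) y)%E); last exact/funext.
  exact: integrableZl.
rewrite (@eq_Rintegral _ _ _ _ _ (fun y => a * (f y * kern x y) + b * (g y * kern x y))); last first.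
  by move=> y _; ring.
by rewrite RintegralD//; [rewrite !RintegralZl//; ring|exact: iZ..].
Qed.

(** The numerator cancels two powers of the distance, so the principal value is an ordinary
    integral: wherever [f y * kern x y] is integrable in [y], the truncated integrands are dominated
    by [|g|]. *)
Lemma layerKE (f : V -> R) : measurable_fun setT f -> omega.-integrable S (EFin \o f) ->
  {ae omega, forall x, S x -> layerK f x = 2^-1 * pot f x}.
Proof.
move=> mf fi; have := pot_ae_integrable mf fi; apply: filterS => x ix Sx.
pose g y := - 2^-1 * (f y * kern x y).
have mk : measurable_fun setT (fun y => kern x y).
  exact: (measurableT_comp measurable_kern (measurable_pair1 x)).
have mg : measurable_fun setT g.
  by apply: measurable_funM => //; exact: measurable_funM.
have ig : omega.-integrable S (EFin \o g).
  rewrite (_ : _ \o _ = fun y => ((- 2^-1)%:E * (EFin \o (fun y => (f y * kern x y)%R)) y)%E); last exact/funext.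
  exact: integrableZl.
have men : measurable_fun setT (fun y : V => enorm (x - y)).
  apply: measurableT_comp; first exact: measurable_enorm.
  apply: measurable_fun_rV => i.
  rewrite (_ : (fun _ => _) = fun y : V => x 0 i - y 0 i).
    by apply: measurable_funB => //; exact: measurable_rV_coord.
  by apply/funext => y; rewrite !mxE.
have E (e : R) : 0 < e -> \int[omega]_(y in [set y | S y /\ e < enorm (x - y)])
      (dot (normal y) (x - y) / enorm (x - y) ^+ d * f y) =
    \int[omega]_(y in S) (if e < enorm (x - y) then g y else 0).
  move=> e0; rewrite (_ : [set y | _] = S `&` [set y | e < enorm (x - y)]); last by apply/seteqP; split => y [].
  rewrite Rintegral_mkcondr; apply: eq_Rintegral => y /set_mem Sy.
  rewrite patchE; case: ifPn => [/set_mem/= ey|/negP ey].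
    rewrite ey /g /kern.
    have r0 : 0 < enorm (x - y) by exact: lt_trans e0 ey.
    have -> : dot (normal y) (x - y) = - 2^-1 * enorm (x - y) ^+ 2.
      rewrite sqr_enorm dot_sphereB// /normal dotBr (sphereP y).1// (dotC y).
      by field.
    have -> : enorm (x - y) ^+ d = enorm (x - y) ^+ (d - 2) * enorm (x - y) ^+ 2.
      by rewrite -exprD subnK// ltnW.
    by field; rewrite expf_neq0 ?gt_eqF.
  by case: ifPn => // H; exfalso; apply: ey; rewrite inE.
rewrite /layerK; apply: cvg_lim => //.
rewrite /pot mulrCA.
rewrite (_ : _ * (2^-1 * _) = - W^-1 * \int[omega]_(y in S) g y); last first.
  by rewrite /g RintegralZl//; ring.
apply: cvgM; first exact: cvg_cst.
apply/cvg_at_rightP => u [u0 cu].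
rewrite (_ : (fun k => _) = fun k => \int[omega]_(y in S) (if u k < enorm (x - y) then g y else 0)); last first.
  by apply/funext => k; rewrite E.
pose gk k y := if u k < enorm (x - y) then g y else 0.
have m1 k : measurable_fun S (gk k).
  apply: measurable_fun_if => //.
  + by apply: measurable_fun_ltr => //; exact: measurable_funS men.
  + by apply: measurable_funTS.
have m2 k y : S y -> `|gk k y| <= `|g y|.
  by move=> Sy; rewrite /gk; case: ifP => // _; rewrite normr0.
have m3 y : S y -> gk k y @[k --> \oo] --> g y; last first.
  by have [_] := Rintegral_dominated mS m1 (integrable_norm ig) m2 m3.
(* On the diagonal [kern] has the default value [0^-1 = 0], because [d - 2 > 0]. *)
move=> Sy; have [xy0|xyn0] := eqVneq (enorm (x - y)) 0.
  have g0 : g y = 0.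
    rewrite /g /kern xy0 expr0n subn_eq0 leqNgt d_ge3 /= invr0; ring.
  by rewrite g0 (_ : (fun k => _) = fun=> 0); [exact: cvg_cst|apply/funext => k; rewrite /gk g0 if_same].
have xy_gt0 : 0 < enorm (x - y) by rewrite lt_neqAle eq_sym xyn0 enorm_ge0.
apply: cvg_near_cst.
have : \forall k \near \oo, u k < enorm (x - y) by exact: (cvgr_lt 0).
by apply: filterS => k; rewrite /gk => ->.
Qed.

End potential.

(** * Unique continuation *)

Section local_green.
Context {R : realType} {d : nat}.
Local Notation V := 'rV[R]_d.
Local Notation S := (@sphere R d).

Lemma smooth_on_glue (K U : set V) (f : V -> R) : closed K -> smooth_on U f ->
  (forall x, ~ K x -> f x = 0) -> smooth_on (U `|` ~` K) f.
Proof.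
move=> cK sf f0; apply: smooth_onU => //.
have oK : open (~` K) by exact: closed_openC.
apply: (smooth_on_ext oK (f := cst 0)); first by move=> x /f0.
exact: smooth_on_cst.
Qed.

Lemma near_out (K : set V) (f : V -> R) x : closed K -> (forall x, ~ K x -> f x = 0) ->
  ~ K x -> \forall z \near x, f z = cst 0 z.
Proof.
move=> cK f0 Kx; have oK : open (~` K) by exact: closed_openC.
have : \forall z \near x, (~` K) z by exact: open_nbhs_nbhs.
by apply: filterS => z /f0.
Qed.

Lemma sg_out (K : set V) (f : V -> R) i x : closed K -> (forall x, ~ K x -> f x = 0) ->
  ~ K x -> sg i f x = 0.
Proof.
by move=> cK f0 Kx; rewrite (sg_near i (near_out cK f0 Kx)) sg_cst.
Qed.

Lemma lap_out (K : set V) (f : V -> R) x : closed K -> (forall x, ~ K x -> f x = 0) ->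
  ~ K x -> lap f x = 0.
Proof.
move=> cK f0 Kx; apply: big1 => i _; apply: (sg_out i cK) => // z; exact: sg_out.
Qed.

Local Opaque sg.

(** [green_sym] does not apply, since [z] may be singular off [U]. But [z grad f - f grad z]
    vanishes off [K], so it is smooth on [U] together with the complement of [K], an open set
    containing the sphere; its divergence is the difference of the two integrands up to sign. *)
Lemma green_local (K U : set V) (f z : V -> R) : open U -> closed K -> K `&` S `<=` U ->
  smooth_on setT f -> (forall x, ~ K x -> f x = 0) -> smooth_on U z ->
  \int[omega]_(x in S) (lap f x * z x) = \int[omega]_(x in S) (f x * lap z x).
Proof.
move=> oU cK KU sf f0 sz.
have sfU : smooth_on U f by exact: smooth_on_subset sf.
pose O := U `|` ~` K.
have oO : open O by apply: openU => //; exact: closed_openC.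
have SO : S `<=` O.
  by move=> x Sx; have [Kx|] := pselect (K x); [left; exact: KU|right].
pose w i x := z x * sg i f x - f x * sg i z x.
have w0 i x : ~ K x -> w i x = 0.
  by move=> Kx; rewrite /w (sg_out i cK f0 Kx) f0// mulr0 mul0r subr0.
have sw i : smooth_on O (w i).
  apply: smooth_on_glue => //; last by move=> x; exact: w0.
  by apply: smooth_onB => //; apply: smooth_onM => //; exact: smooth_on_sg.
have cS := contS_smooth SO.
have I0 : \int[omega]_(x in S) (\sum_i sg i (w i) x) = 0.
  rewrite (@intS_sum R d _ _ (fun i x => sg i (w i) x)); last first.
    by move=> i; apply: cS; exact: smooth_on_sg.
  rewrite (eq_bigr (fun i => (d%:R - 1) * \int[omega]_(x in S) (x 0 i * w i x))); last first.
    by move=> i _; rewrite (intS_sg oO SO).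
  rewrite -mulr_sumr -(@intS_sum R d _ _ (fun i x => x 0 i * w i x)); last first.
    by move=> i; apply: contSM; [exact: contS_coord|exact: cS].
  rewrite (@eq_Rintegral _ _ _ _ _ (cst 0)).
    by rewrite Rintegral_cst ?mul0r ?mulr0//; exact: measurable_sphere.
  move=> x /set_mem Sx /=.
  rewrite (eq_bigr (fun i => z x * (x 0 i * sg i f x) - f x * (x 0 i * sg i z x))); last first.
    by move=> i _; rewrite /w mulrBr; congr (_ - _); exact: mulrCA.
  have e0 (h : V -> R) (a : R) : \sum_i (a * (x 0 i * sg i h x)) = 0.
    by rewrite -mulr_sumr sum_sg_normal// mulr0.
  transitivity (\sum_i z x * (x 0 i * sg i f x) - \sum_i f x * (x 0 i * sg i z x)).
    exact: sumrB.
  by rewrite [X in X - _](e0 f (z x)) [X in _ - X](e0 z (f x)) subrr.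
have s1 : smooth_on O (fun x => lap f x * z x).
  apply: smooth_on_glue => //; last by move=> x Kx; rewrite (lap_out cK f0 Kx) mul0r.
  by apply: smooth_onM => //; exact: smooth_on_lap.
have s2 : smooth_on O (fun x => f x * lap z x).
  apply: smooth_on_glue => //; last by move=> x Kx; rewrite f0// mul0r.
  by apply: smooth_onM => //; exact: smooth_on_lap.
apply/eqP; rewrite -subr_eq0 -intSN; last exact: cS.
rewrite -intSD; [|exact: cS|by apply: contSN; exact: cS].
rewrite -[X in _ == X]I0; apply/eqP; apply: eq_Rintegral => x /set_mem Sx.
have [Kx|Kx] := pselect (K x); last first.
  rewrite (lap_out cK f0 Kx) f0// !mul0r subr0 big1// => i _.
  by apply: (sg_out i cK) => // y; exact: w0.
have Ux : U x by exact: KU.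
rewrite /lap mulr_suml mulr_sumr -sumrB; apply: eq_bigr => i _.
have df : differentiable f x by exact: smooth_on_diff sf _.
have dz : differentiable z x by exact: smooth_on_diff sz _.
have dsf : differentiable (sg i f) x.
  exact: (smooth_on_diff (smooth_on_sg i (@openT V) sf)).
have dsz : differentiable (sg i z) x by exact: (smooth_on_diff (smooth_on_sg i oU sz)).
rewrite (_ : w i = fun x => z x * sg i f x + (-1) * (f x * sg i z x)); last first.
  by apply/funext => y; rewrite mulN1r.
have d1 : differentiable (fun y => z y * sg i f y) x := differentiableM dz dsf.
have d2 : differentiable (fun y => f y * sg i z y) x := differentiableM df dsz.
have d3 : differentiable (fun y => -1 * (f y * sg i z y)) x := differentiableM (differentiable_cst _ _) d2.
rewrite [RHS](sgD i d1 d3) [X in _ = _ + X](sgZ i (-1) d2) [X in _ = X + _](sgM i dz dsf).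
rewrite [X in _ = _ + _ * X](sgM i df dsz).
have alg (p q r s t u : R) : q * t - u * r = p * s + t * q + -1 * (s * p + u * r) by ring.
exact: alg.
Qed.

Local Transparent sg.

(** [lap_zonal] in terms of [s = |x - y|^2], where [t = 1 - s / 2] and [1 - t^2 = s - s^2 / 4]. *)
Lemma lap_zonal2 (a : R) x y : S x -> S y -> zonal_dom 2 2 y x ->
  lap (zonal a 2 2 y) x = 2 * a * (2 * a + 3 - d%:R) * zonal (a + 1) 2 2 y x
    + a * (d%:R - 2 - a) * zonal a 2 2 y x.
Proof.
move=> Sx Sy; rewrite /zonal_dom/= => s0; rewrite lap_zonal// /zonal.
set s := 2 - 2 * dot x y in s0 *.
have -> : dot x y = 1 - s / 2 by rewrite /s; field.
have D u v : s `^ (u + v) = s `^ u * s `^ v by rewrite powRD//; apply/implyP => _; rewrite gt_eqF.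
have e1 : s `^ (- (a + 1)) = s * s `^ (- (a + 2)).
  by rewrite -[X in _ = X * _](powRr1 (ltW s0)) -D; congr (s `^ _); ring.
have e2 : s `^ (- a) = s ^+ 2 * s `^ (- (a + 2)).
  by rewrite -(powR_mulrn _ (ltW s0)) -D; congr (s `^ _); ring.
by rewrite e1 e2; field.
Qed.

End local_green.

Section cutoff.
Context {R : realType} {d : nat}.
Local Notation V := 'rV[R]_d.

(** A smooth bump, positive exactly on the open Euclidean ball about [a] whose squared radius is
    [r]. *)
Definition cutoff (a : V) (r : R) (x : V) : R := flat 1 (r - dot (x - a) (x - a)).

Lemma smooth_dist2 a r : smooth_on setT (fun x : V => r - dot (x - a) (x - a)).
Proof.
rewrite (_ : (fun _ => _) = fun x : V => r - (dot x x - 2 * dot x a + dot a a)); last first.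
  by apply/funext => x; rewrite dotBl !dotBr (dotC a x); ring.
apply: smooth_onB; [exact: openT|exact: smooth_on_cst|].
apply: smooth_onD; [exact: openT| |exact: smooth_on_cst].
apply: smooth_onB; [exact: openT| |].
  by apply: smooth_on_sum => [|i]; [exact: openT|apply: smooth_onM => //; [exact: openT|exact: smooth_on_coord..]].
by apply: smooth_onZ; [exact: openT|apply: smooth_on_dot; exact: openT].
Qed.

Lemma smooth_cutoff a r : smooth_on setT (cutoff a r).
Proof.
apply: (@smooth_on_comp _ _ [set u | exists P : {poly R}, u = flat P] setT setT _
  (@openT V) (smooth_dist2 a r) (fun x _ => I) _ (flat 1)); last by exists 1.
move=> _ [P ->]; exists (flat ('X^2 * P - 'X^2 * P^`())); first by eexists.
by move=> t _; exact: is_derive_flat.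
Qed.

Lemma cutoff_eq0 a r x : r <= dot (x - a) (x - a) -> cutoff a r x = 0.
Proof. by move=> h; rewrite /cutoff /flat ltNge subr_le0 h. Qed.

Lemma cutoff_gt0 a r x : dot (x - a) (x - a) < r -> 0 < cutoff a r x.
Proof.
by move=> h; rewrite /cutoff /flat subr_gt0 h hornerC mul1r expR_gt0.
Qed.

End cutoff.

(** * Moments of an integrable function in a varying direction *)

Section moments.
Context {R : realType} {d : nat}.
Local Notation V := 'rV[R]_d.
Local Notation S := (@sphere R d).
Variable b : V -> R.
Hypothesis ib : omega.-integrable S (EFin \o b).

Let mS := @measurable_sphere R d.

Lemma integrable_mul_contS w : contS w -> omega.-integrable S (EFin \o (fun y => b y * w y)).
Proof.
move=> cw; have [K wK] := contS_bounded cw.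
by apply: integrable_mulb wK => //; exact: contS_measurable.
Qed.

Lemma RintS_sum (w : nat -> V -> R) n : (forall k, contS (w k)) ->
  \int[omega]_(y in S) (b y * \sum_(k < n) w k y) =
  \sum_(k < n) \int[omega]_(y in S) (b y * w k y).
Proof.
move=> cw; elim: n => [|n IH].
  rewrite big_ord0 (@eq_Rintegral _ _ _ _ _ (cst 0)) ?Rintegral_cst ?mul0r//.
  by move=> y _; rewrite big_ord0 mulr0.
rewrite big_ord_recr /= -IH -RintegralD//; last exact: integrable_mul_contS.
  by apply: eq_Rintegral => y _; rewrite big_ord_recr /= mulrDr.
by apply: integrable_mul_contS; apply: contS_sum.
Qed.

Lemma contS_dot z : contS (fun y : V => dot y z).
Proof. by move=> y _; exact: continuous_dot. Qed.

Lemma contS_exp w n : contS w -> contS (fun y : V => w y ^+ n).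
Proof.
move=> cw; elim: n => [|n IH]; first exact: contS_cst.
rewrite (_ : (fun y => _) = fun y => w y * w y ^+ n); first exact: contSM.
by apply/funext => y; rewrite exprS.
Qed.

Lemma contS_prod (s : seq 'I_d) : contS (fun y : V => \prod_(i <- s) y 0 i).
Proof.
elim: s => [|i s IH].
  by rewrite (_ : (fun y => _) = fun=> 1); [exact: contS_cst|apply/funext => y; rewrite big_nil].
rewrite (_ : (fun y => _) = fun y : V => y 0 i * \prod_(i <- s) y 0 i).
  by apply: contSM => //; exact: contS_coord.
by apply/funext => y; rewrite big_cons.
Qed.

Lemma poly_near0_eq0 (p : {poly R}) : (\forall t \near (0 : R), p.[t] = 0) -> p = 0.
Proof.
move=> /nbhs_ballP[e /= e0 pe].
pose rs := [seq e / k.+2%:R | k <- iota 0 (size p)].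
apply: (@roots_geq_poly_eq0 _ p rs).
- apply/allP => _ /mapP[k _ ->]; apply/rootP; apply: pe.
  rewrite /ball /= sub0r normrN ger0_norm ?divr_ge0 ?ltW//.
  by rewrite ltr_pdivrMr// ltr_pMr// ltr1n.
- rewrite map_inj_uniq ?iota_uniq// => k m /(mulfI (lt0r_neq0 e0)) /invr_inj /eqP.
  by rewrite eqr_nat => /eqP[].
- by rewrite size_map size_iota.
Qed.

(* The moment of order [m + 1] at [z + t e_i] is a polynomial in [t] that vanishes
   near [0]; so does its linear coefficient, a moment of order [m] of [b y_i]. *)
Lemma moments_open (U : set V) : open U -> U !=set0 ->
  (forall z, U z -> forall m, \int[omega]_(y in S) (b y * dot y z ^+ m) = 0) ->
  forall s : seq 'I_d, \int[omega]_(y in S) (b y * \prod_(i <- s) y 0 i) = 0.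
Proof.
move=> oU [a Ua] U0.
suff H (s : seq 'I_d) : forall m z, U z ->
    \int[omega]_(y in S) (b y * (\prod_(i <- s) y 0 i * dot y z ^+ m)) = 0.
  move=> s; rewrite -[RHS](H s 0 a Ua).
  by apply: eq_Rintegral => y _; rewrite expr0 mulr1.
elim: s => [|i s IH] m z Uz.
  by rewrite -[RHS](U0 z Uz m); apply: eq_Rintegral => y _; rewrite big_nil mul1r.
pose w k (y : V) : R := \prod_(i <- s) y 0 i * (dot y z ^+ (m.+1 - k) * y 0 i ^+ k).
have cw k : contS (w k).
  apply: contSM; first exact: contS_prod.
  by apply: contSM; apply: contS_exp; [exact: contS_dot|exact: contS_coord].
pose p : {poly R} := \poly_(k < m.+2) ((\int[omega]_(y in S) (b y * w k y)) * 'C(m.+1, k)%:R).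
have p0 : p = 0.
  apply: poly_near0_eq0.
  have cz : {for (0 : R), continuous (fun t : R => z + t *: delta_mx 0 i : V)}.
    by apply: continuousD; [exact: cst_continuous|exact: scalel_continuous].
  have : \forall t \near (0 : R), U (z + t *: delta_mx 0 i).
    by apply: cz; rewrite scale0r addr0; exact: open_nbhs_nbhs.
  apply: filterS => t Ut; rewrite -[RHS](IH m.+1 _ Ut) /p horner_poly.
  pose v k (y : V) : R := w k y * ('C(m.+1, k)%:R * t ^+ k).
  rewrite (@eq_Rintegral _ _ _ _ _ (fun y => b y * \sum_(k < m.+2) v k y)).
    rewrite RintS_sum; last by move=> k; apply: contSM => //; exact: contS_cst.
    apply: eq_bigr => k _; rewrite -mulrA -RintegralZr//; last exact: integrable_mul_contS.
    by apply: eq_Rintegral => y _; rewrite /v mulrA.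
  move=> y _; congr (_ * _).
  rewrite dotDr dotZr dot_delta exprDn mulr_sumr; apply: eq_bigr => k _.
  by rewrite /v /w -mulr_natr exprMn; ring.
have := congr1 (fun q : {poly R} => q`_1) p0.
rewrite coef0 coef_poly /= bin1 => /eqP; rewrite mulf_eq0 pnatr_eq0 orbF => /eqP <-.
by apply: eq_Rintegral => y _; rewrite /w big_cons subn1 /= expr1; ring.
Qed.

(** The moment is a polynomial in [z]: each induction step pulls one factor [y . z] out of the
    integral, coordinate by coordinate. The weight [w] collects the coordinates of [y] that remain
    inside. *)
Lemma contS_moment m : contS (fun z : V => \int[omega]_(y in S) (b y * dot y z ^+ m)).
Proof.
suff H w : contS w -> contS (fun z : V => \int[omega]_(y in S) (b y * (w y * dot y z ^+ m))).
  rewrite (_ : (fun z : V => _) = fun z : V => \int[omega]_(y in S) (b y * (1 * dot y z ^+ m))).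
    by apply: H; exact: contS_cst.
  by apply/funext => z; apply: eq_Rintegral => y _; rewrite mul1r.
elim: m w => [|m IH] w cw.
  rewrite (_ : (fun z : V => _) = fun=> \int[omega]_(y in S) (b y * w y)); first exact: contS_cst.
  by apply/funext => z; apply: eq_Rintegral => y _; rewrite expr0 mulr1.
pose F i (z : V) := z 0 i * \int[omega]_(y in S) (b y * ((w y * y 0 i) * dot y z ^+ m)).
rewrite (_ : (fun z : V => _) = fun z : V => \sum_i F i z).
  apply: contS_sum => i; apply: contSM; first exact: contS_coord.
  by apply: IH; apply: contSM => //; exact: contS_coord.
apply/funext => z; rewrite /F.
have cF i : contS (fun y : V => z 0 i * (w y * y 0 i * dot y z ^+ m)).
  apply: contSM; first exact: contS_cst.
  apply: contSM; last by apply: contS_exp; exact: contS_dot.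
  by apply: contSM => //; exact: contS_coord.
rewrite (eq_bigr (fun i => \int[omega]_(y in S) (b y * (z 0 i * (w y * y 0 i * dot y z ^+ m))))); last first.
  move=> i _; rewrite -RintegralZl//; last first.
    apply: integrable_mul_contS; apply: contSM; last by apply: contS_exp; exact: contS_dot.
    by apply: contSM => //; exact: contS_coord.
  by apply: eq_Rintegral => y _; rewrite mulrCA.
pose G k (y : V) : R := if insub k is Some i then z 0 i * (w y * y 0 i * dot y z ^+ m) else 0.
have cG k : contS (G k).
  by rewrite /G; case: insubP => [i _ _|_]; [exact: cF|exact: contS_cst].
have GE (i : 'I_d) y : G i y = z 0 i * (w y * y 0 i * dot y z ^+ m).
  by rewrite /G valK.
rewrite (@eq_Rintegral _ _ _ _ _ (fun y => b y * \sum_(k < d) G k y)); last first.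
  move=> y _; congr (_ * _); rewrite exprS {1}/dot mulr_suml mulr_sumr.
  by apply: eq_bigr => i _; rewrite GE; ring.
rewrite RintS_sum//; apply: eq_bigr => i _.
by apply: eq_Rintegral => y _; rewrite GE.
Qed.

End moments.

Section unique_continuation.
Context {R : realType} {d : nat} (d_ge3 : (3 <= d)%N).
Local Notation V := 'rV[R]_d.
Local Notation S := (@sphere R d).
Let c : R := (d%:R - 2) / 2.
Let W : R := @sphere_area R d.
Let mS := @measurable_sphere R d.
Let c0 : 0 < c. Proof. exact: c_gt0. Qed.
Let W0 : 0 < W. Proof. exact: sphere_area_gt0. Qed.

Lemma smooth_measurable (f : V -> R) : smooth_on setT f -> measurable_fun setT f.
Proof. by move=> sf; apply: measurable_fun_continuous => x; exact: (sf 0). Qed.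

Lemma measurable_zonal a : measurable_fun setT (fun z : V * V => zonal a 2 2 z.1 z.2).
Proof.
apply: (measurableT_comp (f := fun t : R => t `^ (- a)) (measurable_powR _)).
apply: measurable_funB => //; apply: measurable_funM => //.
apply: measurable_sum => i; apply: measurable_funM;
  by apply: (measurableT_comp (f := fun v : V => v 0 i)) => //; exact: measurable_rV_coord.
Qed.

(** The power [|x - y|^(2 - d - 2 j)] for points of the sphere, set to [0] for [y] in [O]. Since [b]
    vanishes on [O], integrals against [b] do not change, and for [x] near [a] the kernel becomes
    bounded. *)
Definition outker (O : set V) (j : nat) (y x : V) : R := \1_(~` O) y * zonal ((d%:R - 2) / 2 + j%:R) 2 2 y x.

Variables (O : set V) (b : V -> R).
Hypotheses (oO : open O) (mb : measurable_fun setT b).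
Hypothesis ib : omega.-integrable S (EFin \o b).
Hypothesis bO : {ae omega, forall x, S x -> O x -> b x = 0}.
Variables (a : V) (rho : R).
Hypotheses (Sa : S a) (rho0 : 0 < rho) (aO : ball a (rho + rho) `<=` O).
Let r := rho ^+ 2 / 4.
Let K : set V := [set x | dot (x - a) (x - a) <= r].
Let C (phi : V -> R) := smooth_on setT phi /\ (forall x, ~ K x -> phi x = 0).
Hypothesis Hb : forall phi, smooth_on setT phi ->
  (forall x, ~ dot (x - a) (x - a) <= rho ^+ 2 / 4 -> phi x = 0) ->
  \int[omega]_(y in S) (b y * pot (fun x => ((d%:R - 2) / 2) ^+ 2 * phi x - lap phi x) y) = 0.

Let cK : closed K.
Proof.
rewrite (_ : K = (fun x => r - dot (x - a) (x - a)) @^-1` [set t | 0 <= t]).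
  apply: preimage_closed; last exact: closed_ge.
  by move=> x _; exact: (smooth_dist2 a r 0).
by apply/seteqP; split => x /=; rewrite subr_ge0.
Qed.

(** Some coordinate of [y] is at least [2 rho] away from that of [a], as the balls of the topology
    are cubes; every coordinate of [x] is within [rho] of that of [a]. *)
Lemma cutoff_far x y : K x -> ~ O y -> rho ^+ 2 <= dot (x - y) (x - y).
Proof.
move=> Kx Oy.
have [i yi] : exists i, rho + rho <= `|a 0 i - y 0 i|.
  apply: contrapT => H; apply: Oy; apply: aO; apply/ball_rVP; first by rewrite addr_gt0.
  move=> i; rewrite ltNge; apply/negP => h; apply: H; by exists i.
have xi : `|x 0 i - a 0 i| <= rho.
  have := enorm_coord (x - a) i; rewrite !mxE => /le_trans; apply.
  rewrite -(@ler_pXn2r _ 2) ?nnegrE ?enorm_ge0 ?(ltW rho0)// sqr_enorm; apply: le_trans Kx _; rewrite /r.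
  by rewrite ler_pdivrMr// ler_peMr ?sqr_ge0// ler1n.
have : rho <= enorm (x - y).
  apply: le_trans (enorm_coord _ i); rewrite !mxE.
  have := ler_normB (a 0 i - x 0 i) (y 0 i - x 0 i).
  rewrite (_ : _ - _ - _ = a 0 i - y 0 i); last by ring.
  rewrite (distrC (y 0 i)) (distrC (a 0 i) (x 0 i)) => h.
  by have := le_trans yi h; lra.
by rewrite -sqr_enorm => h; rewrite ler_pXn2r ?nnegrE ?enorm_ge0 ?(ltW rho0).
Qed.

Let far_dom x y : S x -> S y -> K x -> ~ O y -> rho ^+ 2 <= 2 - 2 * dot x y.
Proof. by move=> Sx Sy Kx Oy; rewrite -dot_sphereB//; exact: cutoff_far. Qed.

Let rho20 : 0 < rho ^+ 2. Proof. exact: exprn_gt0. Qed.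

Let KS_dom y : S y -> ~ O y -> K `&` S `<=` zonal_dom 2 2 y.
Proof.
by move=> Sy Oy x [Kx Sx]; apply: lt_le_trans rho20 _; exact: far_dom.
Qed.

Let ker := outker O.

Let mker j : measurable_fun setT (fun z : V * V => ker j z.1 z.2).
Proof.
apply: measurable_funM; last exact: measurable_zonal.
have m1 : measurable_fun setT (\1_(~` O) : V -> R).
  by apply: measurable_indic; apply: measurableC; exact: open_measurable_rV.
exact: (measurableT_comp m1 measurable_fst).
Qed.

Let kerO j y x : O y -> ker j y x = 0.
Proof. by move=> Oy; rewrite /ker /outker indicE memNset ?mul0r//; exact. Qed.

Let kerN j y x : ~ O y -> ker j y x = zonal (c + j%:R) 2 2 y x.
Proof. by move=> Oy; rewrite /ker /outker indicE mem_set// mul1r. Qed.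

Let ker_le j x y : S x -> S y -> K x -> `|ker j y x| <= (rho ^+ 2) `^ (- (c + j%:R)).
Proof.
move=> Sx Sy Kx; have [Oy|Oy] := pselect (O y); first by rewrite kerO// normr0 powR_ge0.
rewrite kerN// ger0_norm ?powR_ge0//; apply: powRN_le => //; last exact: far_dom.
by rewrite addr_ge0// ltW.
Qed.

Let C_bounded phi : C phi -> exists2 M : R, 0 <= M & forall x, S x -> `|phi x| <= M.
Proof.
move=> [sphi _]; have [M phiM] := contS_bounded (contS_smooth (@subsetT _ _) sphi).
exists M => //; exact: le_trans (normr_ge0 _) (phiM a Sa).
Qed.

Let phiker_le j phi : C phi -> exists2 M : R, 0 <= M & forall x y, S x -> S y -> `|phi x * ker j y x| <= M.
Proof.
move=> Cphi; have [M M0 phiM] := C_bounded Cphi; have [_ phi0] := Cphi.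
exists (M * (rho ^+ 2) `^ (- (c + j%:R))); first by rewrite mulr_ge0// powR_ge0.
move=> x y Sx Sy; have [Kx|Kx] := pselect (K x); last first.
  by rewrite phi0// mul0r normr0 mulr_ge0// powR_ge0.
by rewrite normrM ler_pM// ?phiM// ker_le.
Qed.

Let bounded_int (F : V -> R) M : measurable_fun setT F -> 0 <= M -> (forall x, S x -> `|F x| <= M) ->
  (\int[omega]_(x in S) `|F x|%:E <= (M * W)%:E)%E.
Proof.
move=> mF M0 FM; apply: (@le_trans _ _ (\int[omega]_(x in S) M%:E)%E).
  apply: ge0_le_integral => //.
  apply/measurable_EFinP; apply: measurable_funTS; exact: measurableT_comp.
rewrite integral_cst//= EFinM /W /sphere_area fineK ?lexx//.
by rewrite ge0_fin_numE//; exact: omega_sphere_lty.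
Qed.

Let Phi j (phi : V -> R) y : R := \int[omega]_(x in S) (phi x * ker j y x).

Let mC phi : C phi -> measurable_fun setT phi.
Proof. by move=> [sphi _]; exact: smooth_measurable. Qed.

Let mphiker j phi : C phi -> measurable_fun setT (fun z : V * V => phi z.1 * ker j z.2 z.1).
Proof.
move=> Cphi; apply: measurable_funM; first by apply: measurableT_comp => //; exact: mC.
exact: (measurableT_comp (f := fun z : V * V => ker j z.1 z.2) (g := fun z => (z.2, z.1)) (mker j) (measurable_fun_pair measurable_snd measurable_fst)).
Qed.

Let int1 : omega.-integrable S (EFin \o (fun _ : V => 1 : R)).
Proof. by apply: contS_integrable; exact: contS_cst. Qed.

Let mPhi j phi : C phi -> measurable_fun setT (Phi j phi).
Proof.
move=> Cphi; have [M M0 phiM] := phiker_le j Cphi.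
pose K' (z : V * V) := phi z.2 * ker j z.1 z.2.
have mK' : measurable_fun setT K'.
  exact: (measurableT_comp (f := fun z : V * V => phi z.1 * ker j z.2 z.1) (g := fun z => (z.2, z.1)) (mphiker j Cphi) (measurable_fun_pair measurable_snd measurable_fst)).
have bK' x : S x -> (fun _ : V => 1 : R) x != 0 -> (\int[omega]_(y in S) `|K' (y, x)|%:E <= (M * W)%:E)%E.
  move=> Sx _; apply: bounded_int => //; last by move=> y Sy; exact: phiM.
  exact: (measurableT_comp mK' (measurable_pair2 x)).
have := swap_measurable (mulr_ge0 M0 (ltW W0)) (measurable_cst _) int1 mK' bK'.
rewrite (_ : (fun x => _) = Phi j phi)//; apply/funext => y.
by apply: eq_Rintegral => x _; rewrite mul1r.
Qed.

Let Phi_le j phi : C phi -> exists M : R, forall y, S y -> `|Phi j phi y| <= M.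
Proof.
move=> Cphi; have [M M0 phiM] := phiker_le j Cphi.
exists (M * W) => y Sy.
have my : measurable_fun setT (fun x => phi x * ker j y x).
  exact: (measurableT_comp (mphiker j Cphi) (measurable_pair2 y)).
have iy := bounded_integrableS (measurable_funTS my) (fun x Sx => phiM x y Sx Sy).
apply: le_trans (le_normr_Rintegral mS iy) _.
rewrite -(intS_cst M); apply: le_Rintegral => //; last by move=> x Sx; exact: phiM.
- exact: (integrable_norm iy).
- by apply: contS_integrable; exact: contS_cst.
Qed.

Let iPhi j phi : C phi -> omega.-integrable S (EFin \o (fun y => b y * Phi j phi y)).
Proof.
move=> Cphi; have [M PM] := Phi_le j Cphi.
by apply: integrable_mulb PM => //; apply: measurable_funTS; exact: mPhi.
Qed.

Let C_lap phi : C phi -> C (lap phi).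
Proof.
move=> [sphi phi0]; split; first by apply: smooth_on_lap => //; exact: openT.
by move=> x Kx; exact: (lap_out cK phi0).
Qed.

Let cphi phi z y : C phi -> S y -> ~ O y -> smooth_on (zonal_dom 2 2 y) z ->
  contS (fun x => phi x * z x).
Proof.
move=> [sphi phi0] Sy Oy sz.
have oD := @open_zonal_dom R d 2 2 y.
apply: (@contS_smooth _ _ (zonal_dom 2 2 y `|` ~` K)).
  by move=> x Sx; have [Kx|] := pselect (K x); [left; exact: (KS_dom Sy Oy)|right].
apply: smooth_on_glue => //; last by move=> x Kx; rewrite phi0// mul0r.
by apply: smooth_onM => //; exact: smooth_on_subset sphi.
Qed.

(** Green's formula moves the Laplacian onto the power of the distance; its pole [y] lies outside
    [O], away from the support of [phi]. For [y] in [O] both sides are [0]. *)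
Let Phi_lap j phi y : C phi -> S y -> let e := c + j%:R in
  Phi j (lap phi) y = 2 * e * (2 * e + 3 - d%:R) * Phi j.+1 phi y + e * (d%:R - 2 - e) * Phi j phi y.
Proof.
move=> Cphi Sy e; have [Oy|Oy] := pselect (O y).
  have P0 k f : Phi k f y = 0.
    rewrite /Phi (@eq_Rintegral _ _ _ _ _ (cst 0)) ?Rintegral_cst ?mul0r//.
    by move=> x _; rewrite kerO// mulr0.
  by rewrite !P0 !mulr0 addr0.
have [sphi phi0] := Cphi.
have sz k : smooth_on (zonal_dom 2 2 y) (zonal (c + k%:R) 2 2 y) by exact: smooth_on_zonal.
have PE k f : Phi k f y = \int[omega]_(x in S) (f x * zonal (c + k%:R) 2 2 y x).
  by apply: eq_Rintegral => x _; rewrite kerN.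
rewrite !PE (green_local (@open_zonal_dom R d 2 2 y) cK (KS_dom Sy Oy) sphi phi0 (sz j)).
have c1 k : contS (fun x => phi x * zonal (c + k%:R) 2 2 y x) := cphi Cphi Sy Oy (sz k).
rewrite -(intSZ _ (c1 j.+1)) -(intSZ _ (c1 j)) -intSD; last 2 first.
- by apply: contSM => //; exact: contS_cst.
- by apply: contSM => //; exact: contS_cst.
apply: eq_Rintegral => x /set_mem Sx; have [Kx|Kx] := pselect (K x); last first.
  by rewrite phi0// !mul0r !mulr0 addr0.
rewrite lap_zonal2//; last exact: (KS_dom Sy Oy).
rewrite -/e (_ : c + j.+1%:R = e + 1); first by ring.
by rewrite /e -natr1 addrA.
Qed.

Let dE : d%:R = 2 * c + 2 :> R.
Proof. by rewrite /c; field. Qed.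

(** Induction on [j]: the Laplacian of an admissible [phi] is again admissible, and [Phi_lap] trades
    it for the next power of the distance. *)
Let moment j phi : C phi -> \int[omega]_(y in S) (b y * Phi j.+1 phi y) = 0.
Proof.
elim: j phi => [|j IH] phi Cphi.
  have [sphi phi0] := Cphi; have Clap := C_lap Cphi.
  pose A x := c ^+ 2 * phi x - lap phi x.
  have mA : measurable_fun setT A.
    by apply: measurable_funB; [apply: measurable_funM => //|]; exact: mC.
  have cA : contS A.
    apply: (contS_smooth (@subsetT _ _)); apply: smooth_onB; [exact: openT| |exact: Clap.1].
    by apply: smooth_onZ => //; exact: openT.
  have := Hb sphi phi0.
  rewrite (_ : Rintegral _ _ _ = \int[omega]_(y in S) ((- 2 * c / W) * (b y * Phi 1 phi y))).
    rewrite RintegralZl//; last exact: iPhi.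
    have ne : - 2 * c / W != 0.
      by rewrite lt_eqF// !mulNr oppr_lt0 divr_gt0// mulr_gt0.
    by move/eqP; rewrite mulf_eq0 (negbTE ne) => /eqP.
  apply: ae_eq_RintegralS.
  - apply: measurable_funM => //; apply: measurable_pot => //; exact: contS_integrable.
  - by apply: measurable_funM => //; apply: measurable_funM => //; exact: mPhi.
  apply: filterS bO => y bOy Sy; have [Oy|Oy] := pselect (O y).
    by rewrite (bOy Sy Oy) !mul0r mulr0.
  rewrite [RHS]mulrCA; congr (b y * _).
  have PE k f : Phi k f y = \int[omega]_(x in S) (f x * zonal (c + k%:R) 2 2 y x).
    by apply: eq_Rintegral => x _; rewrite kerN.
  rewrite -[pot _ y]/(pot A y).
  (* At exponent [c] the coefficient [e (d - 2 - e)] equals [c^2] and cancels the term [c^2 * phi]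
     of [A]; only the next power survives, with coefficient [- 2 c / W]. *)
  have -> : pot A y = W^-1 * (c ^+ 2 * Phi 0 phi y - Phi 0 (lap phi) y).
    have s0 : smooth_on (zonal_dom 2 2 y) (zonal (c + 0%:R) 2 2 y) by exact: smooth_on_zonal.
    have c1 := cphi Cphi Sy Oy s0; have c2 := cphi Clap Sy Oy s0.
    rewrite /pot -/W; congr (_ * _); rewrite !PE -(intSZ _ c1) -(intSN c2) -intSD.
    - apply: eq_Rintegral => x /set_mem Sx.
      by rewrite kernE// -/c addr0 /A; ring.
    - by apply: contSM => //; exact: contS_cst.
    - exact: contSN.
  rewrite (Phi_lap 0 Cphi Sy) addr0 dE.
  by move: (Phi 0 phi y) (Phi 1 phi y) => p q; field; rewrite gt_eqF.
have Cl := C_lap Cphi.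
have := IH _ Cl; set e := c + j.+1%:R.
pose al := 2 * e * (2 * e + 3 - d%:R); pose be := e * (d%:R - 2 - e).
rewrite (@eq_Rintegral _ _ _ _ _ (fun y => al * (b y * Phi j.+2 phi y) + be * (b y * Phi j.+1 phi y))); last first.
  move=> y /set_mem Sy; rewrite (Phi_lap j.+1 Cphi Sy) -/e -/al -/be.
  by move: (Phi j.+1 phi y) (Phi j.+2 phi y) => p q; ring.
have iZ (t : R) k : omega.-integrable S (EFin \o (fun y => t * (b y * Phi k phi y))).
  rewrite (_ : _ \o _ = fun y => (t%:E * (EFin \o (fun y => (b y * Phi k phi y)%R)) y)%E); last exact/funext.
  by apply: integrableZl => //; exact: iPhi.
rewrite RintegralD// !RintegralZl//; try exact: iPhi.
rewrite IH// mulr0 addr0 => /eqP; rewrite mulf_eq0 => /orP[|/eqP//].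
have e0 : 0 < e by rewrite ltr_wpDr.
rewrite /al !mulf_eq0 pnatr_eq0 (gt_eqF e0)/= => /eqP h; exfalso.
(* The coefficient of the new power never vanishes, so its integral does. *)
have : 2 * e + 3 - d%:R = 2 * j.+1%:R + 1 by rewrite /e dE; ring.
by rewrite h => /esym/eqP; rewrite gt_eqF// addr_gt0// mulr_gt0.
Qed.

Let bp := cutoff a r.

Let Cprod (s : seq 'I_d) : C (fun x => bp x * \prod_(i <- s) x 0 i).
Proof.
split; last first.
  move=> x Kx; rewrite /bp cutoff_eq0 ?mul0r// ltW// ltNge; exact/negP.
elim: s => [|i s IH].
  rewrite (_ : (fun x => _) = bp); first exact: smooth_cutoff.
  by apply/funext => x; rewrite big_nil mulr1.
rewrite (_ : (fun x => _) = fun x : V => x 0 i * (bp x * \prod_(i <- s) x 0 i)).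
  by apply: smooth_onM => //; [exact: openT|exact: smooth_on_coord].
by apply/funext => x; rewrite big_cons mulrCA.
Qed.

Let mphiker_x j phi x : C phi -> measurable_fun setT (fun y => phi x * ker j y x).
Proof.
move=> Cphi; exact: (measurableT_comp (f := fun z : V * V => phi z.1 * ker j z.2 z.1)
  (mphiker j Cphi) (measurable_pair1 x)).
Qed.

Let ibker j phi x : C phi -> S x ->
  omega.-integrable S (EFin \o (fun y => b y * (phi x * ker j y x))).
Proof.
move=> Cphi Sx; have [M M0 phiM] := phiker_le j Cphi.
apply: (@integrable_mulb _ _ _ _ _ mS b (fun y => phi x * ker j y x) M) => //.
  by apply: measurable_funTS; exact: mphiker_x.
by move=> y Sy; exact: phiM.
Qed.

(** Passes from test functions to points. With [phi] the bump times a monomial, [moment] and Fubini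
    say that all moments of the function of [x] in question vanish, so it is [0] almost
    everywhere. *)
Lemma ae_moment : {ae omega, forall x, S x ->
  forall j, \int[omega]_(y in S) (b y * (cutoff a (rho ^+ 2 / 4) x * outker O j.+1 y x)) = 0}.
Proof.
suff H j : {ae omega, forall x, S x -> \int[omega]_(y in S) (b y * (bp x * ker j.+1 y x)) = 0}.
  by apply: filterS (ae_foralln H) => x Hx Sx j; exact: Hx.
have bK phi : C phi -> exists2 M : R, 0 <= M & forall y, S y -> b y != 0 ->
    (\int[omega]_(x in S) `|phi x * ker j.+1 y x|%:E <= M%:E)%E.
  move=> Cphi; have [M M0 phiM] := phiker_le j.+1 Cphi.
  exists (M * W); first by rewrite mulr_ge0// ltW.
  move=> y Sy _; apply: bounded_int => //; last by move=> x Sx; exact: phiM.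
  exact: (measurableT_comp (f := fun z : V * V => phi z.1 * ker j.+1 z.2 z.1)
    (mphiker j.+1 Cphi) (measurable_pair2 y)).
have Cbp : C bp.
  have [sp p0] := Cprod [::].
  split; [exact: smooth_cutoff|move=> x Kx; have := p0 x Kx; by rewrite big_nil mulr1].
have [M M0 bM] := bK _ Cbp.
apply: sphere_moments_eq0; first exact: (swap_integrable M0 mb ib (mphiker j.+1 Cbp) bM).
move=> s; have Cs := Cprod s; have [Ms Ms0 bMs] := bK _ Cs.
rewrite -[RHS](moment j Cs).
rewrite -(swap_Rintegral Ms0 mb ib (mphiker j.+1 Cs) bMs).
apply: eq_Rintegral => x /set_mem Sx /=.
rewrite -RintegralZr//; last exact: ibker.
by apply: eq_Rintegral => y _; ring.
Qed.

End unique_continuation.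

Section zonal_moments.
Context {R : realType} {d : nat} (d_ge3 : (3 <= d)%N).
Local Notation V := 'rV[R]_d.
Local Notation S := (@sphere R d).
Let c : R := (d%:R - 2) / 2.
Let mS := @measurable_sphere R d.
Let c0 : 0 < c. Proof. exact: c_gt0. Qed.

(** The exponent is [- d / 2]. In this form the power is obtained from [s^-1] by a square root and
    products, operations available in [blc] for every parity of [d]. *)
Lemma powR_half_dim (s : R) : 0 < s -> s `^ (- ((d%:R - 2) / 2 + 1)) = Num.sqrt s^-1 ^+ d.
Proof.
move=> s0; rewrite -powR12_sqrt ?invr_ge0 ?(ltW s0)// -powR_mulrn ?powR_ge0//.
rewrite -(powR_inv1 (ltW s0)) -!powRrM; congr (s `^ _).
by field.
Qed.

Variables (O : set V) (b : V -> R).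
Hypothesis oO : open O.
Hypothesis ib : omega.-integrable S (EFin \o b).
Variables (x : V) (delta : R).
Hypotheses (Sx : S x) (delta0 : 0 < delta).
Hypothesis far : forall y, S y -> ~ O y -> delta <= 2 - 2 * dot x y.
Lemma outker_integrable j : omega.-integrable S (EFin \o (fun y => b y * outker O j y x)).
Proof.
have kerO y : O y -> outker O j y x = 0.
  by move=> Oy; rewrite /outker indicE memNset ?mul0r//; exact.
have kerN y : ~ O y -> outker O j y x = zonal (c + j%:R) 2 2 y x.
  by move=> Oy; rewrite /outker indicE mem_set// mul1r.
have m1 : measurable_fun setT (\1_(~` O) : V -> R).
  by apply: measurable_indic; apply: measurableC; exact: open_measurable_rV.
have mz : measurable_fun setT (fun y => zonal (c + j%:R) 2 2 y x).
  exact: (measurableT_comp (measurable_zonal (c + j%:R)) (measurable_pair2 x)).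
have kM y : S y -> `|outker O j y x| <= delta `^ (- (c + j%:R)).
  move=> Sy; have [Oy|Oy] := pselect (O y); first by rewrite kerO// normr0 powR_ge0.
  rewrite kerN// ger0_norm ?powR_ge0//; apply: powRN_le => //; last exact: far.
  by rewrite addr_ge0// ltW.
apply: (@integrable_mulb _ _ _ _ _ mS b (fun y => outker O j y x) _ ib _ kM).
by apply: measurable_funTS; exact: measurable_funM.
Qed.

Hypothesis H : forall j, \int[omega]_(y in S) (b y * outker O j.+1 y x) = 0.

(* With [u = delta / |x - y| ^ 2], the density [b * outker O 1] is orthogonal to all
   polynomials in [u], hence to their bounded limits, one of which is a multiple of
   [|x - y| ^ d * (x . y) ^ m]. *)
Lemma outker_moment_dot m : \int[omega]_(y in S) (b y * (\1_(~` O) y * dot y x ^+ m)) = 0.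
Proof.
have kerO j y : O y -> outker O j y x = 0.
  by move=> Oy; rewrite /outker indicE memNset ?mul0r//; exact.
have kerN j y : ~ O y -> outker O j y x = zonal (c + j%:R) 2 2 y x.
  by move=> Oy; rewrite /outker indicE mem_set// mul1r.
have m1 : measurable_fun setT (\1_(~` O) : V -> R).
  by apply: measurable_indic; apply: measurableC; exact: open_measurable_rV.
have mz e : measurable_fun setT (fun y => zonal e 2 2 y x).
  exact: (measurableT_comp (measurable_zonal e) (measurable_pair2 x)).
(* Single generator, hence the index type [unit]. The value [1] on [O] keeps [u] between
   [min (delta / 4) 1] and [1] on the whole sphere, as inversion requires; [delta / 4] comes from
   [|x - y|^2 <= 4]. *)
pose u (_ : unit) y : R := \1_(~` O) y * (delta * zonal 1 2 2 y x) + (1 - \1_(~` O) y).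
have uO y t : O y -> u t y = 1.
  by move=> Oy; rewrite /u indicE memNset ?mul0r ?add0r ?subr0//; exact.
have uN y t : ~ O y -> u t y = delta * zonal 1 2 2 y x.
  by move=> Oy; rewrite /u indicE mem_set// mul1r subrr addr0.
have sE y : S y -> ~ O y -> [/\ 0 < 2 - 2 * dot x y, delta <= 2 - 2 * dot x y,
    2 - 2 * dot x y <= 4 & zonal 1 2 2 y x = (2 - 2 * dot x y)^-1].
  move=> Sy Oy; have h := far Sy Oy; have h0 := lt_le_trans delta0 h.
  split => //; last by rewrite /zonal powR_inv1// ltW.
  have : 0 <= dot (x + y) (x + y) by exact: dot_ge0.
  rewrite dotDl !dotDr (sphereP x).1// (sphereP y).1// (dotC y x) => h1.
  by lra.
have mu t : measurable_fun S (u t).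
  apply: measurable_funTS; apply: measurable_funD; last exact: measurable_funB.
  by apply: measurable_funM => //; exact: measurable_funM.
have u_bound t y : S y -> Num.min (delta / 4) 1 <= u t y <= 1.
  move=> Sy; have [Oy|Oy] := pselect (O y); first by rewrite uO// lexx ge_min lexx orbT.
  have [s0 s1 s2 s3] := sE y Sy Oy; rewrite uN// s3 ge_min; apply/andP; split.
    by apply/orP; left; rewrite ler_pM2l// lef_pV2// posrE.
  by rewrite ler_pdivrMr// mul1r.
have dl0 : 0 < Num.min (delta / 4) 1 :> R.
  by rewrite lt_min ltr01 andbT divr_gt0.
have u0 t y : S y -> 0 < u t y.
  by move=> Sy; have /andP[h _] := u_bound t y Sy; exact: lt_le_trans dl0 h.
have u_le t y : S y -> `|u t y| <= 1.
  by move=> Sy; rewrite gtr0_norm ?u0//; have /andP[] := u_bound t y Sy.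
have gen : blc S u (u tt) by exact: blc_gen.
have b1 : blc S u (fun y => (u tt y)^-1) by exact: (blc_inv dl0 gen (u_bound tt)).
have b2 : blc S u (fun y => Num.sqrt (u tt y)).
  by apply: blc_sqrt => // y Sy; rewrite (ltW (u0 tt y Sy)); have /andP[] := u_bound tt y Sy.
(* The first two factors are [u^(- d / 2)], which off [O] cancels the weight [|x - y|^(- d)] up to a
   constant. The last one is [(x . y)^m], since [x . y = 1 - |x - y|^2 / 2 = 1 - delta / (2 u)]. *)
pose g y := (u tt y)^-1 ^+ d * Num.sqrt (u tt y) ^+ d * (1 - delta / 2 * (u tt y)^-1) ^+ m.
have bg : blc S u g.
  apply: blc_mul; first by apply: blc_mul; exact: blc_exp.
  apply: blc_exp; apply: (blc_sub (D := S)); first exact: blc_cst.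
  exact: blc_scale.
have h0 (s : seq unit) : \int[omega]_(y in S) (b y * outker O 1 y x * \prod_(t <- s) u t y) = 0.
  rewrite (@eq_Rintegral _ _ _ _ _ (fun y => delta ^+ size s * (b y * outker O (size s).+1 y x))).
    by rewrite RintegralZl ?H ?mulr0//; exact: outker_integrable.
  move=> y /set_mem Sy.
  have [Oy|Oy] := pselect (O y); first by rewrite !kerO// !mulr0 mul0r.
  have [s0 s1 s2 s3] := sE y Sy Oy.
  have -> : \prod_(t <- s) u t y = (delta * (2 - 2 * dot x y)^-1) ^+ size s.
    elim: (s) => [|t s' IH]; first by rewrite big_nil expr0.
    by rewrite big_cons IH exprS uN// s3.
  have -> : outker O (size s).+1 y x = outker O 1 y x * (2 - 2 * dot x y)^-1 ^+ size s.
    rewrite !kerN// /zonal -powR_inv1 ?(ltW s0)// -powR_mulrn ?powR_ge0// -powRrM -powRD.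
      by congr (_ `^ _); rewrite -natr1; ring.
    by apply/implyP => _; rewrite gt_eqF.
  by rewrite exprMn; move: (outker _ _ _ _) (_ ^-1 ^+ _) => p q; ring.
have := blc_int mS mu u_le (outker_integrable 1) h0 bg.
rewrite (@eq_Rintegral _ _ _ _ _ (fun y => (Num.sqrt delta ^+ d)^-1 * (b y * (\1_(~` O) y * dot y x ^+ m)))).
  rewrite RintegralZl//; last first.
    have cd : contS (fun y => dot y x ^+ m) by apply: contS_exp; exact: contS_dot.
    have [M dM] := contS_bounded cd.
    apply: (@integrable_mulb _ _ _ _ _ mS b (fun y => \1_(~` O) y * dot y x ^+ m) M ib).
      by apply: measurable_funM; [exact: measurable_funTS|exact: contS_measurable].
    move=> y Sy; rewrite indicE; case: (_ \in _); rewrite ?mul1r ?mul0r ?dM// normr0.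
    exact: le_trans (normr_ge0 _) (dM y Sy).
  move/eqP; rewrite mulf_eq0 invr_eq0 expf_eq0 sqrtr_eq0 leNgt delta0 andbF /=.
  by move/eqP.
move=> y /set_mem Sy.
have [Oy|Oy] := pselect (O y).
  by rewrite kerO// indicE memNset ?mul0r ?mulr0 ?mul0r//; exact.
have [s0 s1 s2 s3] := sE y Sy Oy.
rewrite indicE mem_set// mul1r -[RHS]mulrCA -[LHS]mulrA; congr (b y * _).
rewrite kerN// /zonal powR_half_dim// /g uN// s3 (dotC y).
set s := 2 - 2 * dot x y in s0 s1 s2 s3 *.
have -> : dot x y = 1 - s / 2 by rewrite /s; field.
have -> : delta / 2 * (delta * s^-1)^-1 = s / 2.
  by field; rewrite (gt_eqF delta0) (gt_eqF s0).
rewrite sqrtrM ?(ltW delta0)//; set q := Num.sqrt delta; set p := Num.sqrt s^-1.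
have q0 : q != 0 by rewrite gt_eqF// sqrtr_gt0.
have p0 : p != 0 by rewrite gt_eqF// sqrtr_gt0 invr_gt0.
have -> : delta * s^-1 = (q * p) ^+ 2.
  by rewrite exprMn !sqr_sqrtr ?invr_ge0 ?ltW.
rewrite !mulrA -!exprMn -(exprVn q); congr (_ ^+ d * _).
by field; rewrite q0 p0.
Qed.

End zonal_moments.

(** * Unique continuation and injectivity of [T + 1] and [T - 1] *)

Section injectivity.
Context {R : realType} {d : nat} (d_ge3 : (3 <= d)%N).
Local Notation V := 'rV[R]_d.
Local Notation S := (@sphere R d).
Let c : R := (d%:R - 2) / 2.
Let mS := @measurable_sphere R d.
Let c0 : 0 < c. Proof. exact: c_gt0. Qed.

(** The moments in direction [x] vanish for almost every [x] in a cap. They are continuous in [x]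
    and nonempty relatively open sets have positive measure, so they vanish on the whole cap; by
    homogeneity they vanish on an open cone of [R^d], where [moments_open] applies. *)
Lemma unique_continuation_pot (O : set V) (b : V -> R) : open O -> S `&` O !=set0 ->
  measurable_fun setT b -> omega.-integrable S (EFin \o b) ->
  {ae omega, forall x, S x -> O x -> b x = 0} ->
  (forall phi, smooth_on setT phi ->
    (exists K, [/\ closed K, K `<=` O & forall x, ~ K x -> phi x = 0]) ->
    \int[omega]_(y in S) (b y * pot (fun x => ((d%:R - 2) / 2) ^+ 2 * phi x - lap phi x) y) = 0) ->
  {ae omega, forall x, S x -> b x = 0}.
Proof.
move=> oO [a [Sa Oa]] mb ib bO Hb.
have : \forall x \near a, O x by exact: open_nbhs_nbhs.
move=> /nbhs_ballP[e /= e0 eO].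
pose rho := e / 2; have rho0 : 0 < rho by rewrite divr_gt0.
have aO : ball a (rho + rho) `<=` O by rewrite -splitr.
pose r := rho ^+ 2 / 4.
pose K : set V := [set x | dot (x - a) (x - a) <= r].
have r0 : 0 < r by rewrite divr_gt0// exprn_gt0.
have cK : closed K.
  rewrite (_ : K = (fun x => r - dot (x - a) (x - a)) @^-1` [set t | 0 <= t]).
    apply: preimage_closed; last exact: closed_ge.
    by move=> x _; exact: (smooth_dist2 a r 0).
  by apply/seteqP; split => x /=; rewrite subr_ge0.
have KO : K `<=` O.
  move=> x Kx; apply: contrapT => Ox.
  have := cutoff_far rho0 aO Kx Ox.
  by rewrite subrr dot0l leNgt exprn_gt0.
have Hb' phi : smooth_on setT phi ->
    (forall x, ~ dot (x - a) (x - a) <= rho ^+ 2 / 4 -> phi x = 0) ->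
    \int[omega]_(y in S) (b y * pot (fun x => ((d%:R - 2) / 2) ^+ 2 * phi x - lap phi x) y) = 0.
  by move=> sphi phi0; apply: Hb => //; exists K; split.
have M0 : {ae omega, forall x, S x -> dot (x - a) (x - a) < r ->
    forall m, \int[omega]_(y in S) (b y * dot y x ^+ m) = 0}.
  have := ae_moment d_ge3 oO mb ib bO Sa rho0 aO Hb'; apply: filterS => x Hx Sx xr m.
  have Kx : K x by exact: ltW.
  have far y : S y -> ~ O y -> rho ^+ 2 <= 2 - 2 * dot x y.
    by move=> Sy Oy; rewrite -dot_sphereB//; exact: (cutoff_far rho0 aO).
  have rho20 : 0 < rho ^+ 2 by exact: exprn_gt0.
  have H j : \int[omega]_(y in S) (b y * outker O j.+1 y x) = 0.
    have := Hx Sx j.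
    rewrite (@eq_Rintegral _ _ _ _ _ (fun y => cutoff a r x * (b y * outker O j.+1 y x))); last first.
      by move=> y _; rewrite mulrCA.
    rewrite RintegralZl//; last exact: (outker_integrable d_ge3 oO ib rho20 far).
    by move/eqP; rewrite mulf_eq0 (gt_eqF (cutoff_gt0 xr)) => /eqP.
  rewrite -[RHS](outker_moment_dot d_ge3 oO ib Sx rho20 far H m).
  have md : measurable_fun setT (fun y : V => dot y x ^+ m).
    by apply: measurable_funX; apply: measurable_fun_continuous; exact: continuous_dot.
  apply: ae_eq_RintegralS.
  - exact: measurable_funM.
  - apply: measurable_funM => //; apply: measurable_funM => //.
    by apply: measurable_indic; apply: measurableC; exact: open_measurable_rV.
  apply: filterS bO => y bOy Sy; have [Oy|Oy] := pselect (O y); first by rewrite bOy// !mul0r.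
  by rewrite indicE mem_set// mul1r.
have M1 x m : S x -> dot (x - a) (x - a) < r -> \int[omega]_(y in S) (b y * dot y x ^+ m) = 0.
  move=> Sx xr; apply/eqP/negP => /negP Pn0.
  pose P z := \int[omega]_(y in S) (b y * dot y z ^+ m).
  have n1 : \forall z \near x, P z != 0.
    have cP : {for x, continuous P} by exact: contS_moment.
    by apply: (cP [set t | t != 0]); apply: open_nbhs_nbhs; split => //; exact: open_neq.
  have n2 : \forall z \near x, 0 < r - dot (z - a) (z - a).
    by apply: (cvgr_gt _ ((smooth_dist2 a r 0) x I)); rewrite subr_gt0.
  pose A : set V := [set z | P z != 0 /\ 0 < r - dot (z - a) (z - a)].
  have nA : nbhs x A by exact: filterI.
  have oA : open A° by exact: open_interior.
  have := omega_gt0 oA (ex_intro _ x (conj Sx nA)).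
  have [N [mN N0 subN]] := M0.
  have sub : S `&` A° `<=` N.
    move=> z [Sz /interior_subset[Pz zr]]; apply: subN => /= h.
    by move: Pz; rewrite /P h ?eqxx// -subr_gt0.
  have mSA : measurable (S `&` A°) by apply: measurableI => //; exact: open_measurable_rV.
  by rewrite ltNge -N0 le_measure// inE.
apply: sphere_moments_eq0 => //.
pose U : set V := [set z | z != 0 /\ 0 < r - dot (normalize z - a) (normalize z - a)].
have a0 : a != 0.
  by apply/eqP => a0; move: Sa => /sphereP; rewrite a0 dot0l => /esym/eqP; rewrite oner_eq0.
have nU : nbhs a U.
  apply: filterI.
    have o0 : open (~` [set (0 : V)]).
      apply: closed_openC.
      exact: (accessible_closed_set1 (hausdorff_accessible (@norm_hausdorff _ _))).
    have : nbhs a (~` [set (0 : V)]) by apply: open_nbhs_nbhs; split => //; exact/eqP.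
    by apply: filterS => z /= /eqP.
  have cn : {for a, continuous (fun z => r - dot (normalize z - a) (normalize z - a))}.
    apply: (@continuous_comp _ _ _ (@normalize R d) (fun z => r - dot (z - a) (z - a))).
      exact: continuous_normalize.
    exact: (smooth_dist2 a r 0).
  apply: (cvgr_gt _ cn).
  by rewrite normalize_sphere// subrr dot0l subr0.
apply: (moments_open ib (open_interior U)); first by exists a.
move=> z /interior_subset[z0 zr] m.
have Sz := sphere_normalize z0.
have zE : z = enorm z *: normalize z.
  rewrite /normalize scalerA divff ?scale1r//.
  by apply: contraNneq z0 => /enorm_eq0 ->.
have zr' : dot (normalize z - a) (normalize z - a) < r by rewrite -subr_gt0.
have dz y : dot y z = enorm z * dot y (normalize z) by rewrite -dotZr -zE.
rewrite (@eq_Rintegral _ _ _ _ _ (fun y => enorm z ^+ m * (b y * dot y (normalize z) ^+ m))).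
  rewrite RintegralZl//; first by rewrite (M1 _ m Sz zr') mulr0.
  by apply: integrable_mul_contS => //; apply: contS_exp; exact: contS_dot.
by move=> y _; rewrite dz exprMn mulrCA.
Qed.

Lemma hpoly_prod (s : seq 'I_d) : @hpoly R d (size s) (fun x => \prod_(i <- s) x 0 i).
Proof.
elim: s => [|i s IH].
  by rewrite (_ : (fun x => _) = fun=> 1); [exact: hpoly_cst|apply/funext => x; rewrite big_nil].
rewrite (_ : (fun x => _) = fun x : V => x 0 i * \prod_(i <- s) x 0 i); first exact: hpolyX.
by apply/funext => x; rewrite big_cons.
Qed.

Lemma contS_eigenfun l (e : V -> R) : eigenfun l e -> contS e.
Proof. by move=> [se _ _]; exact: (contS_smooth (@subsetT _ _) se). Qed.

(** Completeness: monomials restricted to the sphere are finite sums of eigenfunctions, so all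
    moments of [u] vanish. *)
Lemma eigenfun_density (u : V -> R) : omega.-integrable S (EFin \o u) ->
  (forall l e, eigenfun l e -> \int[omega]_(x in S) (u x * e x) = 0) ->
  {ae omega, forall x, S x -> u x = 0}.
Proof.
move=> iu H; apply: sphere_moments_eq0 => // s.
have [e ee pe] := hpoly_eigen_decomp (ltnW d_ge3) (hpoly_prod s).
rewrite (@eq_Rintegral _ _ _ _ _ (fun x => u x * \sum_(l < (size s).+1) e l x)); last first.
  by move=> x /set_mem Sx; rewrite pe.
rewrite RintS_sum//; last by move=> l; exact: contS_eigenfun.
by apply: big1 => l _; exact: (H _ _ (ee l)).
Qed.

Lemma pot_mul_eigenfun l (e u : V -> R) : eigenfun l e -> measurable_fun setT u ->
  omega.-integrable S (EFin \o u) ->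
  \int[omega]_(x in S) (pot u x * e x) = c / (l%:R + c) * \int[omega]_(x in S) (u x * e x).
Proof.
move=> ee mu iu; have ce := contS_eigenfun ee; have [M eM] := contS_bounded ce.
have me : measurable_fun setT e by have [se _ _] := ee; exact: smooth_measurable.
rewrite (pot_sym d_ge3 mu iu me eM) -RintegralZl//; last exact: integrable_mul_contS.
apply: eq_Rintegral => x /set_mem Sx; rewrite [RHS]mulrCA; congr (u x * _).
have lc : l%:R + c != 0 by rewrite gt_eqF// ltr_wpDl.
have pe := pot_eigen d_ge3 Sx ee; rewrite -/c in pe.
by apply: (mulfI lc); rewrite pe; field.
Qed.

(** On eigenfunctions of degree [l], [c^2 - lap] acts by [c^2 + l (l + 2 c) = (l + c)^2], which
    cancels the square of the eigenvalue [c / (l + c)]. *)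
Lemma pot_pot phi : smooth_on setT phi ->
  {ae omega, forall x, S x -> pot (pot (fun x => c ^+ 2 * phi x - lap phi x)) x = c ^+ 2 * phi x}.
Proof.
move=> sphi; pose A x := c ^+ 2 * phi x - lap phi x; rewrite -/A.
have oT := @openT V.
have sl : smooth_on setT (lap phi) by exact: smooth_on_lap.
have sc : smooth_on setT (fun x => c ^+ 2 * phi x) by exact: smooth_onZ.
have sA : smooth_on setT A by exact: smooth_onB.
have cS (f : V -> R) : smooth_on setT f -> contS f by move=> sf; exact: (contS_smooth (@subsetT _ _) sf).
have mA := smooth_measurable sA; have iA := contS_integrable (cS _ sA).
have mpA := measurable_pot d_ge3 mA iA; have ipA := pot_integrable d_ge3 mA iA.
have mppA := measurable_pot d_ge3 mpA ipA; have ippA := pot_integrable d_ge3 mpA ipA.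
pose u x := pot (pot A) x - c ^+ 2 * phi x.
have iu : omega.-integrable S (EFin \o u).
  rewrite (_ : _ \o _ = fun x => ((EFin \o pot (pot A)) x - (EFin \o (fun x => (c ^+ 2 * phi x)%R)) x)%E); last exact/funext.
  by apply: integrableB => //; apply: contS_integrable; exact: cS.
suff : {ae omega, forall x, S x -> u x = 0}.
  by apply: filterS => x ux Sx; apply/eqP; rewrite -subr_eq0; apply/eqP; exact: ux.
apply: eigenfun_density => // l e ee; have ce := contS_eigenfun ee; have [se el _] := ee.
have ic : omega.-integrable S (EFin \o (fun x => c ^+ 2 * phi x * e x)).
  by apply: contS_integrable; apply: contSM => //; exact: cS.
have ip : omega.-integrable S (EFin \o (fun x => pot (pot A) x * e x)) by exact: integrable_mul_contS.
rewrite (@eq_Rintegral _ _ _ _ _ (fun x => pot (pot A) x * e x - c ^+ 2 * phi x * e x)); last first.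
  by move=> x _; rewrite mulrBl.
rewrite RintegralB// !(pot_mul_eigenfun ee)//.
have cpe : contS (fun x => phi x * e x) by apply: contSM => //; exact: cS.
have -> : \int[omega]_(x in S) (A x * e x) = (l%:R + c) ^+ 2 * \int[omega]_(x in S) (phi x * e x).
  rewrite (@eq_Rintegral _ _ _ _ _ (fun x => c ^+ 2 * phi x * e x - lap phi x * e x)); last first.
    by move=> x _; rewrite mulrBl.
  rewrite RintegralB//; last by apply: contS_integrable; apply: contSM => //; exact: cS.
  rewrite (green_sym oT (@subsetT _ _) sphi se).
  rewrite (@eq_Rintegral _ _ _ _ _ (fun x => c ^+ 2 * (phi x * e x))); last by move=> x _; rewrite mulrA.
  rewrite [X in _ - X](@eq_Rintegral _ _ _ _ _ (fun x => - @eigval R d l * (phi x * e x))); last first.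
    by move=> x /set_mem Sx; rewrite el// mulrCA.
  rewrite !intSZ// -mulrBl; congr (_ * _).
  by rewrite /eigval /c; field.
rewrite [X in _ - X](@eq_Rintegral _ _ _ _ _ (fun x => c ^+ 2 * (phi x * e x))); last by move=> x _; rewrite mulrA.
rewrite intSZ//; move: (Rintegral _ _ _) => I.
by field; rewrite gt_eqF// ltr_wpDl.
Qed.

Lemma ae_eq0_RintegralS (f : V -> R) : measurable_fun setT f ->
  {ae omega, forall x, S x -> f x = 0} -> \int[omega]_(x in S) f x = 0.
Proof.
move=> mf f0; rewrite (@ae_eq_RintegralS _ _ f (cst 0) mf (measurable_cst _) f0).
by rewrite Rintegral_cst ?mul0r.
Qed.

(** Once [T k + sigma k = 0] on the whole sphere, an eigenfunction of degree [l] yields the factor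
    [c / (l + c) + sigma]. It is positive for [sigma = 1]; for [sigma = -1] it vanishes only at
    [l = 0], where the eigenfunction is constant and the zero mean of [k] takes over. *)
Lemma pot_sign_injective (O : set V) (k : V -> R) (sigma : R) :
  open O -> S `&` O !=set0 -> measurable_fun setT k -> omega.-integrable S (EFin \o k) ->
  sigma = 1 \/ sigma = -1 /\ \int[omega]_(x in S) k x = 0 ->
  {ae omega, forall x, S x -> O x -> pot k x + sigma * k x = 0} ->
  (forall phi, smooth_on setT phi ->
    (exists K, [/\ closed K, K `<=` O & forall x, ~ K x -> phi x = 0]) ->
    \int[omega]_(x in S) (pot k x * lap phi x) = 0) ->
  {ae omega, forall x, S x -> k x = 0}.
Proof.
move=> oO SO0 mk ik sig bO H.
have oT := @openT V.
have mpk := measurable_pot d_ge3 mk ik; have ipk := pot_integrable d_ge3 mk ik.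
have iZ (t : R) (f : V -> R) : omega.-integrable S (EFin \o f) ->
    omega.-integrable S (EFin \o (fun x => t * f x)).
  move=> if'; rewrite (_ : _ \o _ = fun x => (t%:E * (EFin \o f) x)%E); last exact/funext.
  exact: integrableZl.
pose b x := pot k x + sigma * k x.
have mb : measurable_fun setT b by apply: measurable_funD => //; exact: measurable_funM.
have ib : omega.-integrable S (EFin \o b).
  rewrite (_ : _ \o _ = fun x => ((EFin \o pot k) x + (EFin \o (fun x => (sigma * k x)%R)) x)%E); last exact/funext.
  by apply: integrableD => //; exact: iZ.
have bE w : contS w -> \int[omega]_(x in S) (b x * w x) =
    \int[omega]_(x in S) (pot k x * w x) + sigma * \int[omega]_(x in S) (k x * w x).
  move=> cw; rewrite -RintegralZl//; last exact: integrable_mul_contS.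
  rewrite -RintegralD//; [|exact: integrable_mul_contS|by apply: iZ; exact: integrable_mul_contS].
  by apply: eq_Rintegral => x _; rewrite /b mulrDl mulrA.
have b0 : {ae omega, forall x, S x -> b x = 0}.
  apply: (unique_continuation_pot oO SO0 mb ib bO) => phi sphi [K [cK KO phi0]].
  have H0 := H phi sphi (ex_intro _ K (And3 cK KO phi0)).
  rewrite -/c; pose A x := c ^+ 2 * phi x - lap phi x; rewrite -/A.
  have sl : smooth_on setT (lap phi) by exact: smooth_on_lap.
  have sA : smooth_on setT A by apply: smooth_onB => //; exact: smooth_onZ.
  have cS (f : V -> R) : smooth_on setT f -> contS f by move=> sf; exact: (contS_smooth (@subsetT _ _) sf).
  have mA := smooth_measurable sA; have iA := contS_integrable (cS _ sA).
  have [M AM] := contS_bounded (cS _ sA).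
  have mpA := measurable_pot d_ge3 mA iA.
  have pAM y : S y -> `|pot A y| <= M by move=> Sy; exact: (pot_bounded d_ge3 mA AM Sy).
  have ikp : omega.-integrable S (EFin \o (fun x => k x * pot A x)).
    by apply: (integrable_mulb mS ik _ pAM); exact: measurable_funTS.
  have ipkp : omega.-integrable S (EFin \o (fun x => pot k x * pot A x)).
    by apply: (integrable_mulb mS ipk _ pAM); exact: measurable_funTS.
  have cphi := cS _ sphi.
  rewrite (@eq_Rintegral _ _ _ _ _ (fun x => pot k x * pot A x + sigma * (k x * pot A x))); last first.
    by move=> x _; rewrite [RHS]addrC /b mulrDl [RHS]addrC mulrA.
  rewrite RintegralD//; last exact: iZ.
  rewrite RintegralZl// (pot_sym d_ge3 mk ik mpA pAM) -(pot_sym d_ge3 mk ik mA AM).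
  have -> : \int[omega]_(x in S) (k x * pot (pot A) x) = c ^+ 2 * \int[omega]_(x in S) (k x * phi x).
    rewrite -RintegralZl//; last exact: integrable_mul_contS.
    apply: ae_eq_RintegralS.
    - apply: measurable_funM => //; apply: (measurable_pot d_ge3 mpA).
      exact: (pot_integrable d_ge3 mA iA).
    - by apply: measurable_funM => //; apply: measurable_funM => //; exact: smooth_measurable.
    - by apply: filterS (pot_pot sphi) => x px Sx; rewrite -/A in px; rewrite (px Sx) mulrCA.
  have -> : \int[omega]_(x in S) (pot k x * A x) = c ^+ 2 * \int[omega]_(x in S) (pot k x * phi x).
    rewrite (@eq_Rintegral _ _ _ _ _ (fun x => c ^+ 2 * (pot k x * phi x) - pot k x * lap phi x)); last first.
      by move=> x _; rewrite /A mulrBr; congr (_ - _); exact: mulrCA.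
    rewrite RintegralB//; [|by apply: iZ; exact: integrable_mul_contS
      |by apply: integrable_mul_contS => //; exact: cS].
    by rewrite H0 subr0 RintegralZl//; exact: integrable_mul_contS.
  have B0 : \int[omega]_(x in S) (b x * phi x) = 0.
    apply: ae_eq0_RintegralS; first by apply: measurable_funM => //; exact: smooth_measurable.
    apply: filterS bO => x bx Sx; have [/KO Ox|Kx] := pselect (K x).
      by rewrite /b bx ?mul0r.
    by rewrite phi0 ?mulr0.
  move: B0; rewrite bE//; set I := Rintegral _ _ _; set J := Rintegral _ _ _ => B0.
  have ss : sigma * sigma = 1 by case: sig => [->|[-> _]]; ring.
  have -> : c ^+ 2 * J + sigma * (c ^+ 2 * I) =
      sigma * c ^+ 2 * (I + sigma * J) + (1 - sigma * sigma) * c ^+ 2 * J.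
    by move: (I) (J) => p q; ring.
  by rewrite B0 ss subrr mulr0 !mul0r addr0.
apply: eigenfun_density => // l e ee.
have ce := contS_eigenfun ee; have [se _ e0] := ee.
have : \int[omega]_(x in S) (b x * e x) = 0.
  apply: ae_eq0_RintegralS; first by apply: measurable_funM => //; exact: smooth_measurable.
  by apply: filterS b0 => x bx Sx; rewrite bx ?mul0r.
rewrite bE// (pot_mul_eigenfun ee mk ik) -mulrDl => /eqP; rewrite mulf_eq0 => /orP[|/eqP//].
have lc : 0 < l%:R + c by rewrite ltr_wpDl.
case: sig => [->|[-> k0]] => [/eqP E|].
  by exfalso; have := addr_gt0 (divr_gt0 c0 lc) ltr01; rewrite E ltxx.
rewrite subr_eq0 => /eqP /(congr1 (fun t => t * (l%:R + c))).
rewrite divfK ?gt_eqF// mul1r => /eqP.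
rewrite -subr_eq0 opprD addrCA subrr addr0 oppr_eq0 pnatr_eq0 => /eqP l0.
have [t et] := e0 l0.
rewrite et; rewrite (@eq_Rintegral _ _ _ _ _ (fun x => t * k x)); last by move=> x _; rewrite mulrC.
by rewrite RintegralZl// k0 mulr0.
Qed.

End injectivity.

(** * Weak surface gradients and the Hardy fields *)

Section square_integrable.
Context {R : realType} {d : nat}.
Local Notation V := 'rV[R]_d.
Local Notation S := (@sphere R d).
Let mS := @measurable_sphere R d.

Lemma L2_measurable (f : V -> R) : L2 f -> measurable_fun setT f.
Proof. by move=> /L2P[]. Qed.

Lemma L2_integrable (f : V -> R) : L2 f -> omega.-integrable S (EFin \o f).
Proof.
move=> Lf; apply: (integrableS measurableT) => //; apply/Lfun1_integrable.
by apply: Lfun_subset12 => //; exact: fin_num_measure.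
Qed.

Lemma L2_sqr (f : V -> R) : measurable_fun setT f ->
  omega.-integrable setT (EFin \o (fun x => f x ^+ 2)) -> L2 f.
Proof.
move=> mf /integrableP[_ foo]; apply/L2P; split => //.
rewrite /finite_norm unlock /=; apply: poweR_lty.
apply: le_lt_trans foo; rewrite le_eqVlt; apply/orP; left; apply/eqP.
apply: eq_integral => x _ /=.
by rewrite [in RHS]ger0_norm ?sqr_ge0// powR_mulrn// real_normK ?num_real.
Qed.

(* The bound is shaped to cover affine combinations and products with bounded
   functions at once. *)
Lemma L2_dominated (f g w : V -> R) (K : R) : 0 <= K -> L2 f -> L2 g -> measurable_fun setT w ->
  {ae omega, forall x, S x -> `|w x| <= K * (`|f x| + `|g x| + 1)} -> L2 w.
Proof.
move=> K0 Lf Lg mw wK; apply: L2_sqr => //.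
have f2 := Lfun2_integrable_sqr Lf; have g2 := Lfun2_integrable_sqr Lg.
have i1 : (@omega R d).-integrable setT (EFin \o (fun _ : V => 1 : R)).
  apply: (integrableST _).1; first by apply/measurable_EFinP.
  exact: (contS_integrable (@contS_cst R d 1)).
(* The [3] comes from [(p + q + 1)^2 <= 3 (p^2 + q^2 + 1)]. *)
pose h x : R := 3 * K ^+ 2 * (f x ^+ 2 + g x ^+ 2 + 1).
have ih : omega.-integrable setT (EFin \o h).
  rewrite (_ : _ \o _ = fun x => ((3 * K ^+ 2)%:E *
    ((EFin \o (fun x => (f x ^+ 2)%R)) x + (EFin \o (fun x => (g x ^+ 2)%R)) x + (EFin \o (fun _ : V => 1%R)) x))%E).
    apply: integrableZl => //; apply: integrableD => //; exact: integrableD.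
  by apply/funext => x; rewrite /h/= !EFinM !EFinD.
have mw2 : measurable_fun setT (EFin \o (fun x => w x ^+ 2)).
  by apply/measurable_EFinP; exact: measurable_funX.
have /integrableP[mh hoo] := ih.
apply/integrableP; split => //; apply: le_lt_trans hoo.
apply: ae_ge0_le_integral => //; [exact: measurableT_comp|exact: measurableT_comp|].
move: wK (@ae_sphere R d); apply: filterS2 => x wx Sx _; rewrite /= lee_fin.
have h0 : 0 <= h x.
  by apply: mulr_ge0; [rewrite mulr_ge0 ?sqr_ge0|rewrite !addr_ge0 ?sqr_ge0].
rewrite (ger0_norm (sqr_ge0 _)) (ger0_norm h0).
have {}wx := wx Sx.
rewrite -(real_normK (num_real (w x))).
apply: (@le_trans _ _ ((K * (`|f x| + `|g x| + 1)) ^+ 2)).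
  by rewrite ler_pXn2r// nnegrE mulr_ge0// !addr_ge0.
rewrite exprMn /h [leRHS](_ : _ = K ^+ 2 * (3 * (f x ^+ 2 + g x ^+ 2 + 1))); last by ring.
apply: ler_wpM2l; first exact: sqr_ge0.
rewrite -(real_normK (num_real (f x))) -(real_normK (num_real (g x))).
move: `|f x| `|g x| => p q.
rewrite -subr_ge0 (_ : _ - _ = (p - q) ^+ 2 + (p - 1) ^+ 2 + (q - 1) ^+ 2); last by ring.
by rewrite !addr_ge0 ?sqr_ge0.
Qed.

Lemma L2_cst (e : R) : L2 (fun _ : V => e).
Proof.
apply: L2_sqr => //; apply: (integrableST _).1; first by apply/measurable_EFinP.
exact: (contS_integrable (@contS_cst R d (e ^+ 2))).
Qed.

Lemma L2_affine (a b e : R) (f g : V -> R) : L2 f -> L2 g -> L2 (fun x => a * f x + b * g x + e).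
Proof.
move=> Lf Lg; have mf := L2_measurable Lf; have mg := L2_measurable Lg.
apply: (@L2_dominated f g _ (`|a| + `|b| + `|e|)) => //.
  by apply: measurable_funD => //; apply: measurable_funD; exact: measurable_funM.
apply: aeW => x _; apply: le_trans (ler_normD _ _) _.
apply: le_trans (lerD (ler_normD _ _) (lexx _)) _; rewrite !normrM.
have := normr_ge0 a; have := normr_ge0 b; have := normr_ge0 e.
have := normr_ge0 (f x); have := normr_ge0 (g x).
move: `|a| `|b| `|e| `|f x| `|g x| => A' B' E' p q p0 q0 E0 B0 A0.
rewrite -subr_ge0 (_ : _ - _ = A' * q + A' + B' * p + B' + E' * p + E' * q); last by ring.
by rewrite !addr_ge0 ?mulr_ge0.
Qed.

Lemma L2_ae_eq (f w : V -> R) : L2 f -> measurable_fun setT w ->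
  {ae omega, forall x, S x -> w x = f x} -> L2 w.
Proof.
move=> Lf mw wf; apply: (@L2_dominated f f _ 1) => //.
apply: filterS wf => x h Sx; rewrite h// mul1r -addrA lerDl addr_ge0//.
Qed.

Lemma L2_mulS (f v : V -> R) (K : R) : L2 f -> measurable_fun setT v ->
  (forall x, S x -> `|v x| <= K) -> L2 (fun x => f x * v x).
Proof.
move=> Lf mv vK.
apply: (@L2_dominated f f _ `|K|) => //.
  by apply: measurable_funM => //; exact: L2_measurable.
apply: aeW => x Sx; rewrite normrM mulrC; apply: ler_pM => //.
  by apply: le_trans (vK x Sx) (ler_norm _).
by rewrite -addrA lerDl addr_ge0.
Qed.

Lemma dot_integrable (G U : V -> V) : L2v G -> (forall i, contS (fun x => U x 0 i)) ->
  omega.-integrable S (EFin \o (fun x => dot (G x) (U x))).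
Proof.
move=> LG cU; rewrite (_ : _ \o _ = fun x => (\sum_i (EFin \o (fun x => (G x 0 i * U x 0 i)%R)) x)%E).
  apply: integrable_sum => // i _; apply: integrable_mul_contS => //.
  exact: L2_integrable.
by apply/funext => x; rewrite /dot /= sumEFin.
Qed.

End square_integrable.

Section surface_gradient.
Context {R : realType} {d : nat}.
Local Notation V := 'rV[R]_d.
Local Notation S := (@sphere R d).

(** Outside its support [phi] vanishes near [x] on the sphere only, not in space. Rotations keep to
    the sphere, so the derivatives along them vanish, and these span the surface gradient. *)
Lemma sg_sphere_support phi x i : smooth phi -> S x -> ~ sphere_support phi x -> sg i phi x = 0.
Proof.
move=> /smooth_on_setT sphi Sx nx; rewrite sg_angular//; apply: big1 => j ji.
suff -> : angular j i phi x = 0 by rewrite mulr0.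
have dphi : differentiable phi (plane_rot j i 0 x) by exact: smooth_on_diff sphi _.
have [_] := is_derive_rot ji dphi.
rewrite plane_rot0 expr0n addr0 divr1 => D.
have nN : nbhs x (fun z => ~ (S z /\ phi z <> 0)).
  apply: contrapT => H; apply: nx => N nN; apply: contrapT => H'; apply: H.
  by apply: filterS nN => z Nz Az; apply: H'; exists z.
have cr : {for (0 : R), continuous (fun t : R => plane_rot j i t x)}.
  rewrite /plane_rot; apply: continuousD; first exact: cst_continuous.
  apply: continuousZ.
    apply: continuousM; first by apply: continuousM; [exact: cst_continuous|exact: cvg_id].
    apply: continuousV; first by rewrite expr0n addr0 oner_eq0.
    by apply: continuousD; [exact: cst_continuous|exact: exprn_continuous].
  apply: continuousD; (apply: continuousZ; last exact: cst_continuous).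
    apply: continuousB; last exact: cst_continuous.
    by apply: continuousM; [apply: continuousN; exact: cvg_id|exact: cst_continuous].
  apply: continuousB; first exact: cst_continuous.
  by apply: continuousM; [exact: cvg_id|exact: cst_continuous].
have : \forall t \near (0 : R), ~ (S (plane_rot j i t x) /\ phi (plane_rot j i t x) <> 0).
  have nN0 : nbhs (plane_rot j i 0 x) (fun z => ~ (S z /\ phi z <> 0)) by rewrite plane_rot0.
  exact: (cr _ nN0).
move=> n0.
have : 'D_1 (fun s => phi (plane_rot j i s x)) (0 : R) = 0.
  rewrite (near_eq_derive _ (g := cst 0)) ?derive_cst//.
  apply: filterS n0 => t nt; apply: contrapT => p0; apply: nt; split => //.
  by apply/(sphere_rot t x ji).
by rewrite D => /eqP; rewrite mulf_eq0 pnatr_eq0 /= => /eqP.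
Qed.

End surface_gradient.

Section weak_gradient.
Context {R : realType} {d : nat}.
Local Notation V := 'rV[R]_d.
Local Notation S := (@sphere R d).
Let mS := @measurable_sphere R d.

Lemma dot_normal_sgrad (phi : V -> R) x : S x -> dot x (sgrad phi x) = 0.
Proof. by move=> Sx; exact: sum_sg_normal. Qed.

Lemma smooth_tangent_sgrad (phi : V -> R) : smooth_on setT phi -> smooth_tangent (sgrad phi).
Proof.
move=> sphi; split=> [i|x Sx]; last exact: dot_normal_sgrad.
by apply/smooth_on_setT; apply: smooth_on_sg => //; exact: openT.
Qed.

Lemma contS_tangent (U : V -> V) i : smooth_tangent U -> contS (fun x => U x 0 i).
Proof.
by move=> [sU _]; apply: (contS_smooth (@subsetT _ _)); apply/smooth_on_setT.
Qed.

Lemma smooth_sdiv (U : V -> V) : smooth_tangent U -> smooth_on setT (sdiv U).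
Proof.
move=> [sU _]; apply: smooth_on_sum => [|i]; first exact: openT.
by apply: smooth_on_sg; [exact: openT|apply/smooth_on_setT].
Qed.

Lemma contS_sdiv (U : V -> V) : smooth_tangent U -> contS (sdiv U).
Proof. by move=> /smooth_sdiv; exact: contS_smooth. Qed.

(** The curvature terms of [intS_sg] add up to a multiple of [x . U], which is [0] for a tangent
    field. *)
Lemma int_sdiv (U : V -> V) : smooth_tangent U -> \int[omega]_(x in S) sdiv U x = 0.
Proof.
move=> tU; have [sU U0] := tU; have oT := @openT V.
have s1 i : smooth_on setT (fun y => U y 0 i) by apply/smooth_on_setT.
have cS (f : V -> R) : smooth_on setT f -> contS f by move=> sf; exact: (contS_smooth (@subsetT _ _) sf).
rewrite (@intS_sum R d _ _ (fun i => sg i (fun y => U y 0 i))); last first.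
  by move=> i; apply: cS; exact: smooth_on_sg.
rewrite (eq_bigr (fun i => (d%:R - 1) * \int[omega]_(x in S) (x 0 i * U x 0 i))); last first.
  by move=> i _; rewrite (intS_sg oT (@subsetT _ _)).
rewrite -mulr_sumr -(@intS_sum R d _ _ (fun i x => x 0 i * U x 0 i)); last first.
  by move=> i; apply: contSM; [exact: contS_coord|exact: cS].
rewrite (@eq_Rintegral _ _ _ _ _ (cst 0)); first by rewrite Rintegral_cst ?mul0r ?mulr0.
by move=> x /set_mem Sx; exact: U0.
Qed.

Lemma dot_lin (a b : R) (u v w : V) : dot (a *: u + b *: v) w = a * dot u w + b * dot v w.
Proof. by rewrite dotDl !dotZl. Qed.

Lemma RintS_lin (a b : R) (f g : V -> R) (A : set V) : measurable A -> A `<=` S ->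
  omega.-integrable S (EFin \o f) -> omega.-integrable S (EFin \o g) ->
  \int[omega]_(x in A) (a * f x + b * g x) =
  a * \int[omega]_(x in A) f x + b * \int[omega]_(x in A) g x.
Proof.
move=> mA AS /(integrableS mS mA AS) iF /(integrableS mS mA AS) iG.
have iZ (t : R) (h : V -> R) : omega.-integrable A (EFin \o h) ->
    omega.-integrable A (EFin \o (fun x => t * h x)).
  move=> ih; rewrite (_ : _ \o _ = fun x => (t%:E * (EFin \o h) x)%E); last exact/funext.
  exact: integrableZl.
by rewrite RintegralD//; [rewrite !RintegralZl|exact: iZ..].
Qed.

Lemma L2v_lin (a b : R) (F G : V -> V) : L2v F -> L2v G -> L2v (fun x => a *: F x + b *: G x).
Proof.
move=> LF LG i; rewrite (_ : (fun x => _) = fun x => a * F x 0 i + b * G x 0 i + 0).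
  exact: L2_affine.
by apply/funext => x; rewrite !mxE addr0.
Qed.

(** An almost everywhere hypothesis on [w], because layer potentials are linear only where the
    integrals exist. The constant [e] contributes nothing by [int_sdiv]. *)
Lemma weak_sgrad_lin (a b e : R) (u v w : V -> R) (G H : V -> V) :
  weak_sgrad u G -> weak_sgrad v H -> measurable_fun setT w ->
  {ae omega, forall x, S x -> w x = a * u x + b * v x + e} ->
  weak_sgrad w (fun x => a *: G x + b *: H x).
Proof.
move=> [Lu LG tG uG] [Lv LH tH vH] mw wE.
have La : L2 (fun x => a * u x + b * v x + e) by exact: L2_affine.
have Lw : L2 w by exact: L2_ae_eq wE.
split => //; first exact: L2v_lin.
  move: tG tH; apply: filterS2 => x Gx Hx Sx.
  by rewrite dotC dot_lin !(dotC _ (normal x)) Gx ?Hx// !mulr0 addr0.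
move=> U tU; have cU i : contS (fun x => U x 0 i) by exact: contS_tangent.
have cs : contS (sdiv U) by exact: contS_sdiv.
have iG := dot_integrable LG cU; have iH := dot_integrable LH cU.
rewrite (@eq_Rintegral _ _ _ _ _ (fun x => a * dot (G x) (U x) + b * dot (H x) (U x))); last first.
  by move=> x _; rewrite dot_lin.
rewrite RintS_lin// uG// vH//.
have iu := integrable_mul_contS (L2_integrable Lu) cs.
have iv := integrable_mul_contS (L2_integrable Lv) cs.
have isd := contS_integrable cs.
have ms : measurable_fun setT (sdiv U) by apply: smooth_measurable; exact: smooth_sdiv.
rewrite (@ae_eq_RintegralS _ _ (fun x => w x * sdiv U x)
    (fun x => 1 * (a * (u x * sdiv U x) + b * (v x * sdiv U x)) + e * sdiv U x)).
- rewrite RintS_lin// ?RintS_lin// ?int_sdiv//; first by ring.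
  rewrite (_ : (fun x => a * (u x * sdiv U x) + b * (v x * sdiv U x)) =
    fun x => (a * u x + b * v x + 0) * sdiv U x).
    by apply: integrable_mul_contS => //; apply: L2_integrable; exact: L2_affine.
  by apply/funext => x; ring.
- exact: measurable_funM.
- have mu := L2_measurable Lu; have mv := L2_measurable Lv.
  by apply: measurable_funD; apply: measurable_funM => //; apply: measurable_funD;
    apply: measurable_funM => //; exact: measurable_funM.
- by apply: filterS wE => x wx Sx; rewrite wx//; ring.
Qed.

Lemma weak_sgrad_unique (u v : V -> R) (G H : V -> V) :
  weak_sgrad u G -> weak_sgrad v H -> {ae omega, forall x, S x -> u x = v x} ->
  {ae omega, forall x, S x -> G x = H x}.
Proof.
move=> [Lu LG tG uG] [Lv LH tH vH] uv.
have E U : smooth_tangent U ->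
    \int[omega]_(x in S) dot (G x) (U x) = \int[omega]_(x in S) dot (H x) (U x).
  move=> tU; rewrite uG// vH//; congr (- _).
  have ms : measurable_fun setT (sdiv U) by apply: smooth_measurable; exact: smooth_sdiv.
  apply: ae_eq_RintegralS.
  - by apply: measurable_funM => //; exact: L2_measurable.
  - by apply: measurable_funM => //; exact: L2_measurable.
  - by apply: filterS uv => x h Sx; rewrite h.
have mdot (F U : V -> V) : L2v F -> smooth_tangent U -> measurable_fun setT (fun x => dot (F x) (U x)).
  move=> LF [sU _]; apply: measurable_sum => i; apply: measurable_funM; first exact: L2_measurable.
  by apply: smooth_measurable; apply/smooth_on_setT.
suff K i : {ae omega, forall x, S x -> G x 0 i - H x 0 i = 0}.
  have : {ae @omega R d, forall x (i : 'I_d), S x -> G x 0 i - H x 0 i = 0}.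
    have : forall k : nat, {ae @omega R d, forall x, forall i : 'I_d, i = k :> nat -> S x -> G x 0 i - H x 0 i = 0}.
      move=> k; have [kd|dk] := ltnP k d; last by apply: aeW => x i ik; have := ltn_ord i; rewrite ik ltnNge dk.
      apply: filterS (K (Ordinal kd)) => x h i ik; suff -> : i = Ordinal kd by [].
      exact: val_inj.
    by move=> /ae_foralln; apply: filterS => x h i; exact: (h i i).
  apply: filterS => x h Sx; apply/rowP => i; apply/eqP; rewrite -subr_eq0; apply/eqP; exact: h.
pose D x := G x 0 i - H x 0 i.
have iD : omega.-integrable S (EFin \o D).
  have := L2_integrable (L2_affine 1 (-1) 0 (LG i) (LH i)).
  rewrite (_ : (fun x => _) = D)//; apply/funext => x; rewrite /D; ring.
apply: (sphere_moments_eq0 iD) => s.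
pose psi (x : V) : R := \prod_(k <- s) x 0 k.
have spsi : smooth_on setT psi by apply: hpoly_smooth; exact: hpoly_prod.
(* The tangential projection of [e_i] times a monomial. Paired with a tangent field it returns the
   component [i] times the monomial, so all moments of [D] vanish. *)
pose U x : V := psi x *: (delta_mx 0 i - x 0 i *: x).
have tU : smooth_tangent U.
  split=> [k|x /sphereP x1]; last first.
    by rewrite /U dotZr dotBr dotZr x1 dot_delta mulr1 subrr mulr0.
  rewrite (_ : (fun x => _) = fun x => psi x * ((k == i)%:R - x 0 i * x 0 k)).
    have oT := @openT V.
    apply/smooth_on_setT; apply: smooth_onM => //; apply: smooth_onB => //; first exact: smooth_on_cst.
    by apply: smooth_onM => //; exact: smooth_on_coord.
  by apply/funext => x; rewrite !mxE eqxx.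
have dU (F : V -> V) x : S x -> dot (normal x) (F x) = 0 -> dot (F x) (U x) = F x 0 i * psi x.
  rewrite /normal => Sx Fx; rewrite /U dotZr dotBr dotZr dot_delta (dotC (F x) x) Fx.
  by rewrite mulr0 subr0 mulrC.
have LU := E U tU.
have : \int[omega]_(x in S) (1 * dot (G x) (U x) + (-1) * dot (H x) (U x)) = 0.
  rewrite RintS_lin// ?LU; first by ring.
  - by apply: dot_integrable => // k; exact: contS_tangent.
  - by apply: dot_integrable => // k; exact: contS_tangent.
move=> <-; apply: ae_eq_RintegralS.
- apply: measurable_funM; last exact: smooth_measurable.
  by apply: measurable_funB; exact: L2_measurable.
- by apply: measurable_funD; apply: measurable_funM => //; exact: mdot.
- move: tG tH; apply: filterS2 => x Gx Hx Sx.
  by rewrite !dU ?Gx ?Hx// /D -/(psi x); ring.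
Qed.

End weak_gradient.

(** * Layer potentials of affine combinations and the fields they generate *)

Section layer_affine.
Context {R : realType} {d : nat} (d_ge3 : (3 <= d)%N).
Local Notation V := 'rV[R]_d.
Local Notation S := (@sphere R d).
Let mS := @measurable_sphere R d.
Implicit Types (f g : V -> R) (a b e t : R) (F G H : V -> V).

Lemma pot_affine a b e f g : L2 f -> L2 g ->
  {ae omega, forall x, S x -> pot (fun y => a * f y + b * g y + e) x = a * pot f x + b * pot g x + e}.
Proof.
move=> Lf Lg.
have mf := L2_measurable Lf; have mg := L2_measurable Lg.
have if' := L2_integrable Lf; have ig := L2_integrable Lg.
have Lh := L2_affine a b 0 Lf Lg; have Le := @L2_cst R d e.
have := pot_lin d_ge3 1 1 (L2_measurable Lh) (L2_integrable Lh) (L2_measurable Le) (L2_integrable Le).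
have := pot_lin d_ge3 a b mf if' mg ig.
apply: filterS2 => x h1 h2 Sx.
rewrite (_ : (fun y => _) = fun y => 1 * (a * f y + b * g y + 0) + 1 * e); last first.
  by apply/funext => y; rewrite !mul1r addr0.
rewrite h2// (_ : (fun y => _) = fun y => a * f y + b * g y); last by apply/funext => y; rewrite addr0.
by rewrite h1// pot_cst// !mul1r.
Qed.

Lemma measurable_layerS f : L2 f -> measurable_fun setT (layerS f).
Proof.
move=> Lf; rewrite (funext (layerSE f)); apply: measurable_funM => //.
exact: (measurable_pot d_ge3 (L2_measurable Lf) (L2_integrable Lf)).
Qed.

Lemma ae_layerK f : L2 f -> {ae omega, forall x, S x -> layerK f x = 2^-1 * pot f x}.
Proof. by move=> Lf; apply: layerKE => //; [exact: L2_measurable|exact: L2_integrable]. Qed.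

Lemma layerK_affine a b e f g : L2 f -> L2 g ->
  {ae omega, forall x, S x -> layerK (fun y => a * f y + b * g y + e) x =
    a * layerK f x + b * layerK g x + 2^-1 * e}.
Proof.
move=> Lf Lg; have Lh := L2_affine a b e Lf Lg.
have H12 : {ae omega, forall x, S x -> layerK f x = 2^-1 * pot f x /\ layerK g x = 2^-1 * pot g x}.
  by move: (ae_layerK Lf) (ae_layerK Lg); apply: filterS2 => x h1 h2 Sx; split; [exact: h1|exact: h2].
move: (pot_affine a b e Lf Lg) (ae_layerK Lh) H12; apply: filterS3 => x h1 h2 h3 Sx.
have [h3f h3g] := h3 Sx.
by rewrite h2// h3f h3g h1//; move: (pot f x) (pot g x) => p q; ring.
Qed.

Lemma weak_sgrad_layerS a b e f g G H : L2 f -> L2 g ->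
  weak_sgrad (layerS f) G -> weak_sgrad (layerS g) H ->
  weak_sgrad (layerS (fun y => a * f y + b * g y + e)) (fun x => a *: G x + b *: H x).
Proof.
move=> Lf Lg wG wH; have Lh := L2_affine a b e Lf Lg.
apply: (weak_sgrad_lin (e := - (d%:R - 2)^-1 * e) wG wH (measurable_layerS Lh)).
apply: filterS (pot_affine a b e Lf Lg) => x h Sx.
by rewrite !layerSE h//; ring.
Qed.

(* [F] represents [B_+ f] for [t = - 1/2] and [B_- f] for [t = 1/2]. *)
Definition layer_field t f F G := [/\ L2v F, weak_sgrad (layerS f) G &
  {ae omega, forall x, S x -> F x = (layerK f x + t * f x) *: x + G x}].

Lemma Bplus_field f F : Bplus f F -> L2_zero_mean f /\ exists G, layer_field (- 2^-1) f F G.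
Proof.
move=> [Lf LF [G wG FE]]; split => //; exists G; split => //.
by apply: filterS FE => x h Sx; rewrite h// mulNr.
Qed.

Lemma Bminus_field f F : Bminus f F -> L2 f /\ exists G, layer_field 2^-1 f F G.
Proof.
move=> [Lf LF [G wG FE]]; split => //; exists G; split => //.
by apply: filterS FE => x h Sx; rewrite h.
Qed.

Lemma field_Bplus f F G : L2_zero_mean f -> layer_field (- 2^-1) f F G -> Bplus f F.
Proof.
move=> Lf [LF wG FE]; split => //; exists G => //.
by move: FE (@ae_sphere R d); apply: filterS2 => x h Sx _; rewrite h// mulNr.
Qed.

Lemma field_Bminus f F G : L2 f -> layer_field 2^-1 f F G -> Bminus f F.
Proof.
move=> Lf [LF wG FE]; split => //; exists G => //.
by move: FE (@ae_sphere R d); apply: filterS2 => x h Sx _; rewrite h.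
Qed.

(** Square integrability of the normal part needs no estimate on the kernel: [weak_sgrad] includes
    that of [layerS f], and [pot f] is a multiple of it. *)
Lemma layer_field_exists t f G : L2 f -> weak_sgrad (layerS f) G ->
  exists F, layer_field t f F G.
Proof.
move=> Lf wG; have [LS LG _ _] := wG.
have d2 : d%:R - 2 != 0 :> R.
  by rewrite -natrB ?(ltnW d_ge3)// pnatr_eq0 subn_eq0 -ltnNge.
have Lp : L2 (pot f).
  rewrite (_ : pot f = fun x => - (d%:R - 2) * layerS f x + 0 * f x + 0); first exact: L2_affine.
  by apply/funext => x; rewrite layerSE; field.
pose v x := 2^-1 * pot f x + t * f x + 0.
have Lv : L2 v by exact: L2_affine.
exists (fun x => v x *: x + G x); split => //.
  move=> i; rewrite (_ : (fun x => _) = fun x : V => 1 * (v x * x 0 i) + 1 * G x 0 i + 0); last first.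
    by apply/funext => x; rewrite !mxE !mul1r addr0.
  apply: L2_affine => //; apply: (L2_mulS (K := 1)) => //; first exact: measurable_rV_coord.
  by move=> x; exact: sphere_coord_le1.
by apply: filterS (ae_layerK Lf) => x h Sx; rewrite h// /v addr0.
Qed.

Lemma layer_field_dot t f F G : layer_field t f F G ->
  {ae omega, forall x, S x -> dot x (F x) = layerK f x + t * f x}.
Proof.
move=> [_ [_ _ tG _] FE]; move: tG FE; apply: filterS2 => x Gx Fx Sx.
rewrite Fx// dotDr dotZr (sphereP x).1// mulr1 [X in _ + X](_ : _ = 0) ?addr0//.
exact: Gx.
Qed.

Lemma layer_field_tangent t f F G : layer_field t f F G ->
  {ae omega, forall x, S x -> forall phi : V -> R, dot (F x) (sgrad phi x) = dot (G x) (sgrad phi x)}.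
Proof.
move=> [_ _ FE]; apply: filterS FE => x Fx Sx phi.
by rewrite Fx// dotDl dotZl dot_normal_sgrad// mulr0 add0r.
Qed.

End layer_affine.

(** * The conditions on [Sigma] in terms of densities *)

Section sigma.
Context {R : realType} {d : nat} (d_ge3 : (3 <= d)%N).
Local Notation V := 'rV[R]_d.
Local Notation S := (@sphere R d).
Let mS := @measurable_sphere R d.
Variable O : set V.
Hypothesis oO : open O.
Let Sg : set V := S `&` O.
Implicit Types (f g : V -> R) (a b e t : R) (F G H : V -> V).

Let mSg : measurable Sg.
Proof. by apply: measurableI => //; exact: open_measurable_rV. Qed.

Let SgS : Sg `<=` S. Proof. by move=> x []. Qed.

Lemma Rintegral_off f : (forall x, S x -> ~ O x -> f x = 0) ->
  \int[omega]_(x in S) f x = \int[omega]_(x in Sg) f x.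
Proof.
move=> f0; rewrite /Sg Rintegral_mkcondr; apply: eq_Rintegral => x /set_mem Sx.
by rewrite patchE; case: ifPn => // /negP Ox; apply: f0 => // H; apply: Ox; rewrite inE.
Qed.

Lemma test_function_smooth phi : test_function Sg phi -> smooth_on setT phi.
Proof. by move=> [/smooth_on_setT]. Qed.

Lemma test_function_off phi x : test_function Sg phi -> S x -> ~ O x -> sgrad phi x = 0.
Proof.
move=> [sphi _ sub] Sx Ox; apply/rowP => i; rewrite [RHS]mxE.
by apply: sg_sphere_support => // /sub[].
Qed.

Lemma test_function_sub phi : test_function Sg phi -> test_function S phi.
Proof. by move=> [? ? sub]; split => // x /sub[]. Qed.

Lemma test_function_compact phi (K : set V) : smooth_on setT phi -> closed K -> K `<=` O ->
  (forall x, ~ K x -> phi x = 0) -> test_function Sg phi.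
Proof.
move=> /smooth_on_setT sphi cK KO phi0.
have cS : closed S by apply: compact_closed; [exact: norm_hausdorff|exact: compact_sphere].
have sub : sphere_support phi `<=` K `&` S.
  rewrite /sphere_support closureE; apply: smallest_sub; first exact: closedI.
  by move=> x [Sx px]; split => //; apply: contrapT => /phi0.
split => //.
- apply: (subclosed_compact _ compact_sphere); first exact: closed_closure.
  by move=> x /sub[].
- by move=> x /sub[/KO Ox Sx].
Qed.

Let cphi phi i : smooth_on setT phi -> contS (fun x : V => sgrad phi x 0 i).
Proof.
by move=> sphi; apply: (contS_smooth (@subsetT _ _)); apply: smooth_on_sg => //; exact: openT.
Qed.

Let mphi (F : V -> V) phi : L2v F -> smooth_on setT phi ->
  measurable_fun setT (fun x => dot (F x) (sgrad phi x)).
Proof.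
move=> LF sphi; apply: measurable_sum => i; apply: measurable_funM; first exact: L2_measurable.
by apply: smooth_measurable; apply: smooth_on_sg => //; exact: openT.
Qed.

Let ae_int (u v : V -> R) : measurable_fun setT u -> measurable_fun setT v ->
  {ae omega, forall x, S x -> u x = v x} ->
  \int[omega]_(x in Sg) u x = \int[omega]_(x in Sg) v x.
Proof.
move=> mu mv uv; rewrite /Rintegral; congr fine; apply: ae_eq_integral => //.
- by apply/measurable_EFinP; exact: measurable_funS mu.
- by apply/measurable_EFinP; exact: measurable_funS mv.
- by apply: filterS uv => x h [Sx _] /=; rewrite h.
Qed.

Lemma divfree_scale a G : L2v G -> divfree_on Sg G -> divfree_on Sg (fun x => a *: G x).
Proof.
move=> LG dG phi tphi; have sphi := test_function_smooth tphi.
have iG : omega.-integrable S (EFin \o (fun x => dot (G x) (sgrad phi x))).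
  by apply: dot_integrable => // i; exact: cphi.
rewrite (@eq_Rintegral _ _ _ _ _ (fun x => a * dot (G x) (sgrad phi x))); last first.
  by move=> x _; rewrite dotZl.
by rewrite RintegralZl ?dG ?mulr0//; exact: integrableS iG.
Qed.

Lemma layer_field_tangent_divfree f g F H G G' :
  layer_field (- 2^-1) f F G -> layer_field 2^-1 g H G' ->
  {ae omega, forall x, Sg x -> layerK f x - 2^-1 * f x + (layerK g x + 2^-1 * g x) = 0} ->
  divfree_on Sg (fun x => G x + G' x) ->
  tangent_on Sg (fun x => F x + H x) /\ divfree_on Sg (fun x => F x + H x).
Proof.
move=> fF gH rel dG; have [LF [_ LG _ _] _] := fF; have [LH [_ LG' _ _] _] := gH.
split.
  move: rel (layer_field_dot fF) (layer_field_dot gH); apply: filterS3 => x r h1 h2 Sgx.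
  have Sx := SgS Sgx; rewrite /normal dotDr h1// h2// -[RHS](r Sgx).
  by rewrite mulNr.
move=> phi tphi; have sphi := test_function_smooth tphi; rewrite -[RHS](dG _ tphi).
have LD (A B : V -> V) : L2v A -> L2v B -> L2v (fun x => A x + B x).
  move=> LA LB; have := L2v_lin 1 1 LA LB.
  by rewrite (_ : (fun x => _) = fun x => A x + B x)//; apply/funext => x; rewrite !scale1r.
apply: ae_int; [exact: mphi (LD _ _ LF LH) sphi|exact: mphi (LD _ _ LG LG') sphi|].
move: (layer_field_tangent fF) (layer_field_tangent gH); apply: filterS2 => x h1 h2 Sx.
by rewrite !dotDl h1// h2.
Qed.

(** The component [D] drops out of both conditions: it is tangent everywhere, and a test function of
    [Sigma] is also one of the sphere. *)
Lemma layer_field_relation f g F H G G' E D :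
  layer_field (- 2^-1) f F G -> layer_field 2^-1 g H G' -> tangent_divfree D ->
  E = (fun x => F x + H x + D x) %[ae omega] -> L2v E ->
  tangent_on Sg E -> divfree_on Sg E ->
  {ae omega, forall x, Sg x -> layerK f x - 2^-1 * f x + (layerK g x + 2^-1 * g x) = 0} /\
  divfree_on Sg (fun x => G x + G' x).
Proof.
move=> fF gH [LD tD dD] EE LE tE dE.
have [LF [_ LG _ _] _] := fF; have [LH [_ LG' _ _] _] := gH.
split.
  have H1 : {ae omega, forall x, Sg x -> dot x (F x) + dot x (H x) = 0}.
    move: tE tD EE; apply: filterS3 => x h1 h2 h3 Sgx; have Sx := SgS Sgx.
    have := h1 Sgx; rewrite h3// !dotDr (h2 Sx) addr0; exact.
  move: H1 (layer_field_dot fF) (layer_field_dot gH); apply: filterS3 => x h1 h2 h3 Sgx.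
  have Sx := SgS Sgx; rewrite -[RHS](h1 Sgx) h2// h3//.
  by rewrite mulNr.
move=> phi tphi; have sphi := test_function_smooth tphi.
have dDphi : \int[omega]_(x in Sg) dot (D x) (sgrad phi x) = 0.
  rewrite -Rintegral_off; first exact: dD (test_function_sub tphi).
  by move=> x Sx Ox; rewrite (test_function_off tphi)// dotC dot0l.
have iD : omega.-integrable S (EFin \o (fun x => dot (D x) (sgrad phi x))).
  by apply: dot_integrable => // i; exact: cphi.
have iE : omega.-integrable S (EFin \o (fun x => dot (E x) (sgrad phi x))).
  by apply: dot_integrable => // i; exact: cphi.
have : \int[omega]_(x in Sg) (1 * dot (E x) (sgrad phi x) + (-1) * dot (D x) (sgrad phi x)) = 0.
  by rewrite RintS_lin// dE// dDphi !mulr0 addr0.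
move=> <-; apply: ae_int.
- rewrite (_ : (fun x => _) = fun x => dot (G x) (sgrad phi x) + dot (G' x) (sgrad phi x)).
    by apply: measurable_funD; exact: mphi.
  by apply/funext => x; rewrite dotDl.
- by apply: measurable_funD; apply: measurable_funM => //; exact: mphi.
move: EE (layer_field_tangent fF) (layer_field_tangent gH); apply: filterS3 => x h0 h1 h2 Sx.
by rewrite h0// !dotDl h1// h2//; ring.
Qed.

Lemma relation_Uplus_Uminus f g G G' : L2_zero_mean f -> L2 g ->
  weak_sgrad (layerS f) G -> weak_sgrad (layerS g) G' ->
  {ae omega, forall x, Sg x -> layerK f x - 2^-1 * f x + (layerK g x + 2^-1 * g x) = 0} ->
  divfree_on Sg (fun x => G x + G' x) -> Uplus Sg f /\ Uminus Sg g.
Proof.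
move=> Zf Lg wG wG' rel dG; have [Lf f0] := Zf.
have [_ LG _ _] := wG; have [_ LG' _ _] := wG'.
have LGG : L2v (fun x => G x + G' x).
  have := L2v_lin 1 1 LG LG'.
  by rewrite (_ : (fun x => _) = fun x => G x + G' x)//; apply/funext => x; rewrite !scale1r.
split; split => //.
  exists (fun x => 1 * f x + 1 * g x + 0).
    split; first exact: L2_affine.
    exists (fun x => 1 *: G x + 1 *: G' x); first exact: weak_sgrad_layerS.
    by rewrite (_ : (fun x => _) = fun x => G x + G' x)//; apply/funext => x; rewrite !scale1r.
  move: rel (layerK_affine d_ge3 1 1 0 Lf Lg); apply: filterS2 => x r h _.
  rewrite /proj_on !patchE; case: ifPn => // /set_mem Sgx; have Sx := SgS Sgx.
  rewrite h//; apply/eqP; rewrite -subr_eq0 -oppr_eq0 -[X in _ == X](r Sgx); apply/eqP.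
  by move: (layerK f x) (layerK g x) => p q; field.
have W0 := sphere_area_gt0 d_ge3 (R := R).
(* The mean of [g]: as [f] has mean zero, adding [m] gives [- f - g] zero mean, and the operator
   [K - 1/2] does not see the constant. *)
pose m := (\int[omega]_(x in S) g x) / @sphere_area R d.
have LmG := L2_affine (-1) (-1) m Lf Lg.
exists (fun x => (-1) * f x + (-1) * g x + m); split.
- split => //; exists (fun x => (-1) *: G x + (-1) *: G' x); first exact: weak_sgrad_layerS.
  rewrite (_ : (fun x => _) = fun x => (-1) *: (G x + G' x)); first exact: divfree_scale.
  by apply/funext => x; rewrite scalerDr.
- split => //.
  have iF := L2_integrable Lf; have iG := L2_integrable Lg.
  have i1 := L2_integrable (@L2_cst R d m).
  have i2 := L2_integrable (L2_affine (-1) (-1) 0 Lf Lg).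
  rewrite (@eq_Rintegral _ _ _ _ _ (fun x => 1 * ((-1) * f x + (-1) * g x + 0) + 1 * m)); last first.
    by move=> x _; ring.
  rewrite RintS_lin// intS_cst (@eq_Rintegral _ _ _ _ _ (fun x => (-1) * f x + (-1) * g x)); last first.
    by move=> x _; rewrite addr0.
  by rewrite RintS_lin// f0 /m divfK ?gt_eqF//; ring.
move: rel (layerK_affine d_ge3 (-1) (-1) m Lf Lg); apply: filterS2 => x r h _.
rewrite /proj_on !patchE; case: ifPn => // /set_mem Sgx; have Sx := SgS Sgx.
rewrite h//; apply/eqP; rewrite -subr_eq0 -[X in _ == X](r Sgx); apply/eqP.
by move: (layerK f x) (layerK g x) => p q; field.
Qed.

(** Serves both uniqueness claims, [t] being [1/2] or [- 1/2]. Subtracting the two candidates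
    removes [E] and leaves conditions on the difference [k] of the densities; once [k = 0],
    potentials and weak gradients agree as well. *)
Lemma layer_field_unique t f f' E F F' G G' : Sg !=set0 ->
  t = 2^-1 /\ L2 f /\ L2 f' \/ t = - 2^-1 /\ L2_zero_mean f /\ L2_zero_mean f' ->
  L2v E -> layer_field t f F G -> layer_field t f' F' G' ->
  tangent_on Sg (fun x => E x + F x) -> tangent_on Sg (fun x => E x + F' x) ->
  divfree_on Sg (fun x => E x + F x) -> divfree_on Sg (fun x => E x + F' x) ->
  F' = F %[ae omega].
Proof.
move=> Sg0 tf LE fF fF' tF tF' dF dF'.
have [LF wG FE] := fF; have [LF' wG' FE'] := fF'.
have [_ LG _ _] := wG; have [_ LG' _ _] := wG'.
have [Lf Lf'] : L2 f /\ L2 f' by case: tf => [[_ []]|[_ [[] ? _ []]]].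
pose k x := 1 * f' x + (-1) * f x + 0.
have Lk : L2 k by exact: L2_affine.
pose s := 2 * t.
have sig : s = 1 \/ s = -1 /\ \int[omega]_(x in S) k x = 0.
  rewrite /s; case: tf => [[-> _]|[-> [[_ f0] [_ f'0]]]]; first by left; rewrite divff.
  right; split; first by rewrite mulrN divff.
  have iF := L2_integrable Lf; have iF' := L2_integrable Lf'.
  rewrite (@eq_Rintegral _ _ _ _ _ (fun x => 1 * f' x + (-1) * f x)); last first.
    by move=> x _; rewrite /k addr0.
  by rewrite RintS_lin// f0 f'0 !mulr0 addr0.
have wk : weak_sgrad (layerS k) (fun x => 1 *: G' x + (-1) *: G x) by exact: weak_sgrad_layerS.
have k0 : {ae omega, forall x, S x -> k x = 0}.
  apply: (pot_sign_injective d_ge3 oO Sg0 (L2_measurable Lk) (L2_integrable Lk) sig).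
    have K0 : {ae omega, forall x, Sg x -> layerK f' x + t * f' x - (layerK f x + t * f x) = 0}.
      have D0 : {ae omega, forall x, Sg x -> dot x (F' x) - dot x (F x) = 0}.
        move: tF tF'; apply: filterS2 => x h1 h2 Sgx.
        have := h1 Sgx; have := h2 Sgx; rewrite /normal !dotDr => e2 e1.
        by apply/eqP; rewrite -[X in _ == X](subrr (dot x (E x) + dot x (F x))) {1}e1 -e2; apply/eqP; ring.
      move: D0 (layer_field_dot fF) (layer_field_dot fF'); apply: filterS3 => x h1 h2 h3 Sgx.
      have Sx := SgS Sgx; by rewrite -[RHS](h1 Sgx) h2// h3.
    move: K0 (layerK_affine d_ge3 1 (-1) 0 Lf' Lf) (ae_layerK d_ge3 Lk); apply: filterS3 => x h1 h2 h3 Sx Ox.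
    have e : 2^-1 * pot k x = layerK f' x - layerK f x.
      by rewrite -h3// h2//; move: (layerK f x) (layerK f' x) => p q; ring.
    have -> : pot k x = 2 * (layerK f' x - layerK f x) by rewrite -e mulrA divff// mul1r.
    have := h1 (conj Sx Ox); rewrite /s /k; move: (layerK f x) (layerK f' x) => p q E0.
    by rewrite -[RHS](mulr0 2) -[in RHS]E0; ring.
  move=> phi sphi [K [cK KO phi0]].
  have tphi := test_function_compact sphi cK KO phi0.
  have [_ _ _ wkU] := wk.
  have d2 : d%:R - 2 != 0 :> R.
    by rewrite -natrB ?(ltnW d_ge3)// pnatr_eq0 subn_eq0 -ltnNge.
  have LGk := L2v_lin 1 (-1) LG' LG.
  have iX (A : V -> V) : L2v A -> omega.-integrable S (EFin \o (fun x => dot (A x) (sgrad phi x))).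
    by move=> LA; apply: dot_integrable => // i; exact: cphi.
  have LD (A B : V -> V) : L2v A -> L2v B -> L2v (fun x => A x + B x).
    move=> LA LB; have := L2v_lin 1 1 LA LB.
    by rewrite (_ : (fun x => _) = fun x => A x + B x)//; apply/funext => x; rewrite !scale1r.
  have Z : \int[omega]_(x in S) dot (1 *: G' x + (-1) *: G x) (sgrad phi x) = 0.
    rewrite Rintegral_off; last first.
      by move=> x Sx Ox; rewrite (test_function_off tphi)// dotC dot0l.
    have : \int[omega]_(x in Sg) (1 * dot (E x + F' x) (sgrad phi x) +
        (-1) * dot (E x + F x) (sgrad phi x)) = 0.
      rewrite (RintS_lin 1 (-1) mSg SgS (iX _ (LD _ _ LE LF')) (iX _ (LD _ _ LE LF))).
      by rewrite dF'// dF// !mulr0 addr0.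
    move=> <-; apply: ae_int; first exact: mphi LGk sphi.
      by apply: measurable_funD; apply: measurable_funM => //; apply: mphi => //; exact: LD.
    move: (layer_field_tangent fF) (layer_field_tangent fF'); apply: filterS2 => x h1 h2 Sx.
    by rewrite dot_lin !dotDl h1// h2//; ring.
  (* The surface gradient of [phi] as test field: its divergence is [lap phi], so [layerS k] is
     orthogonal to [lap phi]. *)
  have := wkU _ (smooth_tangent_sgrad sphi); rewrite Z => /esym/eqP; rewrite oppr_eq0.
  have il : omega.-integrable S (EFin \o (fun x => pot k x * lap phi x)).
    apply: integrable_mul_contS.
      exact: (pot_integrable d_ge3 (L2_measurable Lk) (L2_integrable Lk)).
    by apply: (contS_smooth (@subsetT _ _)); apply: smooth_on_lap => //; exact: openT.
  rewrite (@eq_Rintegral _ _ _ _ _ (fun x => - (d%:R - 2)^-1 * (pot k x * lap phi x))); last first.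
    by move=> x _; rewrite layerSE [RHS]mulrA.
  by rewrite RintegralZl// mulf_eq0 oppr_eq0 invr_eq0 (negbTE d2) => /eqP.
have ff' : {ae omega, forall x, S x -> f' x = f x}.
  by apply: filterS k0 => x h Sx; apply/eqP; rewrite -subr_eq0 -[X in _ == X](h Sx) /k; apply/eqP; ring.
have pk0 x : pot k x = 0.
  rewrite /pot ae_eq0_RintegralS ?mulr0//; last first.
    by apply: filterS k0 => y h Sy; rewrite (h Sy) mul0r.
  apply: measurable_funM; first exact: (L2_measurable Lk).
  exact: (measurableT_comp measurable_kern (measurable_pair1 x)).
have pp : {ae omega, forall x, S x -> pot f' x = pot f x}.
  apply: filterS (pot_affine d_ge3 1 (-1) 0 Lf' Lf) => x h Sx.
  by have := h Sx; rewrite -/k pk0 => /esym e; apply/eqP; rewrite -subr_eq0 -[X in _ == X]e; apply/eqP; ring.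
have GG : {ae omega, forall x, S x -> G' x = G x}.
  apply: (weak_sgrad_unique wG' wG).
  by apply: filterS pp => x h Sx; rewrite !layerSE h.
have KK : {ae omega, forall x, S x -> layerK f' x = layerK f x}.
  move: pp (ae_layerK d_ge3 Lf) (ae_layerK d_ge3 Lf'); apply: filterS3 => x h1 h2 h3 Sx.
  by rewrite h3// h1// h2.
have A1 : {ae omega, forall x, S x -> (layerK f' x + t * f' x) *: x + G' x = (layerK f x + t * f x) *: x + G x}.
  move: ff' GG KK; apply: filterS3 => x h1 h2 h3 Sx.
  by rewrite (h1 Sx) (h2 Sx) (h3 Sx).
have A2 : {ae omega, forall x, S x -> F' x = F x}.
  move: A1 FE FE'; apply: filterS3 => x h1 h2 h3 Sx.
  by rewrite (h3 Sx) (h1 Sx) (h2 Sx).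
by move: A2 (@ae_sphere R d); apply: filterS2 => x h Sx _; exact: h.
Qed.

End sigma.

(** * Assembly: membership, existence and uniqueness *)

Theorem theorem2p6 (R : realType) (d : nat) (d_ge3 : (3 <= d)%N)
    (Sigma : set 'rV[R]_d) (Sigma_neq0 : Sigma !=set0)
    (Sigma_open : relatively_open Sigma)
    (Sigma_proper : proper_with_closure Sigma) :
  [/\ forall F : 'rV[R]_d -> 'rV[R]_d,
        L2v F -> tangent_on Sigma F -> divfree_on Sigma F ->
        (forall Fp, hardy_component_plus F Fp -> BplusU Sigma Fp) /\
        (forall Fm, hardy_component_minus F Fm -> BminusU Sigma Fm),
      forall Fp : 'rV[R]_d -> 'rV[R]_d, BplusU Sigma Fp ->
        exists Fm : 'rV[R]_d -> 'rV[R]_d,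
          [/\ BminusU Sigma Fm,
              tangent_on Sigma (fun x => Fp x + Fm x),
              divfree_on Sigma (fun x => Fp x + Fm x) &
              forall Fm' : 'rV[R]_d -> 'rV[R]_d, BminusU Sigma Fm' ->
                tangent_on Sigma (fun x => Fp x + Fm' x) ->
                divfree_on Sigma (fun x => Fp x + Fm' x) ->
                Fm' = Fm %[ae omega]] &
      forall Fm : 'rV[R]_d -> 'rV[R]_d, BminusU Sigma Fm ->
        exists Fp : 'rV[R]_d -> 'rV[R]_d,
          [/\ BplusU Sigma Fp,
              tangent_on Sigma (fun x => Fp x + Fm x),
              divfree_on Sigma (fun x => Fp x + Fm x) &
              forall Fp' : 'rV[R]_d -> 'rV[R]_d, BplusU Sigma Fp' ->
                tangent_on Sigma (fun x => Fp' x + Fm x) ->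
                divfree_on Sigma (fun x => Fp' x + Fm x) ->
                Fp' = Fp %[ae omega]]].

Proof.
have [ O oO SE] := Sigma_open.
rewrite SE in Sigma_neq0 *.
have proj_eq (u v : 'rV[R]_d -> R) :
    proj_on (sphere `&` O) u = proj_on (sphere `&` O) v %[ae omega] ->
    {ae omega, forall x, (sphere `&` O) x -> u x = v x}.
  by apply: filterS => x h Sx; have := h I; rewrite /proj_on !patchE mem_set.
split.
- move=> F LF tF dF; split.
  + move=> Fp [Fm [D [[f Bf] [g Bg] tD FE]]].
    have [Zf [G fF]] := Bplus_field Bf; have [Lg [G' gF]] := Bminus_field Bg.
    have [rel dG] := layer_field_relation oO fF gF tD FE LF tF dF.
    have [_ wG _] := fF; have [_ wG' _] := gF.
    by have [Uf _] := relation_Uplus_Uminus d_ge3 oO Zf Lg wG wG' rel dG; exists f.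
  + move=> Fm [Fp [D [[f Bf] [g Bg] tD FE]]].
    have [Zf [G fF]] := Bplus_field Bf; have [Lg [G' gF]] := Bminus_field Bg.
    have [rel dG] := layer_field_relation oO fF gF tD FE LF tF dF.
    have [_ wG _] := fF; have [_ wG' _] := gF.
    by have [_ Ug] := relation_Uplus_Uminus d_ge3 oO Zf Lg wG wG' rel dG; exists g.
- move=> Fp [f [Zf [h [Lh [Gh wGh dGh]] /proj_eq fh]] Bf].
  have [_ [G fF]] := Bplus_field Bf; have [LFp wG _] := fF; have [Lf f0] := Zf.
  pose g x := 1 * h x + (-1) * f x + 0.
  have Lg : L2 g by exact: L2_affine.
  (* The weak gradient of [layerS g] is inherited by linearity from those given with [h] and [f]. *)
  have wg : weak_sgrad (layerS g) (fun x => 1 *: Gh x + (-1) *: G x).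
    exact: weak_sgrad_layerS.
  have rel : {ae omega, forall x, (sphere `&` O) x ->
      layerK f x - 2^-1 * f x + (layerK g x + 2^-1 * g x) = 0}.
    move: fh (layerK_affine d_ge3 1 (-1) 0 Lh Lf); apply: filterS2 => x e1 e2 Sgx.
    have [Sx _] := Sgx; rewrite (e2 Sx) /g [in LHS](e1 Sgx).
    by move: (layerK h x) (layerK f x) => p q; field.
  have dG : divfree_on (sphere `&` O) (fun x => G x + (1 *: Gh x + (-1) *: G x)).
    rewrite (_ : (fun x => _) = Gh)//; apply/funext => x.
    by rewrite scale1r scaleN1r addrC subrK.
  have [Fm gF] := layer_field_exists d_ge3 2^-1 Lg wg.
  have [_ Ug] := relation_Uplus_Uminus d_ge3 oO Zf Lg wG wg rel dG.
  have [tS dS] := layer_field_tangent_divfree oO fF gF rel dG.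
  exists Fm; split => //; first by exists g => //; exact: field_Bminus gF.
  move=> Fm' [g' [Lg' _] Bg'] t' d'; have [_ [G'' gF']] := Bminus_field Bg'.
  exact: (layer_field_unique d_ge3 oO Sigma_neq0 (or_introl (conj erefl (conj Lg Lg')))
    LFp gF gF' tS t' dS d').
move=> Fm [g [Lg [h [[Lh [Gh wGh dGh]] Zh /proj_eq gh]]] Bg].
have [_ [G gF]] := Bminus_field Bg; have [LFm wG _] := gF.
have W0 := sphere_area_gt0 d_ge3 (R := R).
have mS := @measurable_sphere R d.
(* Solves [h = m - f - g] for [f]; [m] is the mean of [g], which gives [f] mean zero because [h] has
   it. *)
pose m := (\int[omega]_(x in sphere) g x) / @sphere_area R d.
pose f x := (-1) * h x + (-1) * g x + m.
have Lf : L2 f by exact: L2_affine.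
have Zf : L2_zero_mean f.
  split => //; have [_ h0] := Zh.
  have iH := L2_integrable Lh; have iG := L2_integrable Lg.
  have i1 := L2_integrable (@L2_cst R d m).
  have i2 := L2_integrable (L2_affine (-1) (-1) 0 Lh Lg).
  rewrite (@eq_Rintegral _ _ _ _ _ (fun x => 1 * ((-1) * h x + (-1) * g x + 0) + 1 * m)); last first.
    by move=> x _; rewrite /f; ring.
  rewrite RintS_lin// intS_cst (@eq_Rintegral _ _ _ _ _ (fun x => (-1) * h x + (-1) * g x)); last first.
    by move=> x _; rewrite addr0.
  by rewrite RintS_lin// h0 /m divfK ?gt_eqF//; ring.
have wf : weak_sgrad (layerS f) (fun x => (-1) *: Gh x + (-1) *: G x).
  exact: weak_sgrad_layerS.
have rel : {ae omega, forall x, (sphere `&` O) x ->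
    layerK f x - 2^-1 * f x + (layerK g x + 2^-1 * g x) = 0}.
  move: gh (layerK_affine d_ge3 (-1) (-1) m Lh Lg); apply: filterS2 => x e1 e2 Sgx.
  have [Sx _] := Sgx; rewrite (e2 Sx) /f [in LHS](e1 Sgx).
  by move: (layerK h x) (layerK g x) => p q; field.
have dG : divfree_on (sphere `&` O) (fun x => (-1) *: Gh x + (-1) *: G x + G x).
  rewrite (_ : (fun x => _) = fun x => (-1) *: Gh x).
    by apply: divfree_scale => //; have [] := wGh.
  by apply/funext => x; rewrite scaleN1r (scaleN1r (G x)) subrK.
have [Fp fF] := layer_field_exists d_ge3 (- 2^-1) Lf wf.
have [Uf _] := relation_Uplus_Uminus d_ge3 oO Zf Lg wf wG rel dG.
have [tS dS] := layer_field_tangent_divfree oO fF gF rel dG.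
exists Fp; split => //; first by exists f => //; exact: field_Bplus fF.
have sw F : (fun x => F x + Fm x) = (fun x => Fm x + F x).
  by apply/funext => x; rewrite addrC.
move=> Fp' [f' [Zf' _] Bf']; rewrite !sw => t' d'; have [_ [G'' fF']] := Bplus_field Bf'.
rewrite !sw in tS dS.
exact: (layer_field_unique d_ge3 oO Sigma_neq0 (or_intror (conj erefl (conj Zf Zf')))
  LFm fF fF' tS t' dS d').
Qed.
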